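(* Let $G=\{G_1\rightrightarrows G_0\}$ be a Lie groupoid. The category $\mathbb{X}(G)$ of (multiplicative) vector fields on $G$, equipped with the pointwise linear structures and the Lie brackets on objects and on morphisms described in the context, is a (strict) Lie 2-algebra; that is, $\mathbb{X}(G)$ is a category internal to the category of Lie algebras.
   Context: Conventions. For a Lie groupoid $G=\{G_1\rightrightarrows G_0\}$ the source, target, unit and inversion maps are $s,t,1,i$; the product $\gamma_2\gamma_1$ is defined when $s(\gamma_2)=t(\gamma_1)$. The tangent groupoid $TG=\{TG_1\rightrightarrows TG_0\}$ is obtained by applying the tangent functor to all structure maps of $G$; its multiplication is the derivative of that of $G$. The bundle projections give a functor $\pi_G:TG\to G$. Functors and natural transformations between Lie groupoids are smooth. The category $\mathbb{X}(G)$. Objects (multiplicative vector fields): functors $v:G\to TG$ with $\pi_G\circ v=\mathrm{id}_G$. A morphism $\alpha:v\to w$ is a natural transformation $\alpha:v\Rightarrow w$ with $\pi_G(\alpha_x)=1_x$ for every $x\in G_0$. Composition is vertical composition of natural transformations. Denote by $\mathbb{X}(G)_0,\mathbb{X}(G)_1$ the sets of objects and morphisms and by $\mathfrak{s},\mathfrak{t}:\mathbb{X}(G)_1\to\mathbb{X}(G)_0$ the source and target maps, and by $\mathbf 1$ the unit map. Linear structure. An object $v$ is a pair of vector fields $(v_0,v_1)$ on $G_0,G_1$; a morphism is in particular a section of $TG_1|_{G_0}\to G_0$ (with $G_0$ embedded in $G_1$ by units). Objects and morphisms are added and scaled pointwise. Brackets. On objects: $[v,w]=([v_0,w_0],[v_1,w_1])$,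 the bracket of vector fields. The kernel $\ker\mathfrak{s}$ is the space $\Gamma(A_G)$ of sections of the Lie algebroid $A_G=\ker(Ts)|_{G_0}\to G_0$; its bracket is defined by requiring $a\mapsto\overrightarrow{a}$, $\overrightarrow{a}(\gamma)=TR_\gamma\,a(t(\gamma))$ (with $R_\gamma$ right multiplication by $\gamma$), to be a map of Lie algebras into vector fields on $G_1$. For $v\in\mathbb{X}(G)_0$ and $a\in\Gamma(A_G)$ put $D(v)a=[v_1,\overrightarrow{a}]|_{G_0}$. On morphisms: identify $\mathbb{X}(G)_1$ with $\ker\mathfrak{s}\oplus\mathbb{X}(G)_0$ by $\alpha\mapsto(\alpha-\mathbf 1_{\mathfrak{s}(\alpha)},\mathfrak{s}(\alpha))$ and set $[(a,v),(b,w)]=([a,b]+D(v)b-D(w)a,\,[v,w])$. A strict Lie 2-algebra is a category internal to the category of real Lie algebras: the objects and the morphisms form Lie algebras and all structure maps (source, target, unit, composition) are Lie algebra homomorphisms. *)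

(* Defs.v *)
From HB Require Import structures.
From mathcomp Require Import all_boot all_order all_algebra.
From mathcomp Require Import all_classical all_reals all_analysis.

Set Implicit Arguments.
Unset Strict Implicit.
Unset Printing Implicit Defensive.

Import Order.TTheory GRing.Theory Num.Theory.
Import numFieldNormedType.Exports.
Local Open Scope classical_set_scope.
Local Open Scope ring_scope.

(** * Smooth manifolds *)

Section SmoothCalculus.
Context {R : realType} {V W : normedModType R}.

Fixpoint Ck_on (k : nat) (A : set V) (f : V -> W) : Prop :=
  if k is k'.+1 then
    (forall x, A x -> differentiable f x) /\
    (forall v, Ck_on k' A (fun x => 'D_v f x))
  else forall x, A x -> {for x, continuous f}.

Definition smooth_near (x : V) (f : V -> W) : Prop :=
  exists A : set V, [/\ open A, A x & forall k, Ck_on k A f].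

End SmoothCalculus.

(* A space with a family of coordinate charts.  [coord i] is a total function,
   but only its values on [dom i] are meaningful. *)
Record chartedSpace (R : realType) := ChartedSpace {
  carrier :> topologicalType;
  dim : nat;
  chart : Type;
  dom : chart -> set carrier;
  coord : chart -> carrier -> 'rV[R]_dim }.

Record is_manifold (R : realType) (M : chartedSpace R) : Prop := IsManifold {
  manifold_hausdorff : hausdorff_space M;
  manifold_second_countable : @second_countable M;
  chart_cover : forall x : M, exists i : chart M, dom i x;
  chart_open : forall i : chart M, open (dom i);
  chart_continuous : forall (i : chart M) (x : M),
    dom i x -> {for x, continuous (coord i)};
  chart_injective : forall (i : chart M) (x y : M),
    dom i x -> dom i y -> coord i x = coord i y -> x = y;
  chart_open_map : forall (i : chart M) (U : set M),
    open U -> U `<=` dom i -> open (coord i @` U);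
  chart_compatible : forall (i j : chart M) (x : M), dom i x -> dom j x ->
    exists2 g : 'rV[R]_(dim M) -> 'rV[R]_(dim M),
      smooth_near (coord i x) g & \forall y \near x, coord j y = g (coord i y) }.

Section Smooth.
Context {R : realType}.

(* [g] represents the map in local coordinates; its values outside the image of
   the chart are irrelevant. *)
Definition smooth_at (M N : chartedSpace R) (x : M) (f : M -> N) : Prop :=
  {for x, continuous f} /\
  exists (i : chart M) (j : chart N) (g : 'rV[R]_(dim M) -> 'rV[R]_(dim N)),
    [/\ dom i x, dom j (f x), smooth_near (coord i x) g &
        \forall y \near x, coord j (f y) = g (coord i y)].

Definition smooth (M N : chartedSpace R) (f : M -> N) : Prop :=
  forall x, smooth_at x f.

Definition smooth_fun_at (M : chartedSpace R) (x : M) (f : M -> R) : Prop :=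
  exists (i : chart M) (g : 'rV[R]_(dim M) -> R^o),
    [/\ dom i x, smooth_near (coord i x) g &
        \forall y \near x, f y = g (coord i y)].

(* Only the germ of the curve at time 0 matters. *)
Definition smooth_curve (M : chartedSpace R) (c : R -> M) : Prop :=
  {for 0, continuous c} /\
  exists (j : chart M) (g : R^o -> 'rV[R]_(dim M)),
    [/\ dom j (c 0), smooth_near 0 g &
        \forall r \near (0 : R), coord j (c r) = g r].

(** * Tangent vectors and the tangent functor *)

Definition functional (M : chartedSpace R) : Type := (M -> R) -> R^o.
HB.instance Definition _ (M : chartedSpace R) :=
  GRing.Lmodule.on (functional M).

(* A tangent vector at x is the operator f |-> (f o c)'(0) attached to a smooth
   curve c through x.  The operator acts on functions that are smooth near x;
   giving it the value 0 on all other functions makes equality of tangent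
   vectors Leibniz equality. *)
Definition velocity (M : chartedSpace R) (c : R -> M) : functional M :=
  fun f => if `[< smooth_fun_at (c 0) f >]
           then derive1 (f \o c : R -> R^o) 0 else 0.

Definition tangent_vector (M : chartedSpace R) (x : M) (X : functional M) :=
  exists c : R -> M, [/\ smooth_curve c, c 0 = x & X = velocity c].

Definition pretangent (M : chartedSpace R) : Type := (M * functional M)%type.

Definition tangent_bundle (M : chartedSpace R) : Type :=
  {p : pretangent M | tangent_vector p.1 p.2}.

HB.instance Definition _ (M : chartedSpace R) :=
  gen_eqMixin (tangent_bundle M).
HB.instance Definition _ (M : chartedSpace R) :=
  gen_choiceMixin (tangent_bundle M).

Definition tangent_dom (M : chartedSpace R) (i : chart M) :
    set (tangent_bundle M) := [set p | dom i (sval p).1].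

(* (x^1, .., x^n, X x^1, .., X x^n) *)
Definition tangent_coord (M : chartedSpace R) (i : chart M)
    (p : tangent_bundle M) : 'rV[R]_(dim M + dim M) :=
  row_mx (coord i (sval p).1)
         (\row_k (sval p).2 (fun y => coord i y ord0 k)).

Definition tangent_subbase (M : chartedSpace R) : set (set (tangent_bundle M)) :=
  [set U | exists (i : chart M) (O : set 'rV[R]_(dim M + dim M)),
     open O /\ U = tangent_dom i `&` (tangent_coord i @^-1` O)].

HB.instance Definition _ (M : chartedSpace R) :=
  isSubBaseTopological.Build (tangent_bundle M) (@tangent_subbase M) id.

Definition tangent_manifold (M : chartedSpace R) : chartedSpace R :=
  @ChartedSpace R (tangent_bundle M) (dim M + dim M) (chart M)
    (@tangent_dom M) (@tangent_coord M).

Definition push (M N : chartedSpace R) (f : M -> N) (x : M) (X : functional M) :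
    functional N :=
  fun h => if `[< smooth_fun_at (f x) h >] then X (h \o f) else 0.

Definition Tmap (M N : chartedSpace R) (f : M -> N) (p : pretangent M) :
    pretangent N := (f p.1, push f p.1 p.2).

(* X is a smooth section of f^* TN; equivalently x |-> (f x, X x) is a smooth
   map M -> TN, which includes the fact that X x is tangent to N at f x. *)
Definition section_along (M N : chartedSpace R) (f : M -> N)
    (X : M -> functional N) : Prop :=
  exists2 F : M -> tangent_manifold N,
    smooth F & forall x, sval (F x) = (f x, X x).

Definition vector_field (M : chartedSpace R) (X : M -> functional M) : Prop :=
  section_along id X.

Definition vf_bracket (M : chartedSpace R) (X Y : M -> functional M) :
    M -> functional M :=
  fun x f => if `[< smooth_fun_at x f >]
             then X x (fun y => Y y f) - Y x (fun y => X y f) else 0.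

Definition submersion (M N : chartedSpace R) (f : M -> N) : Prop :=
  smooth f /\
  forall x Y, tangent_vector (f x) Y ->
    exists2 X, tangent_vector x X & push f x X = Y.

(* P, with its two projections, is the fibre product of s and t: as a set, and
   with the smooth structure for which a map into P is smooth as soon as its
   two components are. *)
Record fibre_product (M N B P : chartedSpace R) (s : M -> B) (t : N -> B)
    (p1 : P -> M) (p2 : P -> N) : Prop := FibreProduct {
  fibre_square : forall z, s (p1 z) = t (p2 z);
  fibre_pair : forall x y, s x = t y -> exists z, p1 z = x /\ p2 z = y;
  fibre_inj : forall z z', p1 z = p1 z' -> p2 z = p2 z' -> z = z';
  fibre_smooth1 : smooth p1;
  fibre_smooth2 : smooth p2;
  fibre_universal : forall (L : chartedSpace R) (c : L -> P), is_manifold L ->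
    smooth (p1 \o c) -> smooth (p2 \o c) -> smooth c }.

End Smooth.

(** * Groupoids *)

(* The product [gmul g h] is only meaningful when [gsrc g = gtgt h]. *)
Record groupoidData := GroupoidData {
  gob : Type;
  gar : Type;
  gsrc : gar -> gob;
  gtgt : gar -> gob;
  gunit : gob -> gar;
  ginv : gar -> gar;
  gmul : gar -> gar -> gar }.

Record is_groupoid (C : groupoidData) : Prop := IsGroupoid {
  gsrc_unit : forall x : gob C, gsrc (gunit x) = x;
  gtgt_unit : forall x : gob C, gtgt (gunit x) = x;
  gsrc_mul : forall g h : gar C, gsrc g = gtgt h -> gsrc (gmul g h) = gsrc h;
  gtgt_mul : forall g h : gar C, gsrc g = gtgt h -> gtgt (gmul g h) = gtgt g;
  gmulA : forall g h k : gar C, gsrc g = gtgt h -> gsrc h = gtgt k ->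
    gmul g (gmul h k) = gmul (gmul g h) k;
  gmul1l : forall g : gar C, gmul (gunit (gtgt g)) g = g;
  gmul1r : forall g : gar C, gmul g (gunit (gsrc g)) = g;
  gsrc_inv : forall g : gar C, gsrc (ginv g) = gtgt g;
  gtgt_inv : forall g : gar C, gtgt (ginv g) = gsrc g;
  gmulVl : forall g : gar C, gmul (ginv g) g = gunit (gsrc g);
  gmulVr : forall g : gar C, gmul g (ginv g) = gunit (gtgt g) }.

Record is_functor (C D : groupoidData) (F0 : gob C -> gob D)
    (F1 : gar C -> gar D) : Prop := IsFunctor {
  functor_src : forall g, gsrc (F1 g) = F0 (gsrc g);
  functor_tgt : forall g, gtgt (F1 g) = F0 (gtgt g);
  functor_unit : forall x, F1 (gunit x) = gunit (F0 x);
  functor_mul : forall g h, gsrc g = gtgt h ->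
    F1 (gmul g h) = gmul (F1 g) (F1 h) }.

Record is_nat_trans (C D : groupoidData) (F0 : gob C -> gob D)
    (F1 : gar C -> gar D) (F0' : gob C -> gob D) (F1' : gar C -> gar D)
    (alpha : gob C -> gar D) : Prop := IsNatTrans {
  nat_src : forall x, gsrc (alpha x) = F0 x;
  nat_tgt : forall x, gtgt (alpha x) = F0' x;
  nat_square : forall g,
    gmul (alpha (gtgt g)) (F1 g) = gmul (F1' g) (alpha (gsrc g)) }.

Definition vertical_comp (C D : groupoidData) (beta alpha : gob C -> gar D) :
    gob C -> gar D := fun x => gmul (beta x) (alpha x).

(* [G2] is the manifold of composable pairs (g, h), lgsrc g = lgtgt h. *)
Record lieGroupoid (R : realType) := LieGroupoid {
  G0 : chartedSpace R;
  G1 : chartedSpace R;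
  G2 : chartedSpace R;
  lgsrc : G1 -> G0;
  lgtgt : G1 -> G0;
  lgunit : G0 -> G1;
  lginv : G1 -> G1;
  lgmul : G1 -> G1 -> G1;
  pr1 : G2 -> G1;
  pr2 : G2 -> G1;
  G0_manifold : is_manifold G0;
  G1_manifold : is_manifold G1;
  G2_manifold : is_manifold G2;
  G2_fibre_product : fibre_product lgsrc lgtgt pr1 pr2;
  G_groupoid : is_groupoid (GroupoidData lgsrc lgtgt lgunit lginv lgmul);
  lgsrc_submersion : submersion lgsrc;
  lgtgt_submersion : submersion lgtgt;
  lgunit_smooth : smooth lgunit;
  lginv_smooth : smooth lginv;
  lgmul_smooth : smooth (fun z => lgmul (pr1 z) (pr2 z)) }.

Section LieTwoAlgebraOfVectorFields.
Context {R : realType} (G : lieGroupoid R).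

Definition base_groupoid : groupoidData :=
  GroupoidData (@lgsrc R G) (@lgtgt R G) (@lgunit R G) (@lginv R G)
    (@lgmul R G).

(* The derivative of the multiplication G2 -> G1, where a pair of composable
   tangent vectors is regarded as a tangent vector of G2. *)
Definition Tmul (p q : pretangent (G1 G)) : pretangent (G1 G) :=
  (lgmul p.1 q.1,
   xget 0 [set Z | exists2 xi : pretangent (G2 G), tangent_vector xi.1 xi.2 &
     [/\ Tmap (@pr1 R G) xi = p, Tmap (@pr2 R G) xi = q &
         Tmap (fun z : G2 G => lgmul (pr1 z) (pr2 z)) xi = (lgmul p.1 q.1, Z)]]).

(* The structure maps are only meaningful on actual tangent vectors. *)
Definition tangent_groupoid : groupoidData :=
  @GroupoidData (pretangent (G0 G)) (pretangent (G1 G))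
    (Tmap (@lgsrc R G)) (Tmap (@lgtgt R G)) (Tmap (@lgunit R G))
    (Tmap (@lginv R G)) Tmul.

(** * The category of multiplicative vector fields *)

Definition obj : Type :=
  ((G0 G -> functional (G0 G)) * (G1 G -> functional (G1 G)))%type.
HB.instance Definition _ := GRing.Lmodule.on obj.

(* (v, alpha, w) stands for alpha : v => w: the section alpha of TG_1 over the
   units does not determine v and w. *)
Definition mor : Type := (obj * (G0 G -> functional (G1 G)) * obj)%type.
HB.instance Definition _ := GRing.Lmodule.on mor.

Definition src (al : mor) : obj := al.1.1.
Definition sec (al : mor) : G0 G -> functional (G1 G) := al.1.2.
Definition tgt (al : mor) : obj := al.2.

Definition obj0 (v : obj) (x : G0 G) : pretangent (G0 G) := (x, v.1 x).
Definition obj1 (v : obj) (g : G1 G) : pretangent (G1 G) := (g, v.2 g).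
Definition sec1 (a : G0 G -> functional (G1 G)) (x : G0 G) :
    pretangent (G1 G) := (lgunit x, a x).

Definition X0 : set obj := [set v |
  [/\ vector_field v.1, vector_field v.2 &
      @is_functor base_groupoid tangent_groupoid (obj0 v) (obj1 v)]].

Definition X1 : set mor := [set al |
  [/\ X0 (src al), X0 (tgt al), section_along (@lgunit R G) (sec al) &
      @is_nat_trans base_groupoid tangent_groupoid
        (obj0 (src al)) (obj1 (src al)) (obj0 (tgt al)) (obj1 (tgt al))
        (sec1 (sec al))]].

Definition unit_sec (v : obj) : G0 G -> functional (G1 G) :=
  fun x => (Tmap (@lgunit R G) (x, v.1 x)).2.

Definition unit_mor (v : obj) : mor := (v, unit_sec v, v).

Definition comp_mor (ba : mor * mor) : mor :=
  (src ba.2,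
   fun x => (@vertical_comp base_groupoid tangent_groupoid
               (sec1 (sec ba.1)) (sec1 (sec ba.2)) x).2,
   tgt ba.1).

(** * Brackets *)

Definition obj_bracket (v w : obj) : obj :=
  (vf_bracket v.1 w.1, vf_bracket v.2 w.2).

Definition algebroid_section (a : G0 G -> functional (G1 G)) : Prop :=
  section_along (@lgunit R G) a /\
  forall x, push (@lgsrc R G) (lgunit x) (a x) = 0.

(* The derivative at the unit of right multiplication by g, as a map
   lgsrc^-1(lgtgt g) -> lgsrc^-1(lgsrc g). *)
Definition right_translate (g : G1 G) (X : functional (G1 G)) :
    functional (G1 G) :=
  xget 0 [set Z | exists c : R -> G1 G,
    [/\ smooth_curve c, c 0 = lgunit (lgtgt g),
        \forall r \near (0 : R), lgsrc (c r) = lgtgt g,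
        X = velocity c & Z = velocity (fun r => lgmul (c r) g)]].

Definition right_vf (a : G0 G -> functional (G1 G)) :
    G1 G -> functional (G1 G) :=
  fun g => right_translate g (a (lgtgt g)).

Definition algebroid_bracket (a b : G0 G -> functional (G1 G)) :
    G0 G -> functional (G1 G) :=
  xget 0 [set c | algebroid_section c /\
                  right_vf c = vf_bracket (right_vf a) (right_vf b)].

Definition deriv_action (v : obj) (a : G0 G -> functional (G1 G)) :
    G0 G -> functional (G1 G) :=
  fun x => vf_bracket v.2 (right_vf a) (lgunit x).

(* The identification of X1 with (ker src) + X0, where a morphism 0 => w in
   ker src is given by its section, a section of the Lie algebroid. *)
Definition split_mor (al : mor) : (G0 G -> functional (G1 G)) * obj :=
  (sec (al - unit_mor (src al)), src al).

Definition split_bracket (p q : (G0 G -> functional (G1 G)) * obj) :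
    (G0 G -> functional (G1 G)) * obj :=
  (algebroid_bracket p.1 q.1 + deriv_action p.2 q.1 - deriv_action q.2 p.1,
   obj_bracket p.2 q.2).

Definition mor_bracket (al be : mor) : mor :=
  xget 0 [set de | X1 de /\
                   split_mor de = split_bracket (split_mor al) (split_mor be)].

End LieTwoAlgebraOfVectorFields.

(** * Strict Lie 2-algebras *)

Section LieAlgebras.
Context {R : realType}.

(* The Lie algebra is the subspace L of the ambient space V. *)
Record is_lie_algebra (V : lmodType R) (L : set V) (br : V -> V -> V) : Prop :=
  IsLieAlgebra {
  lie_zero : L 0;
  lie_lin : forall a x y, L x -> L y -> L (a *: x + y);
  lie_closed : forall x y, L x -> L y -> L (br x y);
  lie_linl : forall a x y z, L x -> L y -> L z ->
    br (a *: x + y) z = a *: br x z + br y z;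
  lie_linr : forall a x y z, L x -> L y -> L z ->
    br z (a *: x + y) = a *: br z x + br z y;
  lie_alt : forall x, L x -> br x x = 0;
  lie_jacobi : forall x y z, L x -> L y -> L z ->
    br x (br y z) + br y (br z x) + br z (br x y) = 0 }.

Record is_lie_hom (V W : lmodType R) (L : set V) (brL : V -> V -> V)
    (K : set W) (brK : W -> W -> W) (f : V -> W) : Prop := IsLieHom {
  hom_maps : forall x, L x -> K (f x);
  hom_lin : forall a x y, L x -> L y -> f (a *: x + y) = a *: f x + f y;
  hom_bracket : forall x y, L x -> L y -> f (brL x y) = brK (f x) (f y) }.

Definition prod_bracket (V W : lmodType R) (brV : V -> V -> V)
    (brW : W -> W -> W) (p q : V * W) : V * W := (brV p.1 q.1, brW p.2 q.2).

Definition composable (V0 V1 : lmodType R) (L1 : set V1) (so ta : V1 -> V0) :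
    set (V1 * V1) := [set ba | [/\ L1 ba.1, L1 ba.2 & so ba.1 = ta ba.2]].

Record strict_lie_2_algebra (V0 V1 : lmodType R) (L0 : set V0) (L1 : set V1)
    (br0 : V0 -> V0 -> V0) (br1 : V1 -> V1 -> V1)
    (so ta : V1 -> V0) (un : V0 -> V1) (co : V1 * V1 -> V1) : Prop :=
  StrictLie2Algebra {
  objects_lie : is_lie_algebra L0 br0;
  morphisms_lie : is_lie_algebra L1 br1;
  composable_lie :
    is_lie_algebra (composable L1 so ta) (prod_bracket br1 br1);
  source_hom : is_lie_hom L1 br1 L0 br0 so;
  target_hom : is_lie_hom L1 br1 L0 br0 ta;
  unit_hom : is_lie_hom L0 br0 L1 br1 un;
  composition_hom :
    is_lie_hom (composable L1 so ta) (prod_bracket br1 br1) L1 br1 co;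
  source_unit : forall x, L0 x -> so (un x) = x;
  target_unit : forall x, L0 x -> ta (un x) = x;
  source_comp : forall b a, composable L1 so ta (b, a) -> so (co (b, a)) = so a;
  target_comp : forall b a, composable L1 so ta (b, a) -> ta (co (b, a)) = ta b;
  comp_assoc : forall c b a,
    composable L1 so ta (c, b) -> composable L1 so ta (b, a) ->
    co (c, co (b, a)) = co (co (c, b), a);
  comp_unit_left : forall a, L1 a -> co (un (ta a), a) = a;
  comp_unit_right : forall a, L1 a -> co (a, un (so a)) = a }.

End LieAlgebras.

(* Main.v *)
Require Import Defs.
From HB Require Import structures.
From mathcomp Require Import all_boot all_order perm all_algebra.
From mathcomp Require Import all_classical all_reals all_analysis.
From mathcomp Require Import ring lra.
Import Defs.


Set Implicit Arguments.
Unset Strict Implicit.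
Unset Printing Implicit Defensive.

Import Order.TTheory GRing.Theory Num.Theory.
Import numFieldNormedType.Exports.
Local Open Scope classical_set_scope.
Local Open Scope ring_scope.

(** A morphism [al : v => w] is encoded by the vector field
    [H(g) = al(t g) v(g) = w(g) al(s g)] on [G1], whose restriction to the units
    is [al].  The fields obtained in this way are those that are [s]-related to
    [v_0], [t]-related to [w_0] and satisfy [H(gh) = H(g) v(h) = w(g) H(h)], that
    is, [(H, v)] and [(w, H)] on [G2] are related to [H] by the multiplication.
    Since brackets of related vector fields are related, such fields are closed
    under brackets.  As [H] is the sum of [v_1] and the right-invariant field of
    [al - 1_v], restricting [[H, H']] to the units gives the formula that defines
    the bracket of morphisms; hence that bracket exists, and the Lie algebra
    axioms and the compatibility with source, target and units are inherited from
    vector fields.  For a composite [be al], the pair [(H_be, H_al)] is related to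
    [H_(be al)], so composition also preserves brackets.

    The fields on [G2] are smooth, and the multiplication of tangent vectors is
    well defined, because [G2] is locally a product: this is the submersion
    theorem for [t], obtained from the inverse function theorem and transported
    to [G2] by its universal property. *)

(** * Differentiable and smooth maps between normed spaces *)

(** A morphism is a section of [TG_1] along the units, not a vector field on a manifold, so two of
    them have no bracket of their own; this is why they are extended to [G1]. The definitions add an
    obstacle: the product of tangent vectors, right translation, the algebroid bracket and the
    morphism bracket are values chosen by [xget], which mean something only once a candidate exists
    and all candidates agree. For the product this requires control of the tangent vectors of [G2],
    yet [G2] is given by a universal property tested on manifolds, with no stated relation between
    its charts and those of [G1]. Near each composable pair a smooth map to [G2] from an open set of
    pairs of coordinates of [G1] is therefore built, left inverse to the coordinates of the two
    projections; functions, curves and tangent vectors on [G2] are read off from it. Moreover a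
    tangent vector is an operator that comes from a curve: a sum or a bracket is at first only an
    operator and must be shown to be a velocity. For brackets this is where the symmetry of second
    derivatives enters. *)

Section Differentiability.
Context {R : realType}.

(** Replaces the little-o of the definition by an inequality against which a candidate derivative
    can be tested; the derivative of a local inverse is found in this way. *)
Lemma differentiable_eps (V W : normedModType R) (f : V -> W)
    (df : {linear V -> W}) (x : V) : continuous df ->
  (forall e : R, 0 < e ->
     \forall h \near 0, `|f (h + x) - f x - df h| <= e * `|h|) ->
  differentiable f x /\ 'd f x = df :> (V -> W).
Proof.
move=> cdf hf.
have E : f \o shift x = cst (f x) + df +o_ 0 id.
  apply/eqaddoP => e e0; near=> h.
  rewrite /= !fctE /= opprD addrA; near: h; exact: hf.
have dE := diff_unique cdf E; split => //.
by apply/diff_locallyP; rewrite dE.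
Unshelve. all: by end_near. Qed.

Lemma differentiable_bound (V W : normedModType R) (f : V -> W) (x : V) :
  differentiable f x -> forall e : R, 0 < e ->
     \forall h \near 0, `|f (h + x) - f x - 'd f x h| <= e * `|h|.
Proof.
move=> /diff_locallyP[_ /eqaddoP E] e e0.
move: (E e e0); apply: filterS => h.
by rewrite !fctE /= opprD addrA.
Qed.

Lemma near_eq_differentiable (V W : normedModType R) (f g : V -> W) (x : V) :
  (\forall y \near x, f y = g y) -> differentiable f x -> differentiable g x.
Proof.
move=> fg df.
have cdf : continuous ('d f x) by exact: diff_continuous.
have [] // := @differentiable_eps V W g ('d f x) x cdf.
move=> e e0; near=> h.
have fgx : f x = g x by exact: (nbhs_singleton fg).
have fgh : f (h + x) = g (h + x).
  near: h; have := fg; rewrite (near_shift 0 x) /=; apply: filterS => z /=.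
  by rewrite subr0.
rewrite -fgx -fgh; near: h; exact: differentiable_bound.
Unshelve. all: by end_near. Qed.

Lemma differentiable_rV (V : normedModType R) n (f : V -> 'rV[R]_n) (x : V) :
  (forall j, differentiable (fun y => f y ord0 j : R^o) x) -> differentiable f x.
Proof.
move=> df.
have -> : f = \sum_(j < n) (fun y => f y ord0 j *: (delta_mx 0 j : 'rV[R]_n)).
  by apply/funext => y; rewrite fct_sumE; exact: row_sum_delta.
by apply: differentiable_sum => j; apply: differentiableZl.
Qed.

Lemma differentiable_coord_comp (V : normedModType R) n (f : V -> 'rV[R]_n)
    (x : V) j : differentiable f x -> differentiable (fun y => f y ord0 j : R^o) x.
Proof.
move=> df; apply: (@differentiable_comp _ _ _ _ f (fun N : 'rV[R]_n => N ord0 j :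
  R^o)) => //.
exact: differentiable_coord.
Qed.

Lemma derive_coord (V : normedModType R) n (f : V -> 'rV[R]_n) (x v : V) j :
  differentiable f x ->
  ('D_v f x) ord0 j = 'D_v (fun y => f y ord0 j : R^o) x.
Proof. by move=> df; rewrite derive_mx ?mxE//; exact: diff_derivable. Qed.

Lemma linear_rV_sum (W : lmodType R) n (L : {linear 'rV[R]_n -> W}) (v : 'rV[R]_n) :
  L v = \sum_(j < n) v ord0 j *: L (delta_mx 0 j).
Proof.
rewrite [in LHS](row_sum_delta v) linear_sum.
by apply: eq_bigr => j _; rewrite linearZ.
Qed.

(** [Ck_on] only speaks of derivatives in fixed directions; this expansion reduces a direction that
    varies with the point to the fixed directions [delta_mx 0 j]. *)
Lemma derive_rV_sum (W : normedModType R) n (F : 'rV[R]_n -> W) (x v : 'rV[R]_n) :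
  differentiable F x ->
  'D_v F x = \sum_(j < n) v ord0 j *: 'D_(delta_mx 0 j) F x.
Proof.
move=> dF; rewrite (deriveE v dF).
rewrite (linear_rV_sum ('d F x)).
apply: eq_bigr => j _.
by rewrite (deriveE _ dF).
Qed.

Lemma derive_comp (U V W : normedModType R) (f : U -> V) (F : V -> W) (x v : U) :
  differentiable f x -> differentiable F (f x) ->
  'D_v (F \o f) x = 'D_('D_v f x) F (f x).
Proof.
move=> df dF; rewrite (deriveE v (differentiable_comp df dF)).
by rewrite (diff_comp df dF) (deriveE _ dF) (deriveE v df).
Qed.

End Differentiability.

(** * Maps of class C^k on an open set *)

Section CkCalculus.
Context {R : realType}.
Implicit Types (k n : nat).

Lemma near_open (V : topologicalType) (A : set V) (x : V) (P : V -> Prop) :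
  open A -> A x -> (forall y, A y -> P y) -> \forall y \near x, P y.
Proof. by move=> oA Ax AP; apply: filterS (open_nbhs_nbhs (conj oA Ax)). Qed.

(** Openness of [A] matters: derivatives are those of the total functions, and agreement on [A]
    makes them agree only at interior points. *)
Lemma Ck_ext (V W : normedModType R) k (A : set V) (f g : V -> W) : open A ->
  (forall x, A x -> f x = g x) -> Ck_on k A f -> Ck_on k A g.
Proof.
move=> oA; elim: k f g => [|k IH] f g fg /=.
  move=> cf x Ax; have := cf x Ax.
  rewrite /prop_for /continuous_at (fg x Ax) => cfx.
  by apply: cvg_trans cfx; apply: near_eq_cvg; exact: near_open Ax fg.
move=> [df Df]; split.
  by move=> x Ax; apply: near_eq_differentiable (df x Ax); apply: near_open Ax fg.
move=> v; apply: IH (Df v) => x Ax.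
by apply: near_eq_derive; apply: near_open Ax fg.
Qed.

Lemma Ck_mono (V W : normedModType R) k (A B : set V) (f : V -> W) :
  B `<=` A -> Ck_on k A f -> Ck_on k B f.
Proof.
move=> BA; elim: k f => [|k IH] f /=; first by move=> + x /BA; exact.
by move=> [df Df]; split=> [x /BA/df//|v]; exact: IH.
Qed.

Lemma Ck_S (V W : normedModType R) k (A : set V) (f : V -> W) :
  Ck_on k.+1 A f -> Ck_on k A f.
Proof.
elim: k f => [|k IH] f [df Df].
  by move=> x /df; exact: differentiable_continuous.
by split => // v; exact: IH.
Qed.

Lemma Ck_differentiable (V W : normedModType R) k (A : set V) (f : V -> W) x :
  Ck_on k.+1 A f -> A x -> differentiable f x.
Proof. by move=> [df _]; exact: df. Qed.

Lemma Ck_cst (V W : normedModType R) k (A : set V) (c : W) :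
  Ck_on k A (cst c : V -> W).
Proof.
elim: k c => [|k IH] c /=; first by move=> x _; exact: cst_continuous.
split=> [x _|v]; first exact: differentiable_cst.
have -> : 'D_v (cst c : V -> W) = cst 0 by apply/funext => x; exact: derive_cst.
exact: IH.
Qed.

Lemma Ck_lin (V W : normedModType R) k (A : set V) (f : {linear V -> W}) :
  continuous f -> Ck_on k A f.
Proof.
move=> cf; case: k => [|k] /=; first by move=> x _; exact: cf.
split=> [x _|v]; first exact: linear_differentiable.
have -> : 'D_v f = cst (f v); last exact: Ck_cst.
by apply/funext => x; rewrite deriveE ?diff_lin//; exact: linear_differentiable.
Qed.

Lemma Ck_add (V W : normedModType R) k (A : set V) (f g : V -> W) : open A ->
  Ck_on k A f -> Ck_on k A g -> Ck_on k A (f + g).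
Proof.
move=> oA; elim: k f g => [|k IH] f g.
  by move=> cf cg x Ax; apply: continuousD; [exact: cf|exact: cg].
move=> [df Df] [dg Dg]; split=> [x Ax|v].
  by apply: differentiableD; [exact: df|exact: dg].
apply: Ck_ext (IH _ _ (Df v) (Dg v)) => // x Ax.
by rewrite (deriveD (v:=v) (diff_derivable (df x Ax)) (diff_derivable (dg x Ax))).
Qed.

Lemma Ck_sum (V W : normedModType R) k (A : set V) (I : Type) (r : seq I)
    (f : I -> V -> W) :
  open A -> (forall i, Ck_on k A (f i)) -> Ck_on k A (\sum_(i <- r) f i).
Proof.
move=> oA hf; elim/big_ind: _ => //; first exact: Ck_cst.
by move=> g h; exact: Ck_add.
Qed.

Lemma Ck_scale (V W : normedModType R) k (A : set V) (a : R) (f : V -> W) :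
  open A -> Ck_on k A f -> Ck_on k A (a *: f).
Proof.
move=> oA; elim: k f => [|k IH] f.
  by move=> cf x Ax; apply: continuousZl_tmp; exact: cf.
move=> [df Df]; split=> [x Ax|v].
  by apply: differentiableZ; exact: df.
apply: Ck_ext (IH _ (Df v)) => // x Ax.
by rewrite (deriveZ (v:=v) _ (diff_derivable (df x Ax))).
Qed.

Lemma Ck_mul (V : normedModType R) k (A : set V) (f g : V -> R^o) : open A ->
  Ck_on k A f -> Ck_on k A g -> Ck_on k A (fun x => f x * g x : R^o).
Proof.
move=> oA; elim: k f g => [|k IH] f g.
  by move=> cf cg x Ax; apply: continuousM; [exact: cf|exact: cg].
move=> Hf Hg; have [df Df] := Hf; have [dg Dg] := Hg; split=> [x Ax|v].
  by apply: differentiableM; [exact: df|exact: dg].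
apply: (@Ck_ext _ _ k _ ((fun x => f x * 'D_v g x : R^o) + (fun x => g x * 'D_v f
  x : R^o))) => //.
  move=> x Ax.
  by rewrite [RHS](deriveM (v:=v) (diff_derivable (df x Ax)) (diff_derivable (dg
    x Ax))).
by apply: Ck_add => //; [exact: IH (Ck_S Hf) (Dg v)|exact: IH (Ck_S Hg) (Df v)].
Qed.

Lemma Ck_prod (V : normedModType R) k (A : set V) n (f : 'I_n -> V -> R^o) :
  open A -> (forall i, Ck_on k A (f i)) ->
  Ck_on k A (fun x => \prod_(i < n) f i x : R^o).
Proof.
move=> oA; elim: n f => [|n IH] f hf.
  by under eq_fun do rewrite big_ord0; exact: Ck_cst.
under eq_fun do rewrite big_ord_recr.
by apply: Ck_mul => //; exact: IH.
Qed.

Lemma Ck_inv (V : normedModType R) k (A : set V) (f : V -> R^o) : open A ->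
  (forall x, A x -> f x != 0) ->
  Ck_on k A f -> Ck_on k A (fun x => (f x)^-1 : R^o).
Proof.
move=> oA f0; elim: k => [|k IH] Hf.
  by move=> x Ax; apply: continuousV => //; [exact: f0|exact: Hf].
have [df Df] := Hf; split=> [x Ax|v].
  by apply: differentiableV; [exact: df|exact: f0].
apply: (@Ck_ext _ _ k _ ((-1) *: (fun x => ((f x)^-1 * (f x)^-1) * 'D_v f x :
  R^o))) => //.
  move=> x Ax; rewrite [RHS](deriveV (v:=v) (f0 x Ax) (diff_derivable (df x Ax))).
  by rewrite fctE expr2 invfM scaleN1r scaleNr.
apply: Ck_scale => //; have IH' := IH (Ck_S Hf).
apply: Ck_mul => //; last exact: Df.
exact: Ck_mul.
Qed.

Lemma Ck_coord (V : normedModType R) k (A : set V) n (f : V -> 'rV[R]_n) j :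
  open A -> Ck_on k A f -> Ck_on k A (fun x => f x ord0 j : R^o).
Proof.
move=> oA; elim: k f => [|k IH] f.
  move=> cf x Ax.
  by apply: (@continuous_comp _ _ _ f (fun N : 'rV[R]_n => N ord0 j)); [exact:
    cf|exact: coord_continuous].
move=> [df Df]; split=> [x Ax|v].
  by apply: differentiable_coord_comp; exact: df.
apply: Ck_ext (IH _ (Df v)) => // x Ax.
by apply: derive_coord; exact: df.
Qed.

Lemma cvg_sum_ord (W : normedModType R) (T : Type) (F : set_system T) n
    (f : 'I_n -> T -> W) (l : 'I_n -> W) : Filter F ->
  (forall j, f j @ F --> l j) ->
  (fun x => \sum_(j < n) f j x) @ F --> \sum_(j < n) l j.
Proof.
move=> FF; elim: n f l => [|n IH] f l fl.
  by rewrite big_ord0; under eq_fun do rewrite big_ord0; exact: cvg_cst.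
rewrite big_ord_recr; under eq_fun do rewrite big_ord_recr.
by apply: cvgD; [exact: IH|exact: fl].
Qed.

Lemma cvg_rV (T : Type) (F : set_system T) n (f : T -> 'rV[R]_n) (l : 'rV[R]_n) :
  Filter F -> (forall j, f x ord0 j @[x --> F] --> l ord0 j) -> f @ F --> l.
Proof.
move=> FF fl; rewrite (row_sum_delta l).
have -> : f = fun x => \sum_(j < n) (f x ord0 j *: (delta_mx 0 j : 'rV[R]_n)).
  by apply/funext => x; exact: row_sum_delta.
by apply: cvg_sum_ord => j; apply: cvgZr_tmp.
Qed.

Lemma Ck_rV (V : normedModType R) k (A : set V) n (f : V -> 'rV[R]_n) : open A ->
  (forall j, Ck_on k A (fun x => f x ord0 j : R^o)) -> Ck_on k A f.
Proof.
move=> oA; elim: k f => [|k IH] f Hf.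
  by move=> x Ax; apply: cvg_rV => j; exact: Hf.
have df x : A x -> differentiable f x.
  by move=> Ax; apply: differentiable_rV => j; exact: Ck_differentiable (Hf j) Ax.
split=> // v; apply: IH => j.
have [_ Df] := Hf j.
by apply: Ck_ext (Df v) => // x Ax; rewrite (derive_coord v j (df x Ax)).
Qed.

(** The chain rule gives a finite sum of products of the coordinates of ['D_v f] with
    ['D_(delta_mx 0 j) F \o f]. The induction hypothesis is applied to the partial derivatives of
    [F], so it is general in [F] while [f] stays fixed. *)
Lemma Ck_comp_fun (V : normedModType R) k n (A : set V) (B : set 'rV[R]_n)
    (f : V -> 'rV[R]_n) (F : 'rV[R]_n -> R^o) : open A ->
  (forall x, A x -> B (f x)) -> Ck_on k A f -> Ck_on k B F -> Ck_on k A (F \o f).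
Proof.
move=> oA AB; elim: k F => [|k IH] F.
  by move=> cf cF x Ax; apply: continuous_comp; [exact: cf|exact: cF (AB _ Ax)].
move=> Hf [dF DF]; have [df Df] := Hf; split=> [x Ax|v].
  by apply: differentiable_comp; [exact: df|exact: dF (AB _ Ax)].
apply: (@Ck_ext _ _ k _ (\sum_(j < n) (fun x => ('D_v f x) ord0 j * ('D_(delta_mx
  0 j) F \o f) x : R^o))) => //.
  move=> x Ax; rewrite (derive_comp v (df x Ax) (dF _ (AB _ Ax))).
  by rewrite fct_sumE [RHS](derive_rV_sum _ (dF _ (AB _ Ax))).
apply: Ck_sum => // j; apply: Ck_mul => //; first exact: Ck_coord oA (Df v).
exact: IH (Ck_S Hf) (DF _).
Qed.

Lemma Ck_det (V : normedModType R) k n (A : set V) (M : V -> 'M[R]_n) : open A ->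
  (forall i j, Ck_on k A (fun x => M x i j : R^o)) ->
  Ck_on k A (fun x => \det (M x) : R^o).
Proof.
move=> oA HM.
have -> : (fun x => \det (M x) : R^o) =
  \sum_(s : {perm 'I_n})
     (((-1) ^+ s) *: (fun x => \prod_(i < n) M x i (s i) : R^o)).
  by apply/funext => x; rewrite fct_sumE.
apply: Ck_sum => // s; apply: Ck_scale => //.
exact: Ck_prod.
Qed.

(** Cramer's formula: each entry of the inverse is a cofactor, polynomial in the entries of [M x],
    divided by the determinant. *)
Lemma Ck_invmx (V : normedModType R) k n (A : set V) (M : V -> 'M[R]_n) : open A ->
  (forall x, A x -> M x \in unitmx) ->
  (forall i j, Ck_on k A (fun x => M x i j : R^o)) ->
  forall i j, Ck_on k A (fun x => invmx (M x) i j : R^o).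
Proof.
move=> oA uM HM i j.
apply: (@Ck_ext _ _ _ _ (fun x => (\det (M x))^-1 * (\adj (M x)) i j : R^o)) => //.
  by move=> x Ax; rewrite /invmx (uM x Ax) [RHS]mxE.
apply: Ck_mul => //.
  apply: Ck_inv => //; last exact: Ck_det oA HM.
  by move=> x /uM; rewrite unitmxE unitfE.
under eq_fun do rewrite mxE /cofactor.
apply: (@Ck_scale _ _ _ _ ((-1) ^+ (j + i)) (fun x => \det (row' j (col' i (M
  x))) : R^o)) => //.
apply: Ck_det => // a b.
by under eq_fun do rewrite !mxE; exact: HM.
Qed.

End CkCalculus.

(** * Germs of smooth maps *)

Section SmoothGerms.
Context {R : realType}.
Implicit Types V W : normedModType R.

Lemma near_openE (T : topologicalType) (x : T) (P : T -> Prop) :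
  (\forall y \near x, P y) ->
  exists B : set T, [/\ open B, B x & forall y, B y -> P y].
Proof. by move=> /nbhs_interior; exists P^°; split=> //; [exact:
  open_interior|exact: nbhs_singleton|move=> y /nbhs_singleton]. Qed.

Lemma smooth_near_eq V W (x : V) (f g : V -> W) :
  (\forall y \near x, f y = g y) -> smooth_near x f -> smooth_near x g.
Proof.
move=> /near_openE[B [oB Bx Bfg]] [A [oA Ax Af]].
exists (A `&` B); split; [exact: openI|by []|move=> k].
apply: (@Ck_ext _ _ _ _ _ f); [exact: openI|by move=> y [_ /Bfg]|].
by apply: Ck_mono (Af k) => y [].
Qed.

Lemma smooth_near_near V W (x : V) (f : V -> W) : smooth_near x f ->
  \forall y \near x, smooth_near y f.
Proof.
move=> [A [oA Ax Af]]; apply: near_open Ax _ => // y Ay.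
by exists A.
Qed.

Lemma smooth_near_differentiable V W (x : V) (f : V -> W) :
  smooth_near x f -> differentiable f x.
Proof. by move=> [A [oA Ax Af]]; exact: Ck_differentiable (Af 1%N) Ax. Qed.

Lemma smooth_near_continuous V W (x : V) (f : V -> W) :
  smooth_near x f -> {for x, continuous f}.
Proof. by move=> /smooth_near_differentiable/differentiable_continuous. Qed.

Lemma smooth_near_cvg V W (x : V) (f : V -> W) (P : W -> Prop) :
  smooth_near x f -> (\forall z \near f x, P z) -> \forall y \near x, P (f y).
Proof. by move=> /smooth_near_continuous cf; exact: cf. Qed.

Lemma smooth_near_derive V W (x v : V) (f : V -> W) :
  smooth_near x f -> smooth_near x ('D_v f).
Proof. by move=> [A [oA Ax Af]]; exists A; split=> // k; have [_ Df] := Af k.+1;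
  exact: Df. Qed.

Lemma smooth_near_cst V W (x : V) (c : W) : smooth_near x (fun _ : V => c).
Proof. by exists setT; split=> // [|k]; [exact: openT|exact: Ck_cst]. Qed.

Lemma smooth_near_lin V W (x : V) (f : {linear V -> W}) :
  continuous f -> smooth_near x f.
Proof. by move=> cf; exists setT; split=> // [|k]; [exact: openT|exact: Ck_lin].
  Qed.

Lemma smooth_near_add V W (x : V) (f g : V -> W) : smooth_near x f ->
  smooth_near x g -> smooth_near x (fun y => f y + g y).
Proof.
move=> [A [oA Ax Af]] [B [oB Bx Bf]]; have oAB := openI oA oB.
exists (A `&` B); split=> // k.
apply: Ck_add => //; [apply: Ck_mono (Af k)|apply: Ck_mono (Bf k)].
- exact: subIsetl.
- exact: subIsetr.
Qed.

Lemma smooth_near_scale V W (x : V) (a : R) (f : V -> W) : smooth_near x f ->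
  smooth_near x (fun y => a *: f y).
Proof.
move=> [A [oA Ax Af]]; exists A; split=> // k.
exact: Ck_scale oA (Af k).
Qed.

Lemma smooth_near_mul V (x : V) (f g : V -> R^o) : smooth_near x f ->
  smooth_near x g -> smooth_near x (fun y => f y * g y : R^o).
Proof.
move=> [A [oA Ax Af]] [B [oB Bx Bf]]; have oAB := openI oA oB.
exists (A `&` B); split=> // k.
apply: Ck_mul => //; [apply: Ck_mono (Af k)|apply: Ck_mono (Bf k)].
- exact: subIsetl.
- exact: subIsetr.
Qed.

Lemma smooth_near_sum V W (x : V) n (f : 'I_n -> V -> W) :
  (forall j, smooth_near x (f j)) -> smooth_near x (fun y => \sum_(j < n) f j y).
Proof.
elim: n f => [|n IH] f hf.
  by under eq_fun do rewrite big_ord0; exact: smooth_near_cst.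
under eq_fun do rewrite big_ord_recr.
by apply: smooth_near_add; [exact: IH|exact: hf].
Qed.

Lemma smooth_near_comp_fun V n (x : V) (f : V -> 'rV[R]_n) (F : 'rV[R]_n -> R^o) :
  smooth_near x f -> smooth_near (f x) F -> smooth_near x (fun y => F (f y)).
Proof.
move=> sf [B [oB Bx Bf]].
have /near_openE[C [oC Cx CB]] : \forall y \near x, B (f y).
  by apply: (smooth_near_cvg sf); exact: open_nbhs_nbhs.
have [A [oA Ax Af]] := sf.
have oAC := openI oA oC.
exists (A `&` C); split=> // k; apply: (Ck_comp_fun oAC _ _ (Bf k)).
  by move=> y [_ /CB].
by apply: Ck_mono (Af k); exact: subIsetl.
Qed.

Lemma smooth_near_coord V n (x : V) (f : V -> 'rV[R]_n) j :
  smooth_near x f -> smooth_near x (fun y => f y ord0 j : R^o).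
Proof.
by move=> [A [oA Ax Af]]; exists A; split=> // k; exact: Ck_coord oA (Af k).
Qed.

(** Each coordinate comes with its own open set; writing [f] as a finite sum lets [smooth_near_sum]
    intersect them. *)
Lemma smooth_near_rV V n (x : V) (f : V -> 'rV[R]_n) :
  (forall j, smooth_near x (fun y => f y ord0 j : R^o)) -> smooth_near x f.
Proof.
move=> sf; have -> : f = fun y => \sum_(j < n) (f y ord0 j *: (delta_mx 0 j :
  'rV[R]_n)).
  by apply/funext => y; exact: row_sum_delta.
apply: smooth_near_sum => j; have [A [oA Ax Af]] := sf j.
exists A; split=> // k; apply: Ck_rV => // i.
under eq_fun do rewrite mxE.
by apply: Ck_mul => //; exact: Ck_cst.
Qed.

Lemma smooth_near_comp V n m (x : V) (f : V -> 'rV[R]_n) (F : 'rV[R]_n ->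
  'rV[R]_m) :
  smooth_near x f -> smooth_near (f x) F -> smooth_near x (fun y => F (f y)).
Proof.
move=> sf sF; apply: smooth_near_rV => j.
apply: (@smooth_near_comp_fun _ _ _ _ (fun z => F z ord0 j : R^o)) => //.
exact: smooth_near_coord.
Qed.

Lemma smooth_near_row_mx V n m (x : V) (f : V -> 'rV[R]_n) (g : V -> 'rV[R]_m) :
  smooth_near x f -> smooth_near x g -> smooth_near x (fun y => row_mx (f y) (g y)).
Proof.
move=> sf sg; apply: smooth_near_rV => j; rewrite -(splitK j).
case: (fintype.split j) => i /=.
  by under eq_fun do rewrite row_mxEl; exact: smooth_near_coord.
by under eq_fun do rewrite row_mxEr; exact: smooth_near_coord.
Qed.

Lemma smooth_near_lsubmx n m (x : 'rV[R]_(n + m)) : smooth_near x lsubmx.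
Proof. apply: smooth_near_lin; exact: continuous_lsubmx. Qed.

Lemma smooth_near_rsubmx n m (x : 'rV[R]_(n + m)) : smooth_near x rsubmx.
Proof. apply: smooth_near_lin; exact: continuous_rsubmx. Qed.

Lemma smooth_near_id n (x : 'rV[R]_n) : smooth_near x id.
Proof. by apply: (@smooth_near_lin _ _ x idfun) => y; exact: cvg_id. Qed.

(** This is the coordinate form of applying a smooth vector field, with components [w], to a smooth
    function. *)
Lemma smooth_near_derive_along V n (x : V) (u w : V -> 'rV[R]_n) (F : 'rV[R]_n ->
  R^o) :
  smooth_near x u -> smooth_near x w -> smooth_near (u x) F ->
  smooth_near x (fun y => 'D_(w y) F (u y)).
Proof.
move=> su sw sF.
apply: (@smooth_near_eq _ _ _ (fun y => \sum_(j < n) (w y ord0 j * 'D_(delta_mx 0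
  j) F (u y)))).
  have : \forall y \near x, smooth_near (u y) F.
    by apply: (smooth_near_cvg (P := fun z => smooth_near z F) su); exact:
      smooth_near_near.
  by apply: filterS => y /smooth_near_differentiable/derive_rV_sum ->.
apply: smooth_near_sum => j; apply: smooth_near_mul; first exact: smooth_near_coord.
by apply: (@smooth_near_comp_fun _ _ _ u ('D_(delta_mx 0 j) F)) => //; exact:
  smooth_near_derive.
Qed.

End SmoothGerms.

(** * Symmetry of second derivatives *)

Section SymmetryOfSecondDerivatives.
Context {R : realType} {V : normedModType R}.

Lemma differentiable_affine (u c : V) (s : R^o) :
  differentiable (fun r : R^o => r *: u + c) s /\
  'D_1 (fun r : R^o => r *: u + c) s = u.
Proof.
have d1 : differentiable (fun r : R^o => r *: u) s by exact: differentiableZl.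
have d2 : differentiable (fun _ : R^o => c) s by exact: differentiable_cst.
split; first exact: (@differentiableD _ _ _ (fun r : R^o => r *: u) (cst c)).
rewrite (@deriveD _ _ _ (fun r : R^o => r *: u) (cst c)); last 2 first.
- exact: diff_derivable.
- exact: diff_derivable.
by rewrite derive_cst addr0 deriveE// diff_val scale1r.
Qed.

Lemma is_derive_line (W : normedModType R) (f : V -> W) (u c : V) (s : R) :
  differentiable f (s *: u + c) ->
  is_derive (s : R^o) 1 (fun r : R^o => f (r *: u + c)) ('D_u f (s *: u + c)).
Proof.
move=> df; have [da Da] := differentiable_affine u c s.
have df' : differentiable (f \o (fun r : R^o => r *: u + c)) s.
  exact: differentiable_comp.
apply: DeriveDef; first exact: diff_derivable.
by rewrite (derive_comp (1 : R^o) da df) Da.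
Qed.

Lemma MVT_line (f : V -> R^o) (u c : V) (h : R) : 0 < h ->
  (forall s, 0 <= s <= h -> differentiable f (s *: u + c)) ->
  exists2 s, 0 <= s <= h & f (h *: u + c) - f c = h * 'D_u f (s *: u + c).
Proof.
move=> h0 df.
have [] := @MVT_segment R (fun r => f (r *: u + c)) (fun r => 'D_u f (r *: u +
  c)) 0 h.
- exact: ltW.
- move=> s; rewrite in_itv /= => /andP[s0 sh].
  by apply: is_derive_line; apply: df; rewrite !ltW.
- apply: derivable_within_continuous => s; rewrite in_itv /= => sh.
  by have [] := is_derive_line (df s sh).
move=> s; rewrite in_itv /= => sh; rewrite scale0r add0r subr0 mulrC => E.
by exists s.
Qed.

(* Both mixed second derivatives are limits of the symmetric second difference
   [f(x+hu+hv) - f(x+hu) - f(x+hv) + f x], divided by [h^2]. *)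
Lemma second_difference (f p : V -> R^o) (x u v : V) (h : R) :
  p = 'D_v ('D_u f) -> 0 < h ->
  (forall s t, 0 <= s <= h -> 0 <= t <= h ->
     differentiable f (t *: v + (s *: u + x)) /\
     differentiable ('D_u f) (t *: v + (s *: u + x))) ->
  exists s t, [/\ 0 <= s <= h, 0 <= t <= h &
   f (h *: v + (h *: u + x)) - f (h *: u + x) - f (h *: v + x) + f x
     = h * (h * p (t *: v + (s *: u + x)))].
Proof.
move=> -> h0 df.
have hh : 0 <= h <= h by rewrite lexx ltW.
have zh : (0 : R) <= 0 <= h by rewrite lexx ltW.
(* The second difference of [f] is the increment of [g] from [x] to [h *: u + x]. The mean value
   theorem for [g] in direction [u] gives [s]; applied then to ['D_u f] in direction [v] it gives
   [t]. *)
pose g (y : V) : R^o := f (h *: v + y) - f y.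
have dfv y : differentiable f (h *: v + y) ->
    differentiable (fun z => f (h *: v + z)) y /\
    'D_u (fun z => f (h *: v + z)) y = 'D_u f (h *: v + y).
  have da : differentiable (fun z => h *: v + z) y.
    exact: (@differentiableD _ _ _ (cst (h *: v)) id).
  move=> dy; split; first exact: (@differentiable_comp _ _ _ _ _ f).
  rewrite (derive_comp u da dy); congr ('D__ f _).
  rewrite (@deriveD _ _ _ (cst (h *: v)) id) ?derive_cst ?derive_id ?add0r//.
have dg s : 0 <= s <= h -> differentiable g (s *: u + x) /\
    'D_u g (s *: u + x) = 'D_u f (h *: v + (s *: u + x)) - 'D_u f (s *: u + x).
  move=> sh; have [d1 _] := df s h sh hh; have [d0 _] := df s 0 sh zh.
  rewrite scale0r add0r in d0; have [d2 D2] := dfv _ d1.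
  split; first exact: (@differentiableB _ _ _ (fun z => f (h *: v + z)) f).
  rewrite -D2 (@deriveB _ _ _ (fun z => f (h *: v + z)) f)//; exact: diff_derivable.
have [|s sh Es] := @MVT_line g u x h h0; first by move=> s /dg[].
have [|t th Et] := @MVT_line ('D_u f) v (s *: u + x) h h0.
  by move=> t th; have [] := df s t sh th.
exists s, t; split=> //; rewrite -Et; have [_ <-] := dg s sh; rewrite -Es /g.
by rewrite opprB [RHS]addrA [RHS]addrAC.
Qed.

(** The common value may be taken at two different points: the two orders of differentiation yield
    different intermediate points in the mean value theorem. If [p x] and [q x] differed, both
    functions would stay within half their distance near [x]. *)
Lemma continuous_meet (p q : V -> R^o) (x : V) :
  {for x, continuous p} -> {for x, continuous q} ->
  (forall A : set V, nbhs x A -> exists y z, [/\ A y, A z & p y = q z]) ->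
  p x = q x.
Proof.
move=> /cvgrPdist_lt cp /cvgrPdist_lt cq pq.
apply/eqP/negP => /negP pqx.
pose e : R := `|p x - q x| / 2.
have e0 : 0 < e by rewrite divr_gt0// normr_gt0 subr_eq0.
have [y [z [[y1 _] [_ z2] E]]] := pq _ (filterI (cp e e0) (cq e e0)).
have : `|p x - q x| < e + e.
  rewrite -(subrK (p y) (p x)) -addrA.
  apply: le_lt_trans (ler_normD _ _) _; apply: ltrD => //.
  by rewrite E distrC.
by rewrite /e -splitr ltxx.
Qed.

Let derive_comm_aux (f p q : V -> R^o) (x u v : V) :
  p = 'D_u ('D_v f) -> q = 'D_v ('D_u f) -> smooth_near x f -> p x = q x.
Proof.
move=> pE qE sf; apply: continuous_meet => [||A nA].
- by rewrite pE; exact: smooth_near_continuous (smooth_near_derive u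
  (smooth_near_derive v sf)).
- by rewrite qE; exact: smooth_near_continuous (smooth_near_derive v
  (smooth_near_derive u sf)).
have nS : \forall y \near x, A y /\ smooth_near y f.
  by apply: filterI => //; exact: smooth_near_near.
have [d /= d0 good] : exists2 d : R, 0 < d & ball x d `<=` [set y | A y /\
  smooth_near y f].
  by move/nbhs_ballP: nS => [d d0 ?]; exists d.
(* With this [h] the parallelogram spanned by [h *: u] and [h *: v] at [x] stays within [d / 2] of
   [x]; the summand 1 keeps the divisor positive when [u] and [v] vanish. *)
pose h : R := d / (2 * (`|u| + `|v| + 1)).
have n0 : 0 < `|u| + `|v| + 1 by rewrite ltr_wpDl// addr_ge0.
have h0 : 0 < h by rewrite divr_gt0// mulr_gt0.
have ok s t : 0 <= s <= h -> 0 <= t <= h -> ball x d (t *: v + (s *: u + x)).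
  move=> /andP[s0 sh] /andP[t0 th]; rewrite -ball_normE /= distrC addrA addrK.
  apply: le_lt_trans (ler_normD _ _) _; rewrite !normrZ (ger0_norm s0) (ger0_norm
    t0).
  apply: (@le_lt_trans _ _ (h * (`|u| + `|v| + 1))).
    have := ler_wpM2r (normr_ge0 u) sh; have := ler_wpM2r (normr_ge0 v) th.
    rewrite !mulrDr mulr1; move: (ltW h0); lra.
  have -> : h * (`|u| + `|v| + 1) = d / 2.
    by rewrite /h; field; rewrite gt_eqF.
  by rewrite ltr_pdivrMr// ltr_pMr// ltr1n.
have sm s t : 0 <= s <= h -> 0 <= t <= h -> smooth_near (t *: v + (s *: u + x)) f.
  by move=> sh th; have [] := good _ (ok s t sh th).
have [|s [t [sh th E1]]] := @second_difference f q x u v h qE h0.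
  move=> s t sh th; have := sm s t sh th => s1.
  by split; [exact: smooth_near_differentiable s1|exact:
    smooth_near_differentiable (smooth_near_derive u s1)].
have [|s' [t' [sh' th' E2]]] := @second_difference f p x v u h pE h0.
  move=> a b ah bh; rewrite addrCA; have := sm b a bh ah => s1.
  by split; [exact: smooth_near_differentiable s1|exact:
    smooth_near_differentiable (smooth_near_derive v s1)].
exists (s' *: v + (t' *: u + x)), (t *: v + (s *: u + x)).
have [A1 _] := good _ (ok t' s' th' sh').
have [A2 _] := good _ (ok s t sh th).
split; [exact: A1|exact: A2|].
have hn0 : h != 0 by rewrite gt_eqF.
apply: (mulfI hn0); apply: (mulfI hn0); rewrite -E1 (addrCA (s' *: v)) -E2.
by rewrite [h *: u + (h *: v + x)]addrCA (addrAC _ _ (- f (h *: v + x))).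
Qed.

Lemma derive_comm (f : V -> R^o) (x u v : V) : smooth_near x f ->
  'D_u ('D_v f) x = 'D_v ('D_u f) x.
Proof. by move=> sf; exact (derive_comm_aux erefl erefl sf). Qed.

End SymmetryOfSecondDerivatives.

(** * The inverse function theorem and submersions *)

Section InverseFunction.
Context {R : realType}.

Lemma rV_norm_le n (x : 'rV[R]_n) (e : R) : 0 <= e ->
  (forall j, `|x ord0 j| <= e) -> `|x| <= e.
Proof.
move=> e0 xe; rewrite /Num.Def.normr /= mx_normrE.
by apply: bigmax_le => // -[i j] _; rewrite (ord1 i); exact: xe.
Qed.

Lemma rV_coord_le n (x : 'rV[R]_n) j : `|x ord0 j| <= `|x|.
Proof.
by rewrite [leRHS]/Num.Def.normr /= mx_normrE; exact: (le_bigmax _ _ (ord0, j)).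
Qed.

Lemma mulmx_bound n m (B : 'M[R]_(n, m)) :
  exists2 C : R, 0 < C & forall v : 'rV[R]_n, `|v *m B| <= C * `|v|.
Proof.
pose C : R := 1 + \sum_i \sum_j `|B i j|.
have C0 : 0 < C by rewrite ltr_pwDl// sumr_ge0// => i _; exact: sumr_ge0.
exists C => // v; apply: rV_norm_le => [|j]; first by rewrite mulr_ge0// ltW.
rewrite mxE (le_trans (ler_norm_sum _ _ _))// mulrDl mul1r mulr_suml.
apply: ler_wpDl => //; apply: ler_sum => i _.
rewrite normrM mulrC ler_pM// ?rV_coord_le//.
by rewrite (bigD1 j)//= lerDl sumr_ge0.
Qed.

Lemma mulmxr_continuous n m (B : 'M[R]_(n, m)) :
  continuous (fun v : 'rV[R]_n => v *m B).
Proof.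
move=> v; apply: (cvg_rV (nbhs_filter v)) => j; rewrite mxE.
under eq_fun do rewrite mxE.
apply: (cvg_sum_ord (W := R^o) (nbhs_filter v)) => i.
by apply: cvgMr_tmp; exact: coord_continuous.
Qed.

Lemma small_derive_lipschitz n m (h : 'rV[R]_n -> 'rV[R]_m) (x0 : 'rV[R]_n) (e :
  R) :
  smooth_near x0 h -> (forall v, 'D_v h x0 = 0) -> 0 < e ->
  \forall r \near 0^'+, forall x y, `|x0 - x| < r -> `|x0 - y| < r ->
    `|h x - h y| <= e * `|x - y|.
Proof.
move=> sh Dh0 e0.
pose hj (j : 'I_m) : 'rV[R]_n -> R^o := fun z => h z ord0 j.
pose d (i : 'I_n) : 'rV[R]_n := delta_mx 0 i.
have shj j : smooth_near x0 (hj j) by exact: smooth_near_coord.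
have n0 : 0 < n.+1%:R :> R by rewrite ltr0n.
(* The mean value theorem along a segment produces [n] terms, each at most [e / n.+1%:R] times the
   distance; [n.+1] instead of [n] also covers dimension 0. *)
pose P j z := differentiable (hj j) z /\
  forall i, `|'D_(d i) (hj j) z| <= e / n.+1%:R.
pose Q j i z := `|'D_(d i) (hj j) z| <= e / n.+1%:R.
have small : \forall z \near x0, forall j, P j z.
  apply: (@filter_forall _ _ (fun j z => P j z) (nbhs x0) (nbhs_filter x0)) => j;
    apply: filterI.
    by apply: filterS (smooth_near_near (shj j)) => z; exact:
      smooth_near_differentiable.
  apply: (@filter_forall _ _ (fun i z => Q j i z) (nbhs x0) (nbhs_filter x0)) =>
    i; rewrite /Q.
  have /cvgrPdist_le c := smooth_near_continuous (smooth_near_derive (d i) (shj j)).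
  have D0 : 'D_(d i) (hj j) x0 = 0.
    by rewrite /hj -(derive_coord _ _ (smooth_near_differentiable sh)) Dh0 mxE.
  have := c (e / n.+1%:R) (divr_gt0 e0 n0).
  by rewrite D0; apply: filterS => z; rewrite sub0r normrN.
have [r0 /= r00 good] : exists2 r : R, 0 < r & ball x0 r `<=` [set z | forall j,
  P j z].
  by move/nbhs_ballP: small => [r ? ?]; exists r.
near=> r => x y xr yr.
have r_lt : r <= r0 by near: r; exact: nbhs_right_le.
have seg (s : R) : 0 <= s <= 1 -> ball x0 r0 (s *: (x - y) + y).
  move=> /andP[s0 s1]; rewrite -ball_normE /=; apply: lt_le_trans r_lt.
  have -> : x0 - (s *: (x - y) + y) = s *: (x0 - x) + (1 - s) *: (x0 - y).
    by apply/rowP => j; rewrite !mxE; ring.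
  apply: le_lt_trans (ler_normD _ _) _; rewrite !normrZ ger0_norm// ger0_norm
    ?subr_ge0//.
  have := ltW xr; have := ltW yr.
  have [->|sn1] := eqVneq s 1; first by rewrite subrr mul0r addr0 mul1r.
  have s1' : 0 < 1 - s by rewrite subr_gt0 lt_neqAle sn1.
  move=> _ /(ler_wpM2l s0) xr'; have := yr; rewrite -(ltr_pM2l s1') => yr'.
  by move: xr' yr'; lra.
apply: rV_norm_le => [|j]; first by rewrite mulr_ge0// ltW.
have [|s s01] := @MVT_line R _ (hj j) (x - y) y 1 ltr01.
  by move=> s /seg/good/(_ j)[].
rewrite scale1r subrK mul1r !mxE => ->.
have [dj sj] := good _ (seg s s01) j.
rewrite (derive_rV_sum _ dj).
apply: le_trans (ler_norm_sum _ _ _) _.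
apply: (@le_trans _ _ (\sum_(i < n) (e / n.+1%:R) * `|x - y|)).
  apply: ler_sum => i _; rewrite normrM mulrC ler_pM// ?rV_coord_le//.
rewrite sumr_const card_ord -[leLHS]mulr_natl mulrA ler_wpM2r//.
rewrite mulrCA ger_pMr// ler_pdivrMr// mul1r ler_nat.
exact: leqnSn.
Unshelve. all: by end_near. Qed.

Lemma contraction_fixpoint n (U : set 'rV[R]_n) (K : 'rV[R]_n -> 'rV[R]_n) (q : R) :
  0 <= q < 1 -> closed U -> U !=set0 -> (forall x, U x -> U (K x)) ->
  (forall x y, U x -> U y -> `|K x - K y| <= q * `|x - y|) ->
  exists2 p, U p & K p = p.
Proof.
move=> /andP[q0 q1] cU U0 UK Kq.
pose X : completeNormedModType R :=
  HB.pack 'rV[R]_n (NormedModule.on 'rV[R]_n) (Complete.on 'rV[R]_n).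
have Kfun : isFun _ _ U U K by constructor.
pose K' : {fun U >-> U} := HB.pack K Kfun.
have [|p Up Ep] := @banach_fixed_point R X U K' _ cU U0; last by exists p.
by exists (NngNum q0); split => // -[x y] /= [Ux Uy]; exact: Kq.
Qed.

End InverseFunction.

Lemma Ck_on_smooth_near {R : realType} (V W : normedModType R) k (A : set V)
    (f : V -> W) : (forall x, A x -> smooth_near x f) -> Ck_on k A f.
Proof.
elim: k f => [|k IH] f sf.
  by move=> x /sf; exact: smooth_near_continuous.
split=> [x /sf|v]; first exact: smooth_near_differentiable.
by apply: IH => x /sf; exact: smooth_near_derive.
Qed.

Section InverseFunctionTheorem.
Context {R : realType} {n : nat}.
Variables (f : 'rV[R]_n -> 'rV[R]_n) (x0 : 'rV[R]_n).
Hypotheses (sf : smooth_near x0 f) (df1 : forall v, 'D_v f x0 = v).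

Let J (x : 'rV[R]_n) : 'M[R]_n :=
  \matrix_(i, j) 'D_(delta_mx 0 i) (fun y => f y ord0 j : R^o) x.

Let derive_J x v : smooth_near x f -> 'D_v f x = v *m J x.
Proof.
move=> /smooth_near_differentiable d; rewrite (derive_rV_sum v d).
apply/rowP => j; rewrite summxE mxE; apply: eq_bigr => i _.
by rewrite !mxE (derive_coord _ _ d).
Qed.

Let J_smooth x i j : smooth_near x f -> smooth_near x (fun y => J y i j : R^o).
Proof.
move=> s; under eq_fun do rewrite mxE.
exact: smooth_near_derive (smooth_near_coord j s).
Qed.

Let J1 : J x0 = 1%:M.
Proof.
apply/row_matrixP => i; rewrite row1 rowE -(derive_J _ sf); exact: df1.
Qed.

Let near_ball (P : 'rV[R]_n -> Prop) : (\forall z \near x0, P z) ->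
  \forall r \near (0 : R)^'+, forall z, `|x0 - z| < r -> P z.
Proof.
move=> /nbhs_ballP[e /= e0 eP]; near=> r => z zr; apply: eP.
rewrite -ball_normE /=; apply: lt_le_trans zr _.
by near: r; exact: nbhs_right_le.
Unshelve. all: by end_near. Qed.

Let unitmx_near : \forall z \near x0, J z \in unitmx.
Proof.
pose dJ : 'rV[R]_n -> R^o := fun z => \det (J z).
have cJ : {for x0, continuous dJ}.
  have [A [oA Ax Af]] := sf.
  suff : Ck_on 0 A dJ by move=> /(_ _ Ax).
  apply: Ck_det => // i j; apply: Ck_S.
  under eq_fun do rewrite mxE.
  have [_ D] := Ck_coord j oA (Af 2%N); exact: D.
have d0 : dJ x0 != 0 by rewrite /dJ J1 det1 oner_neq0.
have nz : \forall z \near x0, dJ z != 0 by exact: cvgr_neq0 cJ d0.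
apply: filterS nz => z; by rewrite unitmxE unitfE.
Qed.

(** Write [f = id + h]. The derivative of [h] vanishes at [x0], so [h] is 1/2-Lipschitz on a small
    ball, which gives the factor 2 in the third clause. Solving [f x = y] means finding a fixed
    point of [x |-> y - h x], a contraction that preserves the closed ball of radius [r / 2] because
    [r / 4 + (1 / 2) * (r / 2) = r / 2]. *)
Lemma local_inverse : exists (r : R) (g : 'rV[R]_n -> 'rV[R]_n), [/\ 0 < r,
  (forall x, `|x0 - x| < r -> smooth_near x f /\ J x \in unitmx),
  (forall x y, `|x0 - x| < r -> `|x0 - y| < r -> `|x - y| <= 2 * `|f x - f y|),
  (forall y, `|f x0 - y| < r / 4 -> `|x0 - g y| < r /\ f (g y) = y) &
  (forall x, `|x0 - x| < r -> `|f x0 - f x| < r / 4 -> g (f x) = x)].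
Proof.
pose h x := f x - x.
have sh : smooth_near x0 h.
  have -> : h = fun x => f x + (-1) *: x by apply/funext => x; rewrite scaleN1r.
  exact: smooth_near_add sf (smooth_near_scale _ (smooth_near_id x0)).
have dh v : 'D_v h x0 = 0.
  have d1 := smooth_near_differentiable sf.
  have d2 := smooth_near_differentiable (smooth_near_id x0).
  rewrite (deriveB (v:=v) (diff_derivable d1) (diff_derivable d2)).
  by rewrite df1 derive_id subrr.
have N1 := small_derive_lipschitz sh dh (e := 1 / 2) ltac:(by rewrite divr_gt0).
have N0 : \forall z \near x0, smooth_near z f /\ J z \in unitmx.
  exact: filterI (smooth_near_near sf) unitmx_near.
have N2 := near_ball N0.
have N3 : \forall r \near (0 : R)^'+, 0 < r by exact: nbhs_right_gt.
have [r [L [S r0]]] := filter_ex (filterI N1 (filterI N2 N3)).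
have low x y : `|x0 - x| < r -> `|x0 - y| < r -> `|x - y| <= 2 * `|f x - f y|.
  move=> xr yr; have := L x y xr yr.
  have : `|x - y| <= `|f x - f y| + `|h x - h y|.
    have -> : x - y = (f x - f y) - (h x - h y).
      by rewrite /h opprB addrC addrA; apply/rowP => j; rewrite !mxE; ring.
    exact: ler_normB.
  lra.
have ex y : `|f x0 - y| < r / 4 -> exists x, `|x0 - x| < r /\ f x = y.
  move=> yr.
  pose U := closed_ball_ (fun z : 'rV[R]_n => `|z|) x0 (r / 2).
  have Ur x : U x -> `|x0 - x| < r.
    by rewrite /U /closed_ball_ /= => xr; move: xr r0; lra.
  have x0r : `|x0 - x0| < r by rewrite subrr normr0.
  have [|||||p Up Ep] := @contraction_fixpoint R n U (fun x => y - h x) (1 / 2).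
  - lra.
  - exact: closed_closed_ball_.
  - by exists x0; rewrite /U /closed_ball_ /= subrr normr0; move: r0; lra.
  - move=> x Ux; rewrite /U /closed_ball_ /=.
    have -> : x0 - (y - h x) = (f x0 - y) - (h x0 - h x).
      by rewrite /h; apply/rowP => j; rewrite !mxE; ring.
    apply: le_trans (ler_normB _ _) _.
    have := L x0 x x0r (Ur _ Ux); move: Ux; rewrite /U /closed_ball_ /=.
    by move: yr r0; lra.
  - move=> x x' Ux Ux'; have := L x' x (Ur _ Ux') (Ur _ Ux).
    have -> : y - h x - (y - h x') = h x' - h x.
      by apply/rowP => j; rewrite !mxE; ring.
    by rewrite (distrC x' x).
  exists p; split; first exact: Ur.
  apply/rowP => j; have := congr1 (fun v : 'rV[R]_n => v ord0 j) Ep.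
  by rewrite /h !mxE; lra.
pose g y := xget x0 [set x | `|x0 - x| < r /\ f x = y].
exists r, g; split => //.
- by move=> y /ex exy; exact: xgetPex exy.
- move=> x xr fxr; have [gr fg] : `|x0 - g (f x)| < r /\ f (g (f x)) = f x.
    exact: xgetPex (ex _ fxr).
  have := low _ _ gr xr; rewrite fg subrr normr0 mulr0 normr_le0 subr_eq0.
  by move/eqP.
Qed.

(** The estimate [|x - y| <= 2 * |f x - f y|] makes the local inverse Lipschitz, hence
    differentiable with matrix [invmx (J (g y))]. Higher regularity is a bootstrap: if [g] is of
    class C^k, so is this matrix as a function of [y], hence [g] is of class C^(k+1). *)
Theorem inverse_function : exists g : 'rV[R]_n -> 'rV[R]_n,
  [/\ smooth_near (f x0) g, g (f x0) = x0,
      \forall y \near f x0, f (g y) = y & \forall x \near x0, g (f x) = x].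
Proof.
have [r [g [r0 good low fg gf]]] := local_inverse.
have r4 : 0 < r / 4 by rewrite divr_gt0.
pose A : set 'rV[R]_n := [set x | `|x0 - x| < r].
pose B : set 'rV[R]_n := [set y | `|f x0 - y| < r / 4].
have oA : open A.
  have -> : A = ball x0 r by rewrite -ball_normE.
  exact: ball_open.
have oB : open B.
  have -> : B = ball (f x0) (r / 4) by rewrite -ball_normE.
  exact: ball_open.
have Bf : B (f x0) by rewrite /B /= subrr normr0.
have Ax0 : A x0 by rewrite /A /= subrr normr0.
have AB y : B y -> A (g y) by move=> /fg[].
have gE : g (f x0) = x0 by exact: gf.
have dg y : B y -> differentiable g y /\
    'd g y = mulmxr (invmx (J (g y))) :> ('rV[R]_n -> 'rV[R]_n).
  move=> By; have [gr fgy] := fg y By.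
  have [sg uJ] := good _ gr.
  have dgy := smooth_near_differentiable sg.
  apply: differentiable_eps => [|e e0]; first exact: mulmxr_continuous.
  have [c c0 cb] := mulmx_bound (invmx (J (g y))).
  (* The factor [c] absorbs the norm of the inverse matrix, and the factor 2 the bound of the
     increment [k] of [g] by [2 * |h|]. *)
  have e' : 0 < e / (2 * c) by rewrite divr_gt0// mulr_gt0.
  have /nbhs_ballP[d /= d0 bd] := differentiable_bound dgy e'.
  have nB : \forall h \near (0 : 'rV[R]_n), B (h + y).
    have nBy : \forall z \near y, B z by exact: open_nbhs_nbhs.
    move: nBy; rewrite (near_shift 0 y) /=.
    by apply: filterS => z /=; rewrite subr0.
  have nd : \forall h \near (0 : 'rV[R]_n), `|h| < d / 2.
    by apply: nbhs0_lt; rewrite divr_gt0.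
  near=> h.
  have Bh : B (h + y) by near: h.
  have hd : `|h| < d / 2 by near: h.
  have [gr' fgy'] := fg _ Bh.
  set k := g (h + y) - g y.
  have kh : `|k| <= 2 * `|h|.
    by have := low _ _ gr' gr; rewrite fgy fgy' addrK.
  have kd : ball 0 d k.
    by rewrite -ball_normE /= sub0r normrN; move: kh hd; lra.
  have := bd _ kd; rewrite /= subrK fgy fgy' addrK.
  rewrite -(deriveE k dgy) (derive_J _ sg) => o1.
  have -> : k - mulmxr (invmx (J (g y))) h = - ((h - k *m J (g y)) *m invmx (J (g
    y))).
    by rewrite mulmxBl mulmxK// opprB.
  rewrite normrN; apply: le_trans (cb _) _.
  apply: le_trans (ler_wpM2l (ltW c0) o1) _.
  apply: le_trans (ler_wpM2l (ltW c0) (ler_wpM2l (ltW e') kh)) _.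
  rewrite le_eqVlt; apply/orP; left; apply/eqP; field.
  by rewrite gt_eqF.
have Dg y v : B y -> 'D_v g y = v *m invmx (J (g y)).
  by move=> /dg[d E]; rewrite (deriveE v d) E.
have Cg k : Ck_on k B g.
  elim: k => [|k IH].
    by move=> y /dg[d _]; exact: differentiable_continuous.
  split=> [y /dg[]//|v].
  apply: (@Ck_ext _ _ _ _ _ (fun y => v *m invmx (J (g y)))) => //.
    by move=> y By; rewrite Dg.
  apply: Ck_rV => // j.
  under eq_fun do rewrite mxE.
  have -> : (fun y => \sum_i v ord0 i * invmx (J (g y)) i j : R^o) =
     \sum_i (fun y => v ord0 i * invmx (J (g y)) i j : R^o).
    by apply/funext => y; rewrite fct_sumE.
  apply: Ck_sum => // i; apply: Ck_mul => //; first exact: Ck_cst.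
  apply: (Ck_comp_fun oB AB IH (F := fun x => invmx (J x) i j)).
  apply: Ck_invmx => //; first by move=> x /good[].
  by move=> a b; apply: Ck_on_smooth_near => x /good[sx _]; exact: J_smooth.
exists g; split => //.
- by exists B.
- exact: near_open Bf (fun y By => (fg y By).2).
- have : \forall x \near x0, B (f x).
    by apply: (smooth_near_cvg sf); exact: near_open Bf _.
  move=> nB; have nA : \forall x \near x0, A x by exact: near_open Ax0 _.
  by apply: filterS2 nA nB => x Ax /(gf x Ax).
Unshelve. all: by end_near. Qed.

End InverseFunctionTheorem.

(** * Local lifts through a map with surjective derivative *)

Section LocalLifting.
Context {R : realType}.

Lemma smooth_near_mulmxr n m (x : 'rV[R]_n) (B : 'M[R]_(n, m)) :
  smooth_near x (fun z => z *m B).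
Proof. by apply: (@smooth_near_lin _ _ _ x (mulmxr B)); exact: mulmxr_continuous.
  Qed.

Lemma derive_mulmxr n m (x v : 'rV[R]_n) (B : 'M[R]_(n, m)) :
  'D_v (fun z => z *m B) x = v *m B.
Proof.
have d := smooth_near_differentiable (smooth_near_mulmxr x B).
rewrite (deriveE v d) (_ : (fun z => z *m B) = mulmxr B)// diff_lin//.
exact: mulmxr_continuous.
Qed.

Lemma derive_row_mx (V : normedModType R) n m (f : V -> 'rV[R]_n)
    (g : V -> 'rV[R]_m) (x v : V) : differentiable f x -> differentiable g x ->
  'D_v (fun y => row_mx (f y) (g y)) x = row_mx ('D_v f x) ('D_v g x).
Proof.
move=> df dg.
have d : differentiable (fun y => row_mx (f y) (g y)) x.
  apply: differentiable_rV => j; rewrite -(splitK j); case: (fintype.split j) =>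
    i /=.
    by under eq_fun do rewrite row_mxEl; exact: differentiable_coord_comp.
  by under eq_fun do rewrite row_mxEr; exact: differentiable_coord_comp.
apply/rowP => j; rewrite (derive_coord _ _ d) -(splitK j).
case: (fintype.split j) => i /=.
  by rewrite row_mxEl (derive_coord _ _ df); under eq_fun do rewrite row_mxEl.
by rewrite row_mxEr (derive_coord _ _ dg); under eq_fun do rewrite row_mxEr.
Qed.

(* With [A] a right inverse of the derivative [T] of [tau] at [a0], the inverse
   function theorem applies to [(a, b) |-> (a, tau(a + bA) - (a - a0)T)], whose
   derivative at [(a0, 0)] is the identity. *)
Lemma local_lifting n m (tau : 'rV[R]_n -> 'rV[R]_m) (a0 : 'rV[R]_n) :
  smooth_near a0 tau -> (forall eta, exists xi, 'D_xi tau a0 = eta) ->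
  exists L : 'rV[R]_(n + m) -> 'rV[R]_n,
    [/\ smooth_near (row_mx a0 (tau a0)) L,
        \forall z \near row_mx a0 (tau a0), tau (L z) = rsubmx z &
        \forall a \near a0, L (row_mx a (tau a)) = a].
Proof.
move=> st surj.
have dt := smooth_near_differentiable st.
have [c cE] : exists c : 'rV[R]_m -> 'rV[R]_n, forall eta, 'D_(c eta) tau a0 = eta.
  by exists (fun eta => sval (cid (surj eta))) => eta; case: cid.
pose T : 'M[R]_(n, m) := jacobian tau a0.
have TE v : 'D_v tau a0 = v *m T by exact: deriveEjacobian.
pose A : 'M[R]_(m, n) := \matrix_i c (delta_mx 0 i).
have AT : A *m T = 1%:M.
  by apply/row_matrixP => i; rewrite row_mul rowK -TE cE row1.
pose P : 'M[R]_(n + m, n) := col_mx 1%:M 0.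
pose Q : 'M[R]_(n + m, n) := col_mx 1%:M A.
pose S : 'M[R]_(n + m, m) := col_mx T 0.
have mP a b : row_mx a b *m P = a by rewrite mul_row_col mulmx1 mulmx0 addr0.
have mQ a b : row_mx a b *m Q = a + b *m A by rewrite mul_row_col mulmx1.
have mS a b : row_mx a b *m S = a *m T by rewrite mul_row_col mulmx0 addr0.
have zP z : z *m P = lsubmx z by rewrite -[z in LHS]hsubmxK mP.
pose F z := row_mx (z *m P) (tau (z *m Q) - (z *m S - a0 *m T)).
pose z0 : 'rV[R]_(n + m) := row_mx a0 0.
have z0Q : z0 *m Q = a0 by rewrite mQ mul0mx addr0.
have Fz0 : F z0 = row_mx a0 (tau a0) by rewrite /F z0Q mP mS subrr subr0.
have sQ : smooth_near z0 (fun z => tau (z *m Q)).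
  apply: (smooth_near_comp (smooth_near_mulmxr z0 Q)).
  by rewrite z0Q.
have sN p q (x : 'rV[R]_p) (f g : 'rV[R]_p -> 'rV[R]_q) : smooth_near x f ->
  smooth_near x g ->
    smooth_near x (fun z => f z - g z).
  move=> sf sg; under eq_fun do rewrite -scaleN1r.
  exact: smooth_near_add sf (smooth_near_scale _ sg).
have sS z : smooth_near z (fun z => z *m S - a0 *m T).
  by apply: sN; [exact: smooth_near_mulmxr|exact: smooth_near_cst].
have sF2 : smooth_near z0 (fun z => tau (z *m Q) - (z *m S - a0 *m T)) by exact: sN.
have sF : smooth_near z0 F.
  by apply: smooth_near_row_mx => //; exact: smooth_near_mulmxr.
have dQ v : 'D_v (fun z => tau (z *m Q)) z0 = v *m Q *m T.
  have d1 := smooth_near_differentiable (smooth_near_mulmxr z0 Q).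
  have d2 : differentiable tau (z0 *m Q) by rewrite z0Q.
  by rewrite (derive_comp v d1 d2) derive_mulmxr z0Q TE.
have DF v : 'D_v F z0 = v.
  have d1 := smooth_near_differentiable (smooth_near_mulmxr z0 P).
  have d2 := smooth_near_differentiable sF2.
  rewrite (derive_row_mx _ d1 d2) derive_mulmxr.
  have d3 := smooth_near_differentiable sQ.
  have d4 := smooth_near_differentiable (sS z0).
  have d5 := smooth_near_differentiable (smooth_near_mulmxr z0 S).
  rewrite (deriveB (v:=v) (diff_derivable d3) (diff_derivable d4)).
  rewrite (deriveB (v:=v) (diff_derivable d5) (derivable_cst _ _ _)) derive_cst
    subr0.
  rewrite dQ derive_mulmxr -[v in RHS]hsubmxK -[v]hsubmxK mP mQ mS !row_mxKl
    !row_mxKr.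
  by rewrite mulmxDl -mulmxA AT mulmx1 addrAC subrr add0r.
have [g [sg gz0 Fg gF]] := inverse_function sF DF.
rewrite Fz0 in sg gz0 Fg.
(* [F] preserves the first block, so [g (w z)] and [z] have the same first block and the same
   correction term; subtracting that term from the second block in advance makes it cancel in
   [F (g (w z)) = w z], leaving [tau (L z) = rsubmx z]. *)
pose w z : 'rV[R]_(n + m) := row_mx (z *m P) (rsubmx z - (z *m S - a0 *m T)).
set zz := row_mx a0 (tau a0) in sg gz0 Fg *.
have sw : smooth_near zz w.
  apply: smooth_near_row_mx; first exact: smooth_near_mulmxr.
  by apply: sN => //; exact: smooth_near_rsubmx.
have wzz : w zz = zz by rewrite /w /zz mP mS subrr subr0 row_mxKr.
exists (fun z => g (w z) *m Q); split.
- apply: (@smooth_near_comp _ _ _ _ _ (fun z => g (w z)) (fun z => z *m Q)); last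
  exact: smooth_near_mulmxr.
  by apply: smooth_near_comp => //; rewrite wzz.
- have : \forall z \near zz, F (g (w z)) = w z.
    by apply: (smooth_near_cvg (P := fun y => F (g y) = y) sw); rewrite wzz.
  apply: filterS => z; rewrite /F /w => /eq_row_mx[E1 E2].
  have ES : g (w z) *m S = z *m S.
    rewrite -[g (w z)]hsubmxK -[z in RHS]hsubmxK !mS; congr (_ *m T).
    by rewrite -!zP.
  by move: E2; rewrite -/(w z) ES => /addIr.
- pose e a : 'rV[R]_(n + m) := row_mx a 0.
  have se : smooth_near a0 e.
    by apply: smooth_near_row_mx; [exact: smooth_near_id|exact: smooth_near_cst].
  have : \forall a \near a0, g (F (e a)) = e a.
    exact: (smooth_near_cvg (P := fun y => g (F y) = y) se).
  apply: filterS => a ga.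
  have <- : F (e a) = w (row_mx a (tau a)).
    by rewrite /F /w /e !mP !mS mQ mul0mx addr0 row_mxKr.
  by rewrite ga mQ mul0mx addr0.
Qed.

End LocalLifting.

(** * Charts, smooth functions and curves *)

Section Charts.
Context {R : realType}.
Implicit Types M N : chartedSpace R.

Lemma near_near (T : topologicalType) (x : T) (P : T -> Prop) :
  (\forall y \near x, P y) -> \forall y \near x, \forall z \near y, P z.
Proof. by move=> /nbhs_interior. Qed.

Lemma near_dom M (i : chart M) x : is_manifold M -> dom i x ->
  \forall y \near x, dom i y.
Proof. by move=> hM dx; apply: open_nbhs_nbhs; split=> //; exact: chart_open. Qed.

Lemma near_continuous (T U : topologicalType) (x : T) (f : T -> U) (P : U -> Prop) :
  {for x, continuous f} -> (\forall z \near f x, P z) -> \forall y \near x, P (f y).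
Proof. by move=> cf; exact: cf. Qed.

(* The value is meaningless (equal to the default [x]) off the image of [i]. *)
Definition chart_inv M (i : chart M) (x : M) (a : 'rV[R]_(dim M)) : M :=
  xget x [set y | dom i y /\ coord i y = a].

Lemma coordK M (i : chart M) (x y : M) : is_manifold M -> dom i y ->
  chart_inv i x (coord i y) = y.
Proof.
move=> hM dy; have [] : [set z | dom i z /\ coord i z = coord i y] (chart_inv i x
  (coord i y)).
  by apply: xgetPex; exists y.
by move=> dz E; exact: (chart_injective hM dz dy E).
Qed.

(** Plays the role of continuity of the inverse chart: by [chart_open_map] the coordinates of a
    neighbourhood of [x] fill a neighbourhood of [coord i x]. *)
Lemma near_chart_inv M (i : chart M) (x x0 : M) (P : M -> Prop) :
  is_manifold M -> dom i x -> (\forall y \near x, P y) ->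
  \forall a \near coord i x, [/\ dom i (chart_inv i x0 a),
    coord i (chart_inv i x0 a) = a & P (chart_inv i x0 a)].
Proof.
move=> hM dx nP; have [U [oU Ux UP]] := near_openE (filterI (near_dom hM dx) nP).
have oV : open (coord i @` U) by apply: (chart_open_map hM) => // y /UP[].
apply: (near_open oV) => [|_ [y Uy <-]]; first by exists x.
by have [dy Py] := UP y Uy; rewrite coordK.
Qed.

Lemma near_coord M (i : chart M) (x : M) (P : 'rV[R]_(dim M) -> Prop) :
  is_manifold M -> dom i x -> (\forall a \near coord i x, P a) ->
  \forall y \near x, P (coord i y).
Proof. by move=> hM dx nP; exact: (chart_continuous hM dx). Qed.

(** [smooth_fun_at] provides some chart; the transition map allows the chart to be prescribed. *)
Lemma smooth_fun_chart M (i : chart M) (x : M) (f : M -> R) : is_manifold M ->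
  dom i x -> smooth_fun_at x f ->
  exists2 g : 'rV[R]_(dim M) -> R^o, smooth_near (coord i x) g &
    \forall y \near x, f y = g (coord i y).
Proof.
move=> hM dx [j [g [dj sg fg]]].
have [h sh jh] := chart_compatible hM dx dj.
have E : coord j x = h (coord i x) by exact: nbhs_singleton jh.
exists (fun a => g (h a)); first by apply: smooth_near_comp_fun => //; rewrite -E.
by apply: filterS2 fg jh => y -> ->.
Qed.

Lemma smooth_fun_eq M (x : M) (f g : M -> R) :
  (\forall y \near x, f y = g y) -> smooth_fun_at x f -> smooth_fun_at x g.
Proof.
move=> fg [i [h [dx sh fh]]]; exists i, h; split=> //.
by apply: filterS2 fg fh => y -> ->.
Qed.

Lemma smooth_fun_near M (x : M) (f : M -> R) : is_manifold M ->
  smooth_fun_at x f -> \forall y \near x, smooth_fun_at y f.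
Proof.
move=> hM [i [h [dx sh fh]]].
have n1 := near_coord hM dx (smooth_near_near sh).
have n2 := near_near fh; have n3 := near_dom hM dx.
near=> y; exists i, h; split; [near: y; exact: n3|near: y; exact: n1|near: y;
  exact: n2].
Unshelve. all: by end_near. Qed.

Lemma smooth_fun_coord M (i : chart M) (x : M) k : is_manifold M -> dom i x ->
  smooth_fun_at x (fun y => coord i y ord0 k).
Proof.
move=> hM dx; exists i, (fun a => a ord0 k); split => //.
  exact: smooth_near_coord (smooth_near_id _).
by apply: filterS (near_dom hM dx).
Qed.

Lemma smooth_fun_rV M n (i : chart M) (x : M) (u : M -> 'rV[R]_n) :
  is_manifold M -> dom i x ->
  (forall k, smooth_fun_at x (fun y => u y ord0 k)) ->
  exists2 g : 'rV[R]_(dim M) -> 'rV[R]_n, smooth_near (coord i x) g &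
    \forall y \near x, u y = g (coord i y).
Proof.
move=> hM dx su.
have [g gP] : exists g : 'I_n -> 'rV[R]_(dim M) -> R^o, forall k,
   smooth_near (coord i x) (g k) /\ \forall y \near x, u y ord0 k = g k (coord i y).
  suff H k : exists g : 'rV[R]_(dim M) -> R^o,
     smooth_near (coord i x) g /\ \forall y \near x, u y ord0 k = g (coord i y).
    by exists (fun k => sval (cid (H k))) => k; case: cid.
  by have [g sg ug] := smooth_fun_chart hM dx (su k); exists g.
exists (fun a => \row_k g k a).
  apply: smooth_near_rV => k; under eq_fun do rewrite mxE.
  by have [] := gP k.
pose P k y := u y ord0 k = g k (coord i y).
have : \forall y \near x, forall k, P k y.
  apply: (@filter_forall _ _ (fun k y => P k y) (nbhs x) (nbhs_filter x)) => k.
  by have [] := gP k.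
by apply: filterS => y Py; apply/rowP => k; rewrite mxE; exact: Py.
Qed.

Lemma smooth_fun_comp M n (x : M) (u : M -> 'rV[R]_n) (H : 'rV[R]_n -> R^o) :
  is_manifold M -> (forall k, smooth_fun_at x (fun y => u y ord0 k)) ->
  smooth_near (u x) H -> smooth_fun_at x (fun y => H (u y)).
Proof.
move=> hM su sH; have [i dx] := chart_cover hM x.
have [g sg ug] := smooth_fun_rV hM dx su.
exists i, (fun a => H (g a)); split=> //.
  by apply: smooth_near_comp_fun => //; rewrite -(nbhs_singleton ug).
by apply: filterS ug => y ->.
Qed.

Lemma smooth_fun_add M (x : M) (f g : M -> R) : is_manifold M ->
  smooth_fun_at x f -> smooth_fun_at x g -> smooth_fun_at x (fun y => f y + g y).
Proof.
move=> hM sf sg; have [i dx] := chart_cover hM x.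
have [f' sf' ff'] := smooth_fun_chart hM dx sf.
have [g' sg' gg'] := smooth_fun_chart hM dx sg.
exists i, (fun a => f' a + g' a); split => //; first exact: smooth_near_add.
by apply: filterS2 ff' gg' => y -> ->.
Qed.

Lemma smooth_fun_scale M (x : M) (a : R) (f : M -> R) :
  smooth_fun_at x f -> smooth_fun_at x (fun y => a * f y).
Proof.
move=> [i [f' [dx sf' ff']]].
exists i, (fun z => a * f' z); split => //; first exact: (smooth_near_scale a sf').
by apply: filterS ff' => y ->.
Qed.

Lemma smooth_fun_comp_map M N (x : M) (f : M -> N) (h : N -> R) : is_manifold N ->
  smooth_at x f -> smooth_fun_at (f x) h -> smooth_fun_at x (h \o f).
Proof.
move=> hN [cf [i [j [g [dx dj sg fg]]]]] sh.
have [h' sh' hh'] := smooth_fun_chart hN dj sh.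
exists i, (fun a => h' (g a)); split => //.
  by apply: smooth_near_comp_fun => //; rewrite -(nbhs_singleton fg).
have nh := near_continuous cf hh'.
by apply: filterS2 fg nh => y E /=; rewrite E.
Qed.

(** Continuity is a separate hypothesis because the values of [coord j] carry no information where
    [f] leaves [dom j]. *)
Lemma smooth_atP M N (x : M) (f : M -> N) (j : chart N) : is_manifold M ->
  {for x, continuous f} -> dom j (f x) ->
  (forall k, smooth_fun_at x (fun y => coord j (f y) ord0 k)) -> smooth_at x f.
Proof.
move=> hM cf dj sf; split=> //; have [i dx] := chart_cover hM x.
have [g sg fg] := smooth_fun_rV hM dx sf.
by exists i, j, g.
Qed.

Lemma smooth_at_continuous M N (x : M) (f : M -> N) :
  smooth_at x f -> {for x, continuous f}.
Proof. by case. Qed.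

Lemma smooth_at_coord M N (x : M) (f : M -> N) (j : chart N) k : is_manifold N ->
  smooth_at x f -> dom j (f x) ->
  smooth_fun_at x (fun y => coord j (f y) ord0 k).
Proof.
move=> hN sf dj.
exact: (smooth_fun_comp_map hN sf (smooth_fun_coord k hN dj)).
Qed.

Lemma smooth_at_comp M N (P : chartedSpace R) (x : M) (f : M -> N) (g : N -> P) :
  is_manifold M -> is_manifold N -> is_manifold P ->
  smooth_at x f -> smooth_at (f x) g -> smooth_at x (g \o f).
Proof.
move=> hM hN hP sf sg; have [j dj] := chart_cover hP (g (f x)).
apply: (smooth_atP hM _ dj).
  by apply: continuous_comp; exact: smooth_at_continuous.
move=> k.
exact: (smooth_fun_comp_map hN sf (smooth_at_coord k hP sg dj)).
Qed.

Lemma smooth_comp M N (P : chartedSpace R) (f : M -> N) (g : N -> P) :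
  is_manifold M -> is_manifold N -> is_manifold P ->
  smooth f -> smooth g -> smooth (g \o f).
Proof. by move=> hM hN hP sf sg x; exact: smooth_at_comp. Qed.

Lemma smooth_id M : is_manifold M -> smooth (@id M).
Proof.
move=> hM x; have [i dx] := chart_cover hM x.
apply: (smooth_atP hM _ dx); first exact: cvg_id.
by move=> k; exact: smooth_fun_coord.
Qed.

End Charts.

(** * Smooth curves *)

Section Curves.
Context {R : realType}.
Implicit Types M N : chartedSpace R.

Lemma smooth_curve_fun M (c : R -> M) (h : M -> R) : is_manifold M ->
  smooth_curve c -> smooth_fun_at (c 0) h -> smooth_near (0 : R^o) (h \o c : R^o
    -> R^o).
Proof.
move=> hM [cc [j [g [dj sg cg]]]] sh.
have [h' sh' hh'] := smooth_fun_chart hM dj sh.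
apply: (@smooth_near_eq _ _ _ _ (fun r : R^o => h' (g r))).
  have nh := near_continuous cc hh'.
  by apply: filterS2 cg nh => r E /= ->; rewrite E.
by apply: smooth_near_comp_fun => //; rewrite -(nbhs_singleton cg).
Qed.

Lemma smooth_curveP M (c : R -> M) (j : chart M) : {for 0, continuous c} ->
  dom j (c 0) ->
  (forall k, smooth_near (0 : R^o) (fun r => coord j (c r) ord0 k : R^o)) ->
  smooth_curve c.
Proof.
move=> cc dj sc; split=> //; exists j, (fun r => coord j (c r)); split=> //.
  exact: smooth_near_rV.
by exact: filterE.
Qed.

Lemma smooth_curve_comp M N (c : R -> M) (f : M -> N) : is_manifold M ->
  is_manifold N -> smooth_curve c -> smooth_at (c 0) f -> smooth_curve (f \o c).
Proof.
move=> hM hN sc sf; have [j dj] := chart_cover hN (f (c 0)).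
apply: (@smooth_curveP _ _ j) => //.
  by apply: continuous_comp; [case: sc|exact: smooth_at_continuous].
move=> k; apply: (smooth_curve_fun hM sc (h := fun y => coord j (f y) ord0 k)).
exact: smooth_at_coord.
Qed.

Lemma smooth_curve_eq M (c d : R -> M) : (\forall r \near (0 : R), c r = d r) ->
  smooth_curve c -> smooth_curve d.
Proof.
move=> cd [cc [j [g [dj sg cg]]]]; have E := nbhs_singleton cd; split.
  rewrite /prop_for /continuous_at -E; apply: cvg_trans cc.
  exact: near_eq_cvg.
exists j, g; split => //; first by rewrite -E.
by apply: filterS2 cd cg => r <-.
Qed.

Lemma smooth_curve_cst M (x : M) : is_manifold M -> smooth_curve (fun _ : R => x).
Proof.
move=> hM; have [j dj] := chart_cover hM x.
apply: (@smooth_curveP _ _ j) => //; first exact: cst_continuous.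
by move=> k; exact: smooth_near_cst.
Qed.

Lemma smooth_curve_chart_inv M (i : chart M) (x : M) (b : R^o -> 'rV[R]_(dim M)) :
  is_manifold M -> dom i x -> smooth_near (0 : R^o) b -> b 0 = coord i x ->
  smooth_curve (fun r => chart_inv i x (b r)) /\
  \forall r \near (0 : R), coord i (chart_inv i x (b r)) = b r.
Proof.
move=> hM dx sb b0.
have cb P : (\forall y \near x, P y) -> \forall r \near (0 : R),
    [/\ dom i (chart_inv i x (b r)), coord i (chart_inv i x (b r)) = b r &
        P (chart_inv i x (b r))].
  move=> nP; pose Q a := [/\ dom i (chart_inv i x a), coord i (chart_inv i x a) =
    a & P (chart_inv i x a)].
  apply: (near_continuous (P := Q) (smooth_near_continuous sb)).
  by rewrite b0; exact: near_chart_inv.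
have E : \forall r \near (0 : R), coord i (chart_inv i x (b r)) = b r.
  have nT : \forall y \near x, True by exact: filterE.
  have := cb (fun=> True) nT; by apply: filterS => r [].
have E0 : chart_inv i x (b 0) = x by rewrite b0 coordK.
split=> //; apply: (@smooth_curveP _ _ i).
- by rewrite /prop_for /continuous_at E0 => P /cb; apply: filterS => r [].
- by rewrite E0.
- move=> k; apply: (@smooth_near_eq _ _ _ _ (fun r : R^o => b r ord0 k : R^o)).
    by apply: filterS E => r ->.
  exact: smooth_near_coord.
Qed.

End Curves.

(** * Tangent vectors *)

Section TangentVectors.
Context {R : realType}.
Implicit Types M N : chartedSpace R.

Lemma velocityE M (c : R -> M) (h : M -> R) : smooth_fun_at (c 0) h ->
  velocity c h = 'D_1 (h \o c : R^o -> R^o) 0.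
Proof. by move=> sh; rewrite /velocity asboolT// derive1E. Qed.

Lemma tangent_nonsmooth M (x : M) (X : functional M) (h : M -> R) :
  tangent_vector x X -> ~ smooth_fun_at x h -> X h = 0.
Proof. by move=> [c [_ <- ->]] nh; rewrite /velocity asboolF. Qed.

Lemma velocity_eq M (c d : R -> M) : (\forall r \near (0 : R), c r = d r) ->
  velocity c = velocity d.
Proof.
move=> cd; have E := nbhs_singleton cd; apply/funext => h; rewrite /velocity E.
case: ifP => // _; rewrite !derive1E; apply: near_eq_derive.
by apply: filterS cd => r /= ->.
Qed.

Lemma velocity_tangent M (c : R -> M) : smooth_curve c ->
  tangent_vector (c 0) (velocity c).
Proof. by move=> sc; exists c. Qed.

(** The chain rule along a curve that represents [X]. The map [u] can be a chart, but also the pair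
    of coordinates of the two projections of a fibre product. *)
Lemma tangent_comp M (x : M) (X : functional M) n (u : M -> 'rV[R]_n)
    (H : 'rV[R]_n -> R^o) : is_manifold M -> tangent_vector x X ->
  (forall k, smooth_fun_at x (fun y => u y ord0 k)) -> smooth_near (u x) H ->
  X (fun y => H (u y)) = 'D_(\row_k X (fun y => u y ord0 k)) H (u x).
Proof.
move=> hM [c [sc c0 ->]] su sH; subst x.
have suc k := smooth_curve_fun hM sc (su k).
have su' : smooth_near (0 : R^o) (u \o c : R^o -> 'rV[R]_n) by exact:
  smooth_near_rV.
have d1 := smooth_near_differentiable su'.
have d2 := smooth_near_differentiable sH.
rewrite velocityE; last exact: smooth_fun_comp.
rewrite (derive_comp (1 : R^o) d1 d2); congr ('D__ H _).
by apply/rowP => k; rewrite mxE (derive_coord (1 : R^o) k d1) velocityE.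
Qed.

Definition tcoord M (i : chart M) (X : functional M) : 'rV[R]_(dim M) :=
  \row_k X (fun y => coord i y ord0 k).

Lemma tangent_eq M (x : M) (X : functional M) (f g : M -> R) :
  tangent_vector x X -> (\forall y \near x, f y = g y) -> X f = X g.
Proof.
move=> tX fg; have [sf|nsf] := pselect (smooth_fun_at x f); last first.
  rewrite (tangent_nonsmooth tX nsf) (tangent_nonsmooth tX)// => sg; apply: nsf.
  by apply: smooth_fun_eq sg; apply: filterS fg.
have sg := smooth_fun_eq fg sf.
have [c [[cc _] c0 XE]] := tX; subst x; rewrite XE !velocityE//.
by apply: near_eq_derive; exact: near_continuous cc fg.
Qed.

Lemma tangent_chart M (i : chart M) (x : M) (X : functional M) (h : M -> R)
    (g : 'rV[R]_(dim M) -> R^o) : is_manifold M -> tangent_vector x X ->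
  dom i x -> smooth_near (coord i x) g ->
  (\forall y \near x, h y = g (coord i y)) -> X h = 'D_(tcoord i X) g (coord i x).
Proof.
move=> hM tX dx sg hg; rewrite (tangent_eq tX hg).
by apply: tangent_comp => // k; exact: smooth_fun_coord.
Qed.

Lemma tangent_ext M (i : chart M) (x : M) (X Y : functional M) : is_manifold M ->
  dom i x -> tangent_vector x X -> tangent_vector x Y ->
  tcoord i X = tcoord i Y -> X = Y.
Proof.
move=> hM dx tX tY E; apply/funext => h.
have [sh|nsh] := pselect (smooth_fun_at x h); last first.
  by rewrite (tangent_nonsmooth tX)// (tangent_nonsmooth tY).
have [g sg hg] := smooth_fun_chart hM dx sh.
by rewrite (tangent_chart hM tX dx sg hg) (tangent_chart hM tY dx sg hg) E.
Qed.

Lemma curve_exists M (i : chart M) (x : M) (xi : 'rV[R]_(dim M)) : is_manifold M ->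
  dom i x -> exists c, [/\ smooth_curve c, c 0 = x,
    tcoord i (velocity c) = xi & \forall r \near (0 : R), coord i (c r) = r *: xi
      + coord i x].
Proof.
move=> hM dx; pose b (r : R^o) := r *: xi + coord i x.
have b0 : b 0 = coord i x by rewrite /b scale0r add0r.
have sb : smooth_near (0 : R^o) b.
  apply: smooth_near_add; last exact: smooth_near_cst.
  apply: smooth_near_rV => k; under eq_fun do rewrite mxE.
  by apply: smooth_near_mul; [apply: (@smooth_near_lin _ _ _ 0 idfun) => y;
    exact: cvg_id|exact: smooth_near_cst].
have [sc cE] := smooth_curve_chart_inv hM dx sb b0.
have c0 : chart_inv i x (b 0) = x by rewrite b0 coordK.
exists (fun r => chart_inv i x (b r)); split => //.
apply/rowP => k; rewrite mxE velocityE; last first.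
  by rewrite c0; exact: smooth_fun_coord.
have [db Db] := differentiable_affine xi (coord i x) (0 : R).
rewrite -[in RHS]Db (derive_coord (1 : R^o) k db).
by apply: near_eq_derive; apply: filterS cE => r /= ->.
Qed.

(** Recognises as a tangent vector an operator given by a formula, such as a sum or a bracket: the
    required curve is a straight line of direction [xi] in the chart. *)
Lemma tangentP M (i : chart M) (x : M) (X : functional M) (xi : 'rV[R]_(dim M)) :
  is_manifold M -> dom i x -> (forall h, ~ smooth_fun_at x h -> X h = 0) ->
  (forall h (g : 'rV[R]_(dim M) -> R^o), smooth_near (coord i x) g ->
     (\forall y \near x, h y = g (coord i y)) -> X h = 'D_xi g (coord i x)) ->
  tangent_vector x X.
Proof.
move=> hM dx X0 XE; have [c [sc c0 cE _]] := curve_exists xi hM dx.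
exists c; split => //; apply/funext => h.
have tc := velocity_tangent sc; rewrite c0 in tc.
have [sh|nsh] := pselect (smooth_fun_at x h); last first.
  by rewrite X0// (tangent_nonsmooth tc).
have [g sg hg] := smooth_fun_chart hM dx sh.
by rewrite (XE _ _ sg hg) (tangent_chart hM tc dx sg hg) cE.
Qed.

Lemma tangent_lin M (x : M) (a : R) (X Y : functional M) : is_manifold M ->
  tangent_vector x X -> tangent_vector x Y -> tangent_vector x (a *: X + Y).
Proof.
move=> hM tX tY; have [i dx] := chart_cover hM x.
apply: (@tangentP _ i _ _ (a *: tcoord i X + tcoord i Y)) => // [h nsh|h g sg hg].
  rewrite /GRing.add /= /GRing.scale /= (tangent_nonsmooth tX)//
    (tangent_nonsmooth tY)//.
  by rewrite scaler0 addr0.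
have d := smooth_near_differentiable sg.
rewrite (deriveE _ d) linearP -!(deriveE _ d).
by rewrite -(tangent_chart hM tX dx sg hg) -(tangent_chart hM tY dx sg hg).
Qed.

Lemma tangent0 M (x : M) : is_manifold M -> tangent_vector x (0 : functional M).
Proof.
move=> hM; have [i dx] := chart_cover hM x.
apply: (@tangentP _ i _ _ 0) => // h g sg _.
by rewrite derive0.
Qed.

Lemma tangent_fun_add M (x : M) (X : functional M) (f g : M -> R) : is_manifold M ->
  tangent_vector x X -> smooth_fun_at x f -> smooth_fun_at x g ->
  X (fun y => f y + g y) = X f + X g.
Proof.
move=> hM [c [sc c0 ->]] sf sg; subst x.
have d1 := smooth_near_differentiable (smooth_curve_fun hM sc sf).
have d2 := smooth_near_differentiable (smooth_curve_fun hM sc sg).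
rewrite !velocityE//; last exact: smooth_fun_add.
exact: (deriveD (v := (1 : R^o)) (diff_derivable d1) (diff_derivable d2)).
Qed.

Lemma tangent_fun_scale M (x : M) (X : functional M) (a : R) (f : M -> R) :
  is_manifold M ->
  tangent_vector x X -> smooth_fun_at x f ->
  X (fun y => a * f y) = a * X f.
Proof.
move=> hM [c [sc c0 ->]] sf; subst x.
have d1 := smooth_near_differentiable (smooth_curve_fun hM sc sf).
rewrite !velocityE//; last exact: smooth_fun_scale.
exact: (deriveZ (v := (1 : R^o)) a (diff_derivable d1)).
Qed.

Lemma smooth_fun_mul M (x : M) (f g : M -> R) : is_manifold M ->
  smooth_fun_at x f -> smooth_fun_at x g -> smooth_fun_at x (fun y => f y * g y).
Proof.
move=> hM sf sg; have [i dx] := chart_cover hM x.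
have [f' sf' ff'] := smooth_fun_chart hM dx sf.
have [g' sg' gg'] := smooth_fun_chart hM dx sg.
exists i, (fun a => f' a * g' a); split => //; first exact: smooth_near_mul.
by apply: filterS2 ff' gg' => y -> ->.
Qed.

Lemma tangent_fun_mul M (x : M) (X : functional M) (f g : M -> R) : is_manifold M ->
  tangent_vector x X -> smooth_fun_at x f -> smooth_fun_at x g ->
  X (fun y => f y * g y) = f x * X g + g x * X f.
Proof.
move=> hM [c [sc c0 ->]] sf sg; subst x.
have d1 := smooth_near_differentiable (smooth_curve_fun hM sc sf).
have d2 := smooth_near_differentiable (smooth_curve_fun hM sc sg).
rewrite !velocityE//; last exact: smooth_fun_mul.
exact: (deriveM (v := (1 : R^o)) (diff_derivable d1) (diff_derivable d2)).
Qed.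

Lemma smooth_fun_cst M (x : M) (a : R) : is_manifold M -> smooth_fun_at x (fun=> a).
Proof.
move=> hM; have [i dx] := chart_cover hM x; exists i, (fun=> a); split => //.
  exact: smooth_near_cst.
exact: filterE.
Qed.

Lemma tangent_fun_cst M (x : M) (X : functional M) (a : R) : is_manifold M ->
  tangent_vector x X -> X (fun=> a) = 0.
Proof.
move=> hM [c [sc c0 ->]]; subst x.
rewrite velocityE; last exact: smooth_fun_cst.
exact: derive_cst.
Qed.

Lemma smooth_fun_sum M (x : M) n (f : 'I_n -> M -> R) : is_manifold M ->
  (forall k, smooth_fun_at x (f k)) -> smooth_fun_at x (fun y => \sum_(k < n) f k
    y).
Proof.
move=> hM; elim: n f => [|n IH] f sf.
  by under eq_fun do rewrite big_ord0; exact: smooth_fun_cst.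
under eq_fun do rewrite big_ord_recr.
by apply: smooth_fun_add => //; exact: IH.
Qed.

Lemma tangent_fun_sum M (x : M) (X : functional M) n (f : 'I_n -> M -> R) :
  is_manifold M -> tangent_vector x X -> (forall k, smooth_fun_at x (f k)) ->
  X (fun y => \sum_(k < n) f k y) = \sum_(k < n) X (f k).
Proof.
move=> hM tX; elim: n f => [|n IH] f sf.
  by under eq_fun do rewrite big_ord0; rewrite big_ord0; exact: tangent_fun_cst tX.
under eq_fun do rewrite big_ord_recr /=.
rewrite (tangent_fun_add hM tX) ?big_ord_recr ?IH//.
exact: smooth_fun_sum.
Qed.

Lemma pushE M N (f : M -> N) (x : M) (X : functional M) (h : N -> R) :
  smooth_fun_at (f x) h -> push f x X h = X (h \o f).
Proof. by move=> sh; rewrite /push asboolT. Qed.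

Lemma push_nonsmooth M N (f : M -> N) (x : M) (X : functional M) (h : N -> R) :
  ~ smooth_fun_at (f x) h -> push f x X h = 0.
Proof. by move=> sh; rewrite /push asboolF. Qed.

Lemma push_velocity M N (f : M -> N) (c : R -> M) : is_manifold N ->
  smooth_at (c 0) f -> push f (c 0) (velocity c) = velocity (f \o c).
Proof.
move=> hN sf; apply/funext => h; rewrite /push /velocity /=.
case: asboolP => // sh; rewrite asboolT//.
exact: smooth_fun_comp_map.
Qed.

Lemma push_tangent M N (f : M -> N) (x : M) (X : functional M) : is_manifold M ->
  is_manifold N -> smooth_at x f -> tangent_vector x X ->
  tangent_vector (f x) (push f x X).
Proof.
move=> hM hN sf [c [sc c0 ->]]; subst x; rewrite push_velocity//.
exact: (velocity_tangent (smooth_curve_comp hM hN sc sf)).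
Qed.

Lemma push_lin M N (f : M -> N) (x : M) (a : R) (X Y : functional M) :
  push f x (a *: X + Y) = a *: push f x X + push f x Y.
Proof.
apply/funext => h; rewrite /push /GRing.add /= /GRing.scale /=.
by case: asboolP => // _; rewrite scaler0 addr0.
Qed.

Lemma push0 M N (f : M -> N) (x : M) : push f x 0 = 0.
Proof. by apply/funext => h; rewrite /push; case: asboolP. Qed.

Lemma push_comp M N (P : chartedSpace R) (f : M -> N) (g : N -> P) (x : M)
    (X : functional M) : is_manifold P -> smooth_at (f x) g ->
  push g (f x) (push f x X) = push (g \o f) x X.
Proof.
move=> hP sg; apply/funext => h.
have [sh|nsh] := pselect (smooth_fun_at (g (f x)) h); last by rewrite
  !push_nonsmooth.
by rewrite !pushE//; exact: smooth_fun_comp_map.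
Qed.

End TangentVectors.

(** * Sections and brackets of vector fields *)

Section Sections.
Context {R : realType}.
Implicit Types M N : chartedSpace R.

Lemma tangent_subbase_open M (U : set (tangent_bundle M)) :
  tangent_subbase U -> open U.
Proof.
move=> sU; exists [set U]; last by rewrite bigcup_set1.
by move=> _ ->; exact: (@finI_from1 _ _ _ id).
Qed.

Lemma tangent_continuous (T : topologicalType) N (F : T -> tangent_bundle N) (x :
  T) :
  (forall U : set (tangent_bundle N), tangent_subbase U -> U (F x) ->
     \forall y \near x, U (F y)) ->
  {for x, continuous F}.
Proof.
move=> FU A /near_openE[B [[D' sD' <-] [V D'V VFx] BA]].
have [S SD SV] := sD' V D'V.
rewrite /nbhs /=; have : \forall y \near x, V (F y).
  rewrite -SV; apply: (@filter_bigI _ _ S (fun i => F @^-1` i) (nbhs x)) => U US.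
  apply: FU; first by have := SD _ US; rewrite inE.
  by move: VFx; rewrite -SV; apply.
by apply: filterS => y Vy; apply: BA; exists V.
Qed.

Lemma smooth_fun_continuous M (x : M) (h : M -> R) : is_manifold M ->
  smooth_fun_at x h -> {for x, continuous (h : M -> R^o)}.
Proof.
move=> hM sh; have [i dx] := chart_cover hM x.
have [g sg hg] := smooth_fun_chart hM dx sh.
have c : {for x, continuous (fun y => g (coord i y))}.
  apply: continuous_comp; first exact: chart_continuous dx.
  exact: smooth_near_continuous sg.
rewrite /prop_for /continuous_at (nbhs_singleton hg).
apply: cvg_trans c; apply: near_eq_cvg.
by apply: filterS hg.
Qed.

(** The form of [section_along] in which the field is tested on smooth functions, so that brackets
    are handled without the charts of the tangent bundle. *)
Definition smooth_section M N (f : M -> N) (X : M -> functional N) : Prop :=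
  [/\ smooth f, forall x, tangent_vector (f x) (X x) &
      forall x h, smooth_fun_at (f x) h -> smooth_fun_at x (fun y => X y h)].

(** The last [dim N] coordinates of [F x] are the values of [X x] on coordinate functions.
    Conversely [X x h] is the derivative of the chart expression of [h] in the direction that they
    form. *)
Lemma section_alongP M N (f : M -> N) (X : M -> functional N) :
  is_manifold M -> is_manifold N -> section_along f X <-> smooth_section f X.
Proof.
move=> hM hN; split.
- move=> [F sF FE].
  have FX x : tangent_vector (f x) (X x) by have := svalP (F x); rewrite FE.
  have rep x : exists (i : chart M) (j : chart N) g, [/\ dom i x, dom j (f x),
      smooth_near (coord i x) g & \forall y \near x,
      row_mx (coord j (f y)) (tcoord j (X y)) = g (coord i y)].
    have [_ [i [j [g [dx dj sg Fg]]]]] := sF x.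
    exists i, j, g; split => //; first by move: dj; rewrite /= /tangent_dom /= FE.
    by apply: filterS Fg => y <-; rewrite /= /tangent_coord FE.
  (* Subbasic sets of the tangent bundle that constrain only the first [dim N] coordinates turn
     continuity of [F] into continuity of [f]. *)
  have cf x : {for x, continuous f}.
    have [cF _] := sF x; have [_ [j [_ [_ dj _ _]]]] := rep x.
    move=> A nA; have [U [oU Ux UA]] := near_openE (filterI nA (near_dom hN dj)).
    have oV : open (coord j @` U) by apply: (chart_open_map hN) => // y /UA[].
    pose O : set 'rV[R]_(dim N + dim N) := lsubmx @^-1` (coord j @` U).
    have oO : open O.
      by apply: open_comp => // z _; exact: continuous_lsubmx.
    have oW : open (tangent_dom j `&` (tangent_coord j @^-1` O)).
      by apply: tangent_subbase_open; exists j, O.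
    have : \forall y \near x, (tangent_dom j `&` (tangent_coord j @^-1` O)) (F y).
      apply: (near_continuous cF); apply: open_nbhs_nbhs; split=> //.
      rewrite /tangent_dom /= /O /= /tangent_coord FE /= row_mxKl.
      by split => //; exists (f x).
    apply: filterS => y []; rewrite /tangent_dom /O /tangent_coord /= FE /=
      row_mxKl.
    move=> djy [u Uu E]; have [Au dju] := UA u Uu.
    by rewrite -(chart_injective hN dju djy E).
  have sf : smooth f.
    move=> x; have [i [j [g [dx dj sg fg]]]] := rep x.
    split; first exact: cf.
    exists i, j, (fun a => lsubmx (g a)); split => //.
      exact: smooth_near_comp sg (smooth_near_lsubmx _).
    by apply: filterS fg => y <-; rewrite row_mxKl.
  split => // x h sh; have [i [j [g [dx dj sg fg]]]] := rep x.
  have [h' sh' hh'] := smooth_fun_chart hN dj sh.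
  have E := nbhs_singleton fg.
  exists i, (fun a => 'D_(rsubmx (g a)) h' (lsubmx (g a))); split => //.
    apply: smooth_near_derive_along.
    - exact: smooth_near_comp sg (smooth_near_lsubmx _).
    - exact: smooth_near_comp sg (smooth_near_rsubmx _).
    - by rewrite -E row_mxKl.
  have n1 := near_continuous (cf x) (near_near hh').
  have n2 := near_continuous (cf x) (near_coord hN dj (smooth_near_near sh')).
  have n3 := near_continuous (cf x) (near_dom hN dj).
  have H y : (\forall z \near f y, h z = h' (coord j z)) ->
     smooth_near (coord j (f y)) h' -> dom j (f y) ->
     row_mx (coord j (f y)) (tcoord j (X y)) = g (coord i y) ->
     X y h = 'D_(rsubmx (g (coord i y))) h' (lsubmx (g (coord i y))).
    move=> y1 y2 y3 <-; rewrite row_mxKl row_mxKr.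
    exact: (tangent_chart hN (FX y) y3 y2 y1).
  near=> y; apply: H; near: y; [exact: n1|exact: n2|exact: n3|exact: fg].
- move=> [sf FX sX].
  pose F (x : M) : tangent_manifold N := exist _ (f x, X x) (FX x).
  exists F => // x.
  have su (j : chart N) : dom j (f x) -> forall k,
      smooth_fun_at x (fun y => tangent_coord j (F y) ord0 k).
    move=> dj k; rewrite -(splitK k) /tangent_coord; case: (fintype.split k) => l
      /=.
      by under eq_fun do rewrite row_mxEl; exact: smooth_at_coord.
    under eq_fun do rewrite row_mxEr mxE.
    by apply: sX; exact: smooth_fun_coord.
  have [j dj] := chart_cover hN (f x).
  split.
    apply: tangent_continuous => _ [l [B [oB ->]]] [/= dl Bx].
    have n1 := near_continuous (smooth_at_continuous (sf x)) (near_dom hN dl).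
    have cu : {for x, continuous (fun y => tangent_coord l (F y))}.
      apply: (cvg_rV (nbhs_filter x)) => k.
      exact: (smooth_fun_continuous hM (su l dl k)).
    have n2 := near_continuous cu (open_nbhs_nbhs (conj oB Bx)).
    exact: filterI n1 n2.
  have [i dx] := chart_cover hM x.
  have [g sg ug] := smooth_fun_rV hM dx (su j dj).
  by exists i, j, g.
Unshelve. all: by end_near. Qed.

Lemma smooth_section_lin M N (f : M -> N) (a : R) (X Y : M -> functional N) :
  is_manifold M -> is_manifold N ->
  smooth_section f X -> smooth_section f Y -> smooth_section f (a *: X + Y).
Proof.
move=> hM hN [sf tX sX] [_ tY sY]; split=> // [x|x h sh]; first exact: tangent_lin.
by apply: smooth_fun_add => //; [apply: smooth_fun_scale; exact: sX|exact: sY].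
Qed.

Lemma smooth_section0 M N (f : M -> N) : is_manifold M -> is_manifold N ->
  smooth f -> smooth_section f 0.
Proof.
move=> hM hN sf; split => // [x|x h _]; first exact: tangent0.
exact: smooth_fun_cst.
Qed.

Lemma smooth_section_precomp M N (L : chartedSpace R) (f : M -> N) (phi : L -> M)
    (X : M -> functional N) : is_manifold L -> is_manifold M -> is_manifold N ->
  smooth phi -> smooth_section f X -> smooth_section (f \o phi) (X \o phi).
Proof.
move=> hL hM hN sp [sf tX sX]; split => [|x|x h sh]; first exact: smooth_comp sp sf.
  exact: tX.
exact: (smooth_fun_comp_map hM (sp x) (sX _ _ sh)).
Qed.

Lemma smooth_section_push M N (P : chartedSpace R) (f : M -> N) (phi : N -> P)
    (X : M -> functional N) : is_manifold M -> is_manifold N -> is_manifold P ->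
  smooth phi -> smooth_section f X ->
  smooth_section (phi \o f) (fun x => push phi (f x) (X x)).
Proof.
move=> hM hN hP sp [sf tX sX]; split => [|x|x h sh]; first exact: smooth_comp sf sp.
  exact: (push_tangent hN hP (sp _) (tX x)).
have n1 := near_continuous (smooth_at_continuous (smooth_at_comp hM hN hP (sf x)
  (sp _)))
  (smooth_fun_near hP sh).
apply: (smooth_fun_eq (f := fun y => X y (h \o phi))).
  by apply: filterS n1 => y sy; rewrite pushE.
by apply: sX; exact: (smooth_fun_comp_map hP (sp _) sh).
Qed.

Lemma smooth_section_eq M N (f g : M -> N) (X Y : M -> functional N) :
  f =1 g -> X =1 Y -> smooth_section f X -> smooth_section g Y.
Proof. by move=> /funext <- /funext <-. Qed.

End Sections.

(** * The Lie bracket of vector fields *)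

Section Bracket.
Context {R : realType}.
Implicit Types M N : chartedSpace R.

Lemma vf_bracketE M (X Y : M -> functional M) (x : M) (h : M -> R) :
  smooth_fun_at x h ->
  vf_bracket X Y x h = X x (fun y => Y y h) - Y x (fun y => X y h).
Proof. by move=> sh; rewrite /vf_bracket asboolT. Qed.

Lemma vf_bracket_nonsmooth M (X Y : M -> functional M) (x : M) (h : M -> R) :
  ~ smooth_fun_at x h -> vf_bracket X Y x h = 0.
Proof. by move=> sh; rewrite /vf_bracket asboolF. Qed.

(* Only the double sum involves second derivatives of [g]; exchanging [X] and
   [Y] leaves it unchanged by [derive_comm], so the bracket is a tangent vector. *)
Lemma second_order_term M (X Y : M -> functional M) (x : M) (i : chart M)
    (h : M -> R) (g : 'rV[R]_(dim M) -> R^o) : is_manifold M ->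
  smooth_section id X -> smooth_section id Y -> dom i x ->
  smooth_near (coord i x) g -> (\forall y \near x, h y = g (coord i y)) ->
  X x (fun y => Y y h) =
    'D_(\row_k X x (fun y => Y y (fun z => coord i z ord0 k))) g (coord i x) +
    \sum_k \sum_l tcoord i (Y x) ord0 k * (tcoord i (X x) ord0 l *
       'D_(delta_mx 0 l) ('D_(delta_mx 0 k) g) (coord i x)).
Proof.
move=> hM [_ tX sX] [_ tY sY] dx sg hg.
pose Yk k y := Y y (fun z => coord i z ord0 k).
pose gk (k : 'I_(dim M)) y := 'D_(delta_mx 0 k) g (coord i y).
have sYk k : smooth_fun_at x (Yk k) by apply: sY; exact: smooth_fun_coord.
have sDk (k : 'I_(dim M)) : smooth_near (coord i x) ('D_(delta_mx 0 k) g).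
  exact: smooth_near_derive.
have sgk k : smooth_fun_at x (gk k).
  by apply: (smooth_fun_comp (u := coord i) hM _ (sDk k)) => j; exact:
    smooth_fun_coord.
have E : \forall y \near x, Y y h = \sum_k Yk k y * gk k y.
  have n1 := near_near hg; have n2 := near_dom hM dx.
  have n3 := near_coord hM dx (smooth_near_near sg).
  apply: filterS3 n1 n2 n3 => y y1 y2 y3.
  rewrite (tangent_chart hM (tY y) y2 y3 y1).
  rewrite (derive_rV_sum _ (smooth_near_differentiable y3)).
  by apply: eq_bigr => k _; rewrite mxE.
rewrite (tangent_eq (tX x) E) (tangent_fun_sum hM (tX x)); last first.
  by move=> k; exact: smooth_fun_mul.
rewrite (derive_rV_sum _ (smooth_near_differentiable sg)) -big_split /=.
apply: eq_bigr => k _; rewrite (tangent_fun_mul hM (tX x))//.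
rewrite addrC mxE [gk k x * _]mulrC; congr (_ + _).
have -> : X x (gk k) = 'D_(tcoord i (X x)) ('D_(delta_mx 0 k) g) (coord i x).
  by apply: (tangent_chart hM (tX x) dx (sDk k)); exact: filterE.
rewrite (derive_rV_sum _ (smooth_near_differentiable (sDk k))) mulr_sumr.
apply: eq_bigr => l _; congr (_ * _).
by rewrite /tcoord mxE.
Qed.

Lemma vf_bracket_tangent M (X Y : M -> functional M) (x : M) : is_manifold M ->
  smooth_section id X -> smooth_section id Y -> tangent_vector x (vf_bracket X Y x).
Proof.
move=> hM sX sY; have [i dx] := chart_cover hM x.
apply: (@tangentP _ _ i _ _ (\row_k X x (fun y => Y y (fun z => coord i z ord0 k)) -
   \row_k Y x (fun y => X y (fun z => coord i z ord0 k)))) => // [h|h g sg hg].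
  exact: vf_bracket_nonsmooth.
have sh : smooth_fun_at x h by exists i, g.
rewrite vf_bracketE//.
rewrite (second_order_term hM sX sY dx sg hg) (second_order_term hM sY sX dx sg hg).
have d := smooth_near_differentiable sg.
rewrite (deriveE _ d) (deriveE _ d) (deriveE _ d) linearB opprD addrACA -[RHS]addr0.
congr (_ + _); apply/eqP; rewrite subr_eq0; apply/eqP.
rewrite exchange_big /=; apply: eq_bigr => k _; apply: eq_bigr => l _.
by rewrite (derive_comm (delta_mx 0 k) (delta_mx 0 l) sg) mulrCA.
Qed.

Lemma smooth_section_bracket M (X Y : M -> functional M) : is_manifold M ->
  smooth_section id X -> smooth_section id Y -> smooth_section id (vf_bracket X Y).
Proof.
move=> hM sX sY; split; [exact: smooth_id|by move=> x; exact: vf_bracket_tangent|].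
move=> x h sh.
have [_ _ fX] := sX; have [_ _ fY] := sY.
apply: (smooth_fun_eq (f := fun y => X y (fun z => Y z h) + (-1) * Y y (fun z =>
  X z h))).
  by apply: filterS (smooth_fun_near hM sh) => y hy; rewrite vf_bracketE// mulN1r.
apply: smooth_fun_add => //; first exact: fX _ _ (fY _ _ sh).
by apply: smooth_fun_scale; exact: fY _ _ (fX _ _ sh).
Qed.

Lemma vf_bracket_anti M (X Y : M -> functional M) :
  vf_bracket X Y = - vf_bracket Y X.
Proof.
apply/funext => x; apply/funext => h.
rewrite /vf_bracket /GRing.opp /= /GRing.opp /=.
by case: asboolP => _; rewrite ?opprB ?oppr0.
Qed.

Lemma vf_bracket_alt M (X : M -> functional M) : vf_bracket X X = 0.
Proof.
apply/funext => x; apply/funext => h; rewrite /vf_bracket.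
by case: asboolP => // _; rewrite subrr.
Qed.

Lemma vf_bracket_linl M (a : R) (X Y Z : M -> functional M) : is_manifold M ->
  smooth_section id X -> smooth_section id Y -> smooth_section id Z ->
  vf_bracket (a *: X + Y) Z = a *: vf_bracket X Z + vf_bracket Y Z.
Proof.
move=> hM [_ tX sX] [_ tY sY] [_ tZ sZ].
apply/funext => x; apply/funext => h.
change (vf_bracket (a *: X + Y) Z x h = a * vf_bracket X Z x h + vf_bracket Y Z x
  h).
have [sh|nsh] := pselect (smooth_fun_at x h); last first.
  by rewrite !vf_bracket_nonsmooth// mulr0 addr0.
rewrite !vf_bracketE//.
change (a * X x (fun y => Z y h) + Y x (fun y => Z y h) -
  Z x (fun y => a * X y h + Y y h) = a * (X x (fun y => Z y h) - Z x (fun y => X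
    y h)) +
  (Y x (fun y => Z y h) - Z x (fun y => Y y h))).
have s1 := sX _ _ sh; have s2 := sY _ _ sh.
rewrite (tangent_fun_add hM (tZ x) (smooth_fun_scale a s1) s2).
rewrite (tangent_fun_scale a hM (tZ x) s1).
by rewrite opprD mulrBr addrACA.
Qed.

Lemma vf_bracket_linr M (a : R) (X Y Z : M -> functional M) : is_manifold M ->
  smooth_section id X -> smooth_section id Y -> smooth_section id Z ->
  vf_bracket Z (a *: X + Y) = a *: vf_bracket Z X + vf_bracket Z Y.
Proof.
move=> hM sX sY sZ.
rewrite vf_bracket_anti (vf_bracket_linl a hM sX sY sZ) opprD -scalerN.
by rewrite -!vf_bracket_anti.
Qed.

Lemma vf_jacobi M (X Y Z : M -> functional M) : is_manifold M ->
  smooth_section id X -> smooth_section id Y -> smooth_section id Z ->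
  vf_bracket X (vf_bracket Y Z) + vf_bracket Y (vf_bracket Z X) +
    vf_bracket Z (vf_bracket X Y) = 0.
Proof.
move=> hM sX sY sZ; apply/funext => x; apply/funext => h.
change (vf_bracket X (vf_bracket Y Z) x h + vf_bracket Y (vf_bracket Z X) x h +
    vf_bracket Z (vf_bracket X Y) x h = 0).
have [sh|nsh] := pselect (smooth_fun_at x h); last first.
  by rewrite !vf_bracket_nonsmooth// !addr0.
(* Each double bracket is a signed sum of four triple derivatives of [h]; the twelve terms of the
   cyclic sum cancel in pairs. *)
have key (U V W : M -> functional M) : smooth_section id U -> smooth_section id V ->
    smooth_section id W -> vf_bracket U (vf_bracket V W) x h =
    U x (fun y => V y (fun z => W z h)) - U x (fun y => W y (fun z => V z h)) -
    V x (fun y => W y (fun z => U z h)) + W x (fun y => V y (fun z => U z h)).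
  move=> [_ tU fU] [_ tV fV] [_ tW fW]; rewrite vf_bracketE//.
  have E : \forall y \near x, vf_bracket V W y h =
      V y (fun z => W z h) + (-1) * W y (fun z => V z h).
    by apply: filterS (smooth_fun_near hM sh) => y hy; rewrite vf_bracketE// mulN1r.
  have s1 := fV _ _ (fW _ _ sh); have s2 := fW _ _ (fV _ _ sh).
  rewrite (tangent_eq (tU x) E) (tangent_fun_add hM (tU x) s1 (smooth_fun_scale _
    s2)).
  rewrite (tangent_fun_scale _ hM (tU x) s2) vf_bracketE; last exact: fU.
  by rewrite mulN1r opprB addrA addrAC.
rewrite !key//.
move: (X x _) (X x _) (Y x _) (Y x _) (Z x _) (Z x _) => *; ring.
Qed.

(** Relatedness says [X (h \o f) = (X' h) \o f] where [h] is smooth; using it for both fields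
    carries each term of the bracket through [f]. As [h] is smooth only near [f x], the inner
    identity holds near [x], which suffices by [tangent_eq]. *)
Lemma related_bracket M N (f : M -> N) (X Y : M -> functional M)
    (X' Y' : N -> functional N) : is_manifold M -> is_manifold N -> smooth f ->
  smooth_section id X -> smooth_section id Y ->
  smooth_section id X' -> smooth_section id Y' ->
  (forall x, push f x (X x) = X' (f x)) -> (forall x, push f x (Y x) = Y' (f x)) ->
  forall x, push f x (vf_bracket X Y x) = vf_bracket X' Y' (f x).
Proof.
move=> hM hN sf [_ tX sX] [_ tY sY] [_ tX' sX'] [_ tY' sY'] XX' YY' x.
apply/funext => h.
have [sh|nsh] := pselect (smooth_fun_at (f x) h); last first.
  by rewrite push_nonsmooth// vf_bracket_nonsmooth.
rewrite pushE// vf_bracketE; last exact: (smooth_fun_comp_map hN (sf x) sh).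
rewrite vf_bracketE// -XX' -YY' !pushE; [|exact: sX'|exact: sY'].
have n1 := near_continuous (smooth_at_continuous (sf x)) (smooth_fun_near hN sh).
congr (_ - _).
- apply: tangent_eq (tX x) _; apply: filterS n1 => y sy /=.
  by rewrite -YY' pushE.
- apply: tangent_eq (tY x) _; apply: filterS n1 => y sy /=.
  by rewrite -XX' pushE.
Qed.

End Bracket.

(** * Fibre products along a submersion *)

Section OpenSubmanifold.
Context {R : realType} {n : nat}.

Lemma rat_approximation (x : 'rV[R]_n) (e : R) : 0 < e ->
  exists q : 'rV[rat]_n, `|x - map_mx (@ratr R) q| < e.
Proof.
move=> e0.
have [q qP] : exists q : 'I_n -> rat, forall k, ratr (q k) \in `]x ord0 k - e /
  2, x ord0 k + e / 2[.
  suff H k : exists r : rat, ratr r \in `]x ord0 k - e / 2, x ord0 k + e / 2[.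
    by exists (fun k => sval (cid (H k))) => k; case: cid.
  by have [|r rP] := @rat_in_itvoo R (x ord0 k - e / 2) (x ord0 k + e / 2);
    [lra|exists r].
exists (\row_k q k); apply: (@le_lt_trans _ _ (e / 2)); last by lra.
apply: rV_norm_le => [|k]; first by lra.
have := qP k; rewrite in_itv /= => /andP[q1 q2].
by rewrite !mxE ler_norml; apply/andP; split; lra.
Qed.

Variable A : set 'rV[R]_n.

(* Needed because [fibre_universal] only tests maps out of manifolds. *)
Definition open_submanifold : chartedSpace R :=
  @ChartedSpace R (set_type A) n unit (fun=> setT) (fun _ x => \val x).

Lemma submanifold_val_continuous : continuous (fun x : open_submanifold => \val x).
Proof. exact: (@initial_continuous _ _ set_val). Qed.

Lemma submanifold_second_countable : @second_countable open_submanifold.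
Proof.
pose B (p : 'rV[rat]_n * nat) : set open_submanifold :=
  [set x | ball (map_mx (@ratr R) p.1) (p.2.+1%:R^-1) (\val x)].
exists (B @` setT); first exact: sub_countable (card_image_le _ _) (countableP _).
split.
  move=> _ [p _ <-]; rewrite /B.
  exists (ball (map_mx (@ratr R) p.1) (p.2.+1%:R^-1)) => //.
  by apply: ball_open; rewrite invr_gt0.
move=> x V /near_openE[_ [[U oU <-] Ux UV]].
have /nbhs_ballP[e /= e0 eU] : nbhs (\val x) U by exact: open_nbhs_nbhs.
have [//|k] := @ltr_add_invr R 0 (e / 2) _; first by rewrite divr_gt0.
rewrite add0r => ke.
have k0 : 0 < k.+1%:R^-1 :> R by rewrite invr_gt0.
have [q xq] := rat_approximation (\val x) k0.
exists (B (q, k)).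
  by split; [exists (q, k)|rewrite /B /= -ball_normE /= distrC].
move=> y By; apply: UV; apply: eU.
rewrite -ball_normE /=; move: By; rewrite /B /= -ball_normE /= => By.
rewrite -(subrK (map_mx (@ratr R) q) (\val x)) -addrA.
apply: le_lt_trans (ler_normD _ _) _.
by apply: lt_trans (ltrD xq By) _; rewrite [ltRHS]splitr; exact: (ltrD ke ke).
Qed.

Lemma open_submanifold_manifold : open A -> is_manifold open_submanifold.
Proof.
move=> oA; split.
- rewrite open_hausdorff => x y xy.
  have vxy : \val x != \val y by apply: contra xy => /eqP/val_inj ->.
  have := @norm_hausdorff _ 'rV[R]_n; rewrite open_hausdorff.
  move=> /(_ _ _ vxy)[[U V] /= [xU yV] [oU oV UV]].
  exists (\val @^-1` U, \val @^-1` V); first by rewrite !inE in xU yV *.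
  split; [by exists U|by exists V|].
  move: UV => /eqP UV; apply/eqP; rewrite -subset0 => z [zU zV].
  by have : (U `&` V) (\val z) by []; rewrite UV.
- exact: submanifold_second_countable.
- by move=> x; exists tt.
- by move=> i; exact: openT.
- by move=> i x _; exact: submanifold_val_continuous.
- by move=> i x y _ _ /val_inj.
- move=> i _ [U oU <-] _ /=.
  suff -> : [set \val x | x in (set_val : set_type A -> _) @^-1` U] = U `&` A.
    exact: openI.
  apply/seteqP; split => [_ [x Ux <-]|x [Ux Ax]].
    by split => //; have := valP x; rewrite inE.
  by exists (exist _ x (mem_set Ax)).
- move=> i j x _ _; exists id; first exact: smooth_near_id.
  exact: filterE.
Qed.

Lemma submanifold_smooth_fun (x : open_submanifold) (f : 'rV[R]_n -> R^o) :
  smooth_near (\val x) f -> smooth_fun_at x (fun y : open_submanifold => f (\val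
    y)).
Proof. by move=> sf; exists tt, f; split => //; exact: filterE. Qed.

End OpenSubmanifold.

(** * Lifting points and curves through a submersion *)

Section Submersions.
Context {R : realType}.
Implicit Types M N B : chartedSpace R.

Lemma smooth_chart_inv M N (x : M) (j : chart N) (y0 : N) (u : M -> 'rV[R]_(dim
  N)) :
  is_manifold M -> is_manifold N -> dom j (chart_inv j y0 (u x)) ->
  (\forall x' \near x, coord j (chart_inv j y0 (u x')) = u x') ->
  (forall k, smooth_fun_at x (fun x' => u x' ord0 k)) ->
  smooth_at x (fun x' => chart_inv j y0 (u x')).
Proof.
move=> hM hN dj uK su.
have cu : {for x, continuous u}.
  apply: (cvg_rV (nbhs_filter x)) => k; exact: (smooth_fun_continuous hM (su k)).
apply: (smooth_atP hM _ dj).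
- move=> U nU; have E := nbhs_singleton uK.
  pose Q a := [/\ dom j (chart_inv j y0 a), coord j (chart_inv j y0 a) = a & U
    (chart_inv j y0 a)].
  have nQ : \forall a \near u x, Q a by rewrite -E; exact: near_chart_inv.
  by apply: filterS (near_continuous cu nQ) => x' [].
- move=> k; apply: smooth_fun_eq (su k).
  by apply: filterS uK => x' ->.
Qed.

(** [L] moves the point with coordinates [a] onto the fibre over the point with coordinates [b], and
    fixes it if it lies there already. The domain clauses keep all points in charts, where
    coordinates determine them. *)
Lemma submersion_lift N B (t : N -> B) (y0 : N) (j : chart N) (k : chart B) :
  is_manifold N -> is_manifold B -> submersion t -> dom j y0 -> dom k (t y0) ->
  exists L : 'rV[R]_(dim N + dim B) -> 'rV[R]_(dim N),
  [/\ smooth_near (row_mx (coord j y0) (coord k (t y0))) L,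
      L (row_mx (coord j y0) (coord k (t y0))) = coord j y0,
      \forall w \near row_mx (coord j y0) (coord k (t y0)),
        [/\ dom j (chart_inv j y0 (L w)), coord j (chart_inv j y0 (L w)) = L w,
            dom k (t (chart_inv j y0 (L w))) &
            coord k (t (chart_inv j y0 (L w))) = rsubmx w] &
      \forall y \near y0, L (row_mx (coord j y) (coord k (t y))) = coord j y].
Proof.
move=> hN hB [st surj] dj dk.
have [tau stau tE] := smooth_fun_rV hN dj (fun l => smooth_at_coord l hB (st y0)
  dk).
have tE0 := nbhs_singleton tE.
have [|L [sL LR LK]] := local_lifting stau.
  move=> eta; have [c [sc c0 cE _]] := curve_exists eta hB dk.
  have tc := velocity_tangent sc; rewrite c0 in tc.
  have [X tX pX] := surj _ _ tc.
  exists (tcoord j X); apply/rowP => l.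
  have d := smooth_near_differentiable stau.
  rewrite (derive_coord _ _ d) -[in RHS]cE -pX mxE pushE; last exact:
    smooth_fun_coord.
  symmetry; apply: (tangent_chart hN tX dj (smooth_near_coord l stau)).
  by apply: filterS tE => y <-.
rewrite -tE0 in sL LR.
have L0 : L (row_mx (coord j y0) (coord k (t y0))) = coord j y0.
  by rewrite tE0; exact: (nbhs_singleton LK).
exists L; split => //.
- pose Q a := [/\ dom j (chart_inv j y0 a), coord j (chart_inv j y0 a) = a &
     dom k (t (chart_inv j y0 a)) /\ coord k (t (chart_inv j y0 a)) = tau (coord
       j (chart_inv j y0 a))].
  have nQ : \forall a \near coord j y0, Q a.
    have nP : \forall y \near y0, dom k (t y) /\ coord k (t y) = tau (coord j y).
      apply: filterI tE.
      exact: (near_continuous (smooth_at_continuous (st y0)) (near_dom hB dk)).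
    exact: (near_chart_inv y0 hN dj nP).
  have nQ' : \forall w \near row_mx (coord j y0) (coord k (t y0)), Q (L w).
    by apply: (smooth_near_cvg sL); rewrite L0.
  by apply: filterS2 nQ' LR => w [q1 q2 [q3 q4]] wR; split=> //; rewrite q4 q2.
- have nL := near_coord hN dj LK.
  by apply: filterS2 nL tE => y yL ->.
Qed.

Lemma curve_coord M (i : chart M) (c : R -> M) : is_manifold M -> smooth_curve c ->
  dom i (c 0) -> smooth_near (0 : R^o) (fun r : R^o => coord i (c r)) /\
  'D_1 (fun r : R^o => coord i (c r)) 0 = tcoord i (velocity c).
Proof.
move=> hM sc di.
have s : smooth_near (0 : R^o) (fun r : R^o => coord i (c r)).
  apply: smooth_near_rV => k.
  exact: (smooth_curve_fun hM sc (smooth_fun_coord k hM di)).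
split=> //; apply/rowP => k.
rewrite (derive_coord (1 : R^o) k (smooth_near_differentiable s)) mxE velocityE//.
exact: smooth_fun_coord.
Qed.

(** A curve that lies over [b] only to first order is pushed by [L] onto the points over [b],
    without changing its velocity. *)
Lemma curve_lift N B (t : N -> B) (c : R -> N) (b : R -> B) :
  is_manifold N -> is_manifold B -> submersion t -> smooth_curve c ->
  smooth_curve b -> b 0 = t (c 0) -> velocity b = push t (c 0) (velocity c) ->
  exists c', [/\ smooth_curve c', c' 0 = c 0, velocity c' = velocity c &
    \forall r \near (0 : R), t (c' r) = b r].
Proof.
move=> hN hB ht sc sb b0 vb; have [st _] := ht.
have [j dj] := chart_cover hN (c 0); have [k dk] := chart_cover hB (t (c 0)).
have dkb : dom k (b 0) by rewrite b0.
have [L [sL L0 LR LK]] := submersion_lift hN hB ht dj dk.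
have [sj Dj] := curve_coord hN sc dj; have [sk Dk] := curve_coord hB sb dkb.
pose e (r : R^o) := L (row_mx (coord j (c r)) (coord k (b r))).
pose w (r : R^o) := row_mx (coord j (c r)) (coord k (b r)).
have sw : smooth_near (0 : R^o) w by exact: smooth_near_row_mx.
have w0 : w 0 = row_mx (coord j (c 0)) (coord k (t (c 0))) by rewrite /w b0.
have se : smooth_near (0 : R^o) e.
  by apply: (smooth_near_comp sw); rewrite w0.
have e0 : e 0 = coord j (c 0) by rewrite /e b0.
have [sc' cE] := smooth_curve_chart_inv hN dj se e0.
have c'0 : chart_inv j (c 0) (e 0) = c 0 by rewrite e0 coordK.
exists (fun r => chart_inv j (c 0) (e r)); split => //; last first.
  have nL : \forall r \near (0 : R^o), [/\ dom j (chart_inv j (c 0) (L (w r))),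
     coord j (chart_inv j (c 0) (L (w r))) = L (w r),
     dom k (t (chart_inv j (c 0) (L (w r)))) &
     coord k (t (chart_inv j (c 0) (L (w r)))) = rsubmx (w r)].
    apply: (smooth_near_cvg (P := fun w => [/\ dom j (chart_inv j (c 0) (L w)),
     coord j (chart_inv j (c 0) (L w)) = L w,
     dom k (t (chart_inv j (c 0) (L w))) &
     coord k (t (chart_inv j (c 0) (L w))) = rsubmx w]) sw).
    by rewrite w0.
  have nd : \forall r \near (0 : R), dom k (b r).
    have [cb _] := sb; exact: near_continuous cb (near_dom hB dkb).
  apply: filterS2 nL nd => r [_ _ q1 q2] q3.
  by apply: (chart_injective hB q1 q3); rewrite q2 /w row_mxKr.
have tc := velocity_tangent sc; have tc' := velocity_tangent sc'.
rewrite c'0 in tc'.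
apply: (tangent_ext hN dj tc' tc).
have dj' : dom j (chart_inv j (c 0) (e 0)) by rewrite c'0.
have [_ <-] := curve_coord hN sc' dj'.
have -> : 'D_1 (fun r : R^o => coord j (chart_inv j (c 0) (e r))) 0 = 'D_1 e 0.
  exact: near_eq_derive.
(* [e'] has [t \o c] in place of [b], so [L] returns [c] itself. Since [b] and [t \o c] have the
   same velocity, the chain rule gives [e] and [e'] the same derivative at 0. *)
pose e' (r : R^o) := L (row_mx (coord j (c r)) (coord k (t (c r)))).
have e'E : \forall r \near (0 : R^o), e' r = coord j (c r).
  by have [cc _] := sc; exact: near_continuous cc LK.
rewrite -Dj -(near_eq_derive (1 : R^o) e'E).
have stc : smooth_curve (t \o c) by exact: smooth_curve_comp (st _).
have [stk Dtk] := curve_coord hB stc dk.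
have d1 := smooth_near_differentiable sj.
have d2 := smooth_near_differentiable sk.
have d3 := smooth_near_differentiable stk.
have sw' : smooth_near (0 : R^o) (fun r : R^o => row_mx (coord j (c r)) (coord k
  (t (c r)))).
  exact: smooth_near_row_mx.
have dL := smooth_near_differentiable sL.
have dw := smooth_near_differentiable sw; have dw' := smooth_near_differentiable
  sw'.
have dLw : differentiable L (w 0) by rewrite w0.
rewrite (derive_comp (1 : R^o) dw dLw) (derive_comp (1 : R^o) dw' dL) w0.
rewrite (derive_row_mx (1 : R^o) d1 d2) (derive_row_mx (1 : R^o) d1 d3).
by rewrite Dk Dtk vb push_velocity.
Qed.

End Submersions.

(** * Functions, curves and tangent vectors on a fibre product *)

Section FibreProducts.
Context {R : realType}.

Lemma near_submanifold n (A : set 'rV[R]_n) (x0 : open_submanifold A)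
    (Q : 'rV[R]_n -> Prop) : open A ->
  (\forall x \near x0, Q (\val x)) -> \forall w \near \val x0, Q w.
Proof.
move=> oA /near_openE[_ [[U oU <-] Ux UQ]].
have Ax0 : A (\val x0) by have := valP x0; rewrite inE.
have nA := open_nbhs_nbhs (conj oA Ax0); have nU := open_nbhs_nbhs (conj oU Ux).
apply: filterS2 nA nU => w Aw Uw.
exact: (UQ (exist _ w (mem_set Aw)) Uw).
Qed.

Context {M N B P : chartedSpace R} {s : M -> B} {t : N -> B} {p1 : P -> M} {p2 :
  P -> N}.
Hypotheses (hM : is_manifold M) (hN : is_manifold N) (hB : is_manifold B)
  (hP : is_manifold P) (fp : fibre_product s t p1 p2) (ss : smooth s) (ht :
    submersion t).

Let s1 : smooth p1 := fibre_smooth1 fp.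
Let s2 : smooth p2 := fibre_smooth2 fp.

Let W (i : chart M) (j : chart N) (x : M) (y : N) : 'rV[R]_(dim M + dim N) :=
  row_mx (coord i x) (coord j y).

(* [C] is smooth because it comes from the universal property applied to the
   submanifold of pairs [(a, b)] where the point [b] of [N] is first moved by
   [submersion_lift] onto the fibre of [t] over [s a]. *)
Lemma fibre_param (z0 : P) (i : chart M) (j : chart N) :
  dom i (p1 z0) -> dom j (p2 z0) ->
  exists (C : 'rV[R]_(dim M + dim N) -> P) (q : chart P) G,
    let w0 := W i j (p1 z0) (p2 z0) in
    [/\ {for w0, continuous C}, dom q (C w0), smooth_near w0 G,
        \forall w \near w0, coord q (C w) = G w &
        \forall p \near (p1 z0, p2 z0), s p.1 = t p.2 ->
          p1 (C (W i j p.1 p.2)) = p.1 /\ p2 (C (W i j p.1 p.2)) = p.2].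
Proof.
move=> di dj; have [k dk] := chart_cover hB (t (p2 z0)).
have sq := fibre_square fp z0.
have dk' : dom k (s (p1 z0)) by rewrite sq.
have [sg ssg sE] := smooth_fun_rV hM di (fun l => smooth_at_coord l hB (ss (p1
  z0)) dk').
have sE0 := nbhs_singleton sE.
have [L [sL L0 LR LK]] := submersion_lift hN hB ht dj dk.
pose w0 := W i j (p1 z0) (p2 z0).
pose e (w : 'rV[R]_(dim M + dim N)) := row_mx (rsubmx w) (sg (lsubmx w)).
pose phi (w : 'rV[R]_(dim M + dim N)) := chart_inv i (p1 z0) (lsubmx w).
pose psi (w : 'rV[R]_(dim M + dim N)) := chart_inv j (p2 z0) (L (e w)).
have w0l : lsubmx w0 = coord i (p1 z0) by rewrite row_mxKl.
have w0r : rsubmx w0 = coord j (p2 z0) by rewrite row_mxKr.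
have e0 : e w0 = row_mx (coord j (p2 z0)) (coord k (t (p2 z0))).
  by rewrite /e w0l w0r -sE0 sq.
have se : smooth_near w0 e.
  apply: smooth_near_row_mx; first exact: smooth_near_rsubmx.
  by apply: (smooth_near_comp (smooth_near_lsubmx w0)); rewrite w0l.
pose Q1 a := [/\ dom i (chart_inv i (p1 z0) a), coord i (chart_inv i (p1 z0) a) =
  a &
  dom k (s (chart_inv i (p1 z0) a)) /\
  coord k (s (chart_inv i (p1 z0) a)) = sg (coord i (chart_inv i (p1 z0) a))].
have n1 : \forall w \near w0, Q1 (lsubmx w).
  apply: (smooth_near_cvg (smooth_near_lsubmx w0)); rewrite w0l.
  have nP : \forall x \near p1 z0, dom k (s x) /\ coord k (s x) = sg (coord i x).
    apply: filterI sE.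
    exact: (near_continuous (smooth_at_continuous (ss _)) (near_dom hB dk')).
  exact: (near_chart_inv (p1 z0) hM di nP).
pose Q2 b := [/\ dom j (chart_inv j (p2 z0) (L b)), coord j (chart_inv j (p2 z0)
  (L b)) = L b,
  dom k (t (chart_inv j (p2 z0) (L b))) & coord k (t (chart_inv j (p2 z0) (L b)))
    = rsubmx b].
have n2 : \forall w \near w0, Q2 (e w).
  by apply: (smooth_near_cvg se); rewrite e0; exact: LR.
have n3 : \forall w \near w0, smooth_near w (fun w => L (e w)).
  by apply: smooth_near_near; apply: (smooth_near_comp se); rewrite e0.
have [A [oA Aw0 AQ]] := near_openE (filterI n1 (filterI n2 n3)).
have st w : A w -> s (phi w) = t (psi w).
  move=> /AQ[[q1 q2 [q3 q4]] [[r1 r2 r3 r4] _]].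
  by apply: (chart_injective hB q3 r3); rewrite q4 r4 q2 /e row_mxKr.
pose C w := xget z0 [set z | p1 z = phi w /\ p2 z = psi w].
have CE w : A w -> p1 (C w) = phi w /\ p2 (C w) = psi w.
  move=> Aw; apply: (@xgetPex _ z0 [set z | p1 z = phi w /\ p2 z = psi w]).
  exact: fibre_pair fp _ _ (st w Aw).
pose S := open_submanifold A.
have hS : is_manifold S by exact: open_submanifold_manifold.
have AS (x : S) : A (\val x) by have := valP x; rewrite inE.
have nS (Q : 'rV[R]_(dim M + dim N) -> Prop) (x : S) :
    (forall w, A w -> Q w) -> \forall x' \near x, Q (\val x').
  by move=> AQ'; apply: filterE => x'; exact: AQ'.
have sphi : smooth (fun x : S => phi (\val x)).
  move=> x; apply: (smooth_chart_inv (u := fun x : S => lsubmx (\val x))) => //.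
  - by have [[]] := AQ _ (AS x).
  - by apply: filterE => x'; have [[]] := AQ _ (AS x').
  - move=> l; apply: (submanifold_smooth_fun (f := fun w => lsubmx w ord0 l)).
    exact: smooth_near_coord (smooth_near_lsubmx _).
have spsi : smooth (fun x : S => psi (\val x)).
  move=> x; apply: (smooth_chart_inv (u := fun x : S => L (e (\val x)))) => //.
  - by have [_ [[]]] := AQ _ (AS x).
  - by apply: filterE => x'; have [_ [[]]] := AQ _ (AS x').
  - move=> l; apply: (submanifold_smooth_fun (f := fun w => L (e w) ord0 l)).
    by apply: smooth_near_coord; have [_ []] := AQ _ (AS x).
have sC : smooth (fun x : S => C (\val x)).
  apply: (fibre_universal fp hS).
    by rewrite (_ : _ \o _ = fun x : S => phi (\val x)) //; apply/funext => x;
      have [] := CE _ (AS x).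
  by rewrite (_ : _ \o _ = fun x : S => psi (\val x)) //; apply/funext => x; have
    [] := CE _ (AS x).
pose x0 : S := exist _ w0 (mem_set Aw0).
have [cC [u0 [q [G [_ dq sG CG]]]]] := sC x0.
exists C, q, G; split => //.
- move=> V nV; apply: (near_submanifold (x0 := x0) oA).
  exact: cC.
- exact: (near_submanifold (x0 := x0) oA CG).
(* Nearness is measured in [M * N], so that this clause applies to pairs of curves before they are
   known to lift to [P]. *)
- have cW : {for (p1 z0, p2 z0), continuous (fun p : M * N => W i j p.1 p.2)}.
    apply: (cvg_rV (nbhs_filter (p1 z0, p2 z0))) => l.
    have c1 : {for (p1 z0, p2 z0), continuous (fun p : M * N => coord i p.1)}.
      by apply: continuous_comp; [exact: cvg_fst|exact: chart_continuous di].
    have c2 : {for (p1 z0, p2 z0), continuous (fun p : M * N => coord j p.2)}.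
      by apply: continuous_comp; [exact: cvg_snd|exact: chart_continuous dj].
    rewrite -(splitK l) /W; case: (fintype.split l) => m /=.
      under eq_fun do rewrite row_mxEl; rewrite row_mxEl.
      exact: (cvg_comp _ _ c1 (@coord_continuous _ _ _ ord0 m _)).
    under eq_fun do rewrite row_mxEr; rewrite row_mxEr.
    exact: (cvg_comp _ _ c2 (@coord_continuous _ _ _ ord0 m _)).
  have m1 := near_continuous cW (open_nbhs_nbhs (conj oA Aw0)).
  have m2 : \forall p \near (p1 z0, p2 z0), dom i p.1 /\ coord k (s p.1) = sg
    (coord i p.1).
    have cf : {for (p1 z0, p2 z0), continuous (@fst M N)} by exact: cvg_fst.
    have nP : \forall x \near p1 z0, dom i x /\ coord k (s x) = sg (coord i x).
      exact: filterI (near_dom hM di) sE.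
    exact: near_continuous cf nP.
  have m3 : \forall p \near (p1 z0, p2 z0), dom j p.2 /\ L (row_mx (coord j p.2)
    (coord k (t p.2))) = coord j p.2.
    have cf : {for (p1 z0, p2 z0), continuous (@snd M N)} by exact: cvg_snd.
    have nP : \forall y \near p2 z0, dom j y /\ L (row_mx (coord j y) (coord k (t
      y))) = coord j y.
      exact: filterI (near_dom hN dj) LK.
    exact: near_continuous cf nP.
  apply: filterS3 m1 m2 m3 => -[x y] /= Aw [dx sx] [dy Ly] sxty.
  have [-> ->] := CE _ Aw; rewrite /phi /psi /e /W row_mxKl row_mxKr.
  by rewrite coordK// -sx sxty Ly coordK.
Qed.

(** [C] inverts the pair of coordinates on [P] near [z0], hence [h] factors through that pair. This
    reduces the evaluation of tangent vectors of [P] to coordinates of [M] and [N]. *)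
Lemma fibre_function (z0 : P) (i : chart M) (j : chart N) (h : P -> R) :
  dom i (p1 z0) -> dom j (p2 z0) -> smooth_fun_at z0 h ->
  exists2 H : 'rV[R]_(dim M + dim N) -> R^o, smooth_near (W i j (p1 z0) (p2 z0)) H &
    \forall z \near z0, h z = H (W i j (p1 z) (p2 z)).
Proof.
move=> di dj sh; have [C [q [G [cC dq sG CG Cp]]]] := fibre_param di dj.
have c1 := smooth_at_continuous (s1 z0); have c2 := smooth_at_continuous (s2 z0).
have c12 : {for z0, continuous (fun z => (p1 z, p2 z))} by exact: cvg_pair.
have CW : \forall z \near z0, C (W i j (p1 z) (p2 z)) = z.
  have := near_continuous c12 Cp; apply: filterS => z /= Cz.
  have [] := Cz (fibre_square fp z); exact: (fibre_inj fp).
have CW0 := nbhs_singleton CW; rewrite CW0 in dq.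
have [h' sh' hh'] := smooth_fun_chart hP dq sh.
have GW0 : G (W i j (p1 z0) (p2 z0)) = coord q z0.
  by rewrite -(nbhs_singleton CG) CW0.
exists (fun w => h' (G w)); first by apply: smooth_near_comp_fun => //; rewrite GW0.
have cW : {for z0, continuous (fun z => W i j (p1 z) (p2 z))}.
  apply: (cvg_rV (nbhs_filter z0)) => l.
  rewrite -(splitK l) /W; case: (fintype.split l) => m /=.
    under eq_fun do rewrite row_mxEl; rewrite row_mxEl.
    exact: (smooth_fun_continuous hP (smooth_at_coord m hM (s1 z0) di)).
  under eq_fun do rewrite row_mxEr; rewrite row_mxEr.
  exact: (smooth_fun_continuous hP (smooth_at_coord m hN (s2 z0) dj)).
apply: filterS3 CW (near_continuous cW CG) hh' => z E1 E2 ->.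
by rewrite -E2 E1.
Qed.

Lemma fibre_curve (z0 : P) (c1 : R -> M) (c2 : R -> N) :
  smooth_curve c1 -> smooth_curve c2 -> c1 0 = p1 z0 -> c2 0 = p2 z0 ->
  (\forall r \near (0 : R), s (c1 r) = t (c2 r)) ->
  exists d, [/\ smooth_curve d, d 0 = z0 &
    \forall r \near (0 : R), p1 (d r) = c1 r /\ p2 (d r) = c2 r].
Proof.
move=> sc1 sc2 c10 c20 st.
have [i di] := chart_cover hM (p1 z0); have [j dj] := chart_cover hN (p2 z0).
have [C [q [G [cC dq sG CG Cp]]]] := fibre_param di dj.
have cc : {for 0, continuous (fun r : R => (c1 r, c2 r))}.
  by have [? _] := sc1; have [? _] := sc2; exact: cvg_pair.
have nE : \forall r \near (0 : R), p1 (C (W i j (c1 r) (c2 r))) = c1 r /\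
    p2 (C (W i j (c1 r) (c2 r))) = c2 r.
  have : \forall r \near (0 : R), s (c1 r) = t (c2 r) ->
      p1 (C (W i j (c1 r) (c2 r))) = c1 r /\ p2 (C (W i j (c1 r) (c2 r))) = c2 r.
    by apply: (near_continuous (P := fun p => s p.1 = t p.2 -> p1 (C (W i j p.1
      p.2)) = p.1 /\ p2 (C (W i j p.1 p.2)) = p.2) cc); rewrite c10 c20.
  by move=> n1; apply: filterS2 n1 st => r; apply.
have [s1' _] := curve_coord hM sc1 (eq_ind_r (fun x => dom i x) di c10).
have [s2' _] := curve_coord hN sc2 (eq_ind_r (fun x => dom j x) dj c20).
have sW : smooth_near (0 : R^o) (fun r : R^o => W i j (c1 r) (c2 r)).
  exact: smooth_near_row_mx.
have W0 : W i j (c1 0) (c2 0) = W i j (p1 z0) (p2 z0) by rewrite c10 c20.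
exists (fun r => C (W i j (c1 r) (c2 r))); split => //; last first.
  have [E1 E2] := nbhs_singleton nE.
  by apply: (fibre_inj fp); rewrite ?E1 ?E2.
apply: (@smooth_curveP _ _ _ q).
- apply: continuous_comp; first exact: smooth_near_continuous sW.
  by rewrite W0.
- by rewrite W0.
- move=> l; apply: (@smooth_near_eq _ _ _ _ (fun r : R^o => G (W i j (c1 r) (c2
  r)) ord0 l : R^o)).
    have : \forall r \near (0 : R^o), coord q (C (W i j (c1 r) (c2 r))) = G (W i
      j (c1 r) (c2 r)).
      by apply: (smooth_near_cvg (P := fun w => coord q (C w) = G w) sW); rewrite
        W0.
    by apply: filterS => r ->.
  apply: smooth_near_coord; apply: (smooth_near_comp sW).
  by rewrite W0.
Qed.

(** Curves representing [X] and [Y] have [s \o c1] and [t \o c2] equal only to first order;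
    [curve_lift] replaces [c2] by a curve of the same velocity for which they agree near 0. *)
Lemma fibre_tangent_exists (z0 : P) (X : functional M) (Y : functional N) :
  tangent_vector (p1 z0) X -> tangent_vector (p2 z0) Y ->
  push s (p1 z0) X = push t (p2 z0) Y ->
  exists xi, [/\ tangent_vector z0 xi, push p1 z0 xi = X & push p2 z0 xi = Y].
Proof.
move=> [c1 [sc1 c10 ->]] [c2 [sc2 c20 ->]] E; have [st _] := ht.
have [|||c2' [sc2' c20' vc2' tc2']] := @curve_lift R N B t c2 (s \o c1) hN hB ht
  sc2.
- exact: smooth_curve_comp (ss _).
- by rewrite /= c10 c20 (fibre_square fp).
- by rewrite -push_velocity// c10 E c20.
rewrite c20 in c20'.
have tc2E : \forall r \near (0 : R), s (c1 r) = t (c2' r) by apply: filterS tc2'.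
have [d [sd d0 dE]] := fibre_curve sc1 sc2' c10 c20' tc2E.
exists (velocity d); split.
- by rewrite -d0; exact: velocity_tangent.
- rewrite -[z0 in push _ z0]d0 push_velocity//.
  by apply: velocity_eq; apply: filterS dE => r [].
- rewrite -[z0 in push _ z0]d0 push_velocity// -vc2'.
  by apply: velocity_eq; apply: filterS dE => r [].
Qed.

Lemma fibre_tangent_formula (z0 : P) (i : chart M) (j : chart N) (h : P -> R)
    (H : 'rV[R]_(dim M + dim N) -> R^o) (xi : functional P) :
  tangent_vector z0 xi -> dom i (p1 z0) -> dom j (p2 z0) ->
  smooth_near (W i j (p1 z0) (p2 z0)) H ->
  (\forall z \near z0, h z = H (W i j (p1 z) (p2 z))) ->
  xi h = 'D_(row_mx (tcoord i (push p1 z0 xi)) (tcoord j (push p2 z0 xi)))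
    H (W i j (p1 z0) (p2 z0)).
Proof.
move=> txi di dj sH hH; rewrite (tangent_eq txi hH).
rewrite (tangent_comp (u := fun z => W i j (p1 z) (p2 z)) hP txi _ sH).
  congr ('D__ H _); apply/rowP => l; rewrite mxE.
  rewrite -(splitK l) /W; case: (fintype.split l) => m /=.
    under eq_fun do rewrite row_mxEl; rewrite row_mxEl mxE pushE//.
    exact: smooth_fun_coord.
  under eq_fun do rewrite row_mxEr; rewrite row_mxEr mxE pushE//.
  exact: smooth_fun_coord.
move=> l; rewrite -(splitK l) /W; case: (fintype.split l) => m /=.
  by under eq_fun do rewrite row_mxEl; exact: (smooth_at_coord m hM (s1 z0) di).
by under eq_fun do rewrite row_mxEr; exact: (smooth_at_coord m hN (s2 z0) dj).
Qed.

Lemma fibre_tangent_unique (z0 : P) (xi eta : functional P) :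
  tangent_vector z0 xi -> tangent_vector z0 eta ->
  push p1 z0 xi = push p1 z0 eta -> push p2 z0 xi = push p2 z0 eta -> xi = eta.
Proof.
move=> txi teta E1 E2; apply/funext => h.
have [sh|nsh] := pselect (smooth_fun_at z0 h); last first.
  by rewrite (tangent_nonsmooth txi)// (tangent_nonsmooth teta).
have [i di] := chart_cover hM (p1 z0); have [j dj] := chart_cover hN (p2 z0).
have [H sH hH] := fibre_function di dj sh.
rewrite (fibre_tangent_formula txi di dj sH hH).
by rewrite (fibre_tangent_formula teta di dj sH hH) E1 E2.
Qed.

(** By [fibre_tangent_formula], [Xi l h] is a directional derivative of [H], with base point and
    direction given by the two projections and the two pushed fields; these depend smoothly on
    [l]. *)
Lemma fibre_section (L : chartedSpace R) (phi : L -> P) (Xi : L -> functional P) :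
  is_manifold L -> smooth phi -> (forall l, tangent_vector (phi l) (Xi l)) ->
  smooth_section (p1 \o phi) (fun l => push p1 (phi l) (Xi l)) ->
  smooth_section (p2 \o phi) (fun l => push p2 (phi l) (Xi l)) ->
  smooth_section phi Xi.
Proof.
move=> hL sphi tXi [_ _ f1] [_ _ f2]; split => // l0 h sh.
have [i di] := chart_cover hM (p1 (phi l0)); have [j dj] := chart_cover hN (p2
  (phi l0)).
have [H sH hH] := fibre_function di dj sh.
have cphi := smooth_at_continuous (sphi l0).
have c1 := smooth_at_continuous (s1 (phi l0)); have c2 := smooth_at_continuous
  (s2 (phi l0)).
have s1phi : smooth_at l0 (p1 \o phi) by exact: smooth_at_comp.
have s2phi : smooth_at l0 (p2 \o phi) by exact: smooth_at_comp.
pose u l := row_mx (W i j (p1 (phi l)) (p2 (phi l)))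
  (row_mx (tcoord i (push p1 (phi l) (Xi l))) (tcoord j (push p2 (phi l) (Xi l)))).
pose K (w : 'rV[R]_((dim M + dim N) + (dim M + dim N))) : R^o :=
  'D_(rsubmx w) H (lsubmx w).
have su k : smooth_fun_at l0 (fun l => u l ord0 k).
  rewrite -(splitK k) /u; case: (fintype.split k) => m /=.
    under eq_fun do rewrite row_mxEl.
    rewrite -(splitK m) /W; case: (fintype.split m) => a /=.
      by under eq_fun do rewrite row_mxEl; exact: smooth_at_coord a hM s1phi di.
    by under eq_fun do rewrite row_mxEr; exact: smooth_at_coord a hN s2phi dj.
  under eq_fun do rewrite row_mxEr.
  rewrite -(splitK m); case: (fintype.split m) => a /=.
    by under eq_fun do rewrite row_mxEl mxE; apply: f1; exact: smooth_fun_coord.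
  by under eq_fun do rewrite row_mxEr mxE; apply: f2; exact: smooth_fun_coord.
apply: (smooth_fun_eq (f := fun l => K (u l))); last first.
  apply: smooth_fun_comp => //; apply: smooth_near_derive_along.
  - exact: smooth_near_lsubmx.
  - exact: smooth_near_rsubmx.
  - by rewrite /u row_mxKl.
have n1 := near_continuous cphi (near_near hH).
have cu : {for l0, continuous (fun l => W i j (p1 (phi l)) (p2 (phi l)))}.
  apply: (cvg_rV (nbhs_filter l0)) => k.
  have := smooth_fun_continuous hL (su (lshift _ k)); rewrite /prop_for
    /continuous_at.
  by rewrite /u row_mxEl; under eq_fun do rewrite row_mxEl.
have n2 := near_continuous cu (smooth_near_near sH).
have n3 := near_continuous (smooth_at_continuous s1phi) (near_dom hM di).
have n4 := near_continuous (smooth_at_continuous s2phi) (near_dom hN dj).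
apply: filterS2 (filterI n1 n2) (filterI n3 n4) => l [a1 a2] [a3 a4].
by rewrite (fibre_tangent_formula (tXi l) a3 a4 a2 a1) /K /u row_mxKl row_mxKr.
Qed.

End FibreProducts.

(** * The tangent groupoid *)

Section TangentMultiplication.
Context {R : realType} {G : lieGroupoid R}.

Local Notation src := (@lgsrc R G).
Local Notation tgt := (@lgtgt R G).
Local Notation one := (@lgunit R G).
Local Notation mul2 := (fun z : G2 G => lgmul (pr1 z) (pr2 z)).
Local Notation h0 := (G0_manifold G).
Local Notation h1 := (G1_manifold G).
Local Notation h2 := (G2_manifold G).
Local Notation fp := (G2_fibre_product G).

Definition tmul (g h : G1 G) (X Y : functional (G1 G)) : functional (G1 G) :=
  (Tmul (g, X) (h, Y)).2.

Lemma src_smooth : smooth src. Proof. by case: (lgsrc_submersion G). Qed.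
Lemma tgt_smooth : smooth tgt. Proof. by case: (lgtgt_submersion G). Qed.

Lemma src_one (x : G0 G) : src (one x) = x.
Proof. exact: (gsrc_unit (G_groupoid G) x). Qed.
Lemma tgt_one (x : G0 G) : tgt (one x) = x.
Proof. exact: (gtgt_unit (G_groupoid G) x). Qed.
Lemma src_mul (g h : G1 G) : src g = tgt h -> src (lgmul g h) = src h.
Proof. exact: (@gsrc_mul _ (G_groupoid G) g h). Qed.
Lemma tgt_mul (g h : G1 G) : src g = tgt h -> tgt (lgmul g h) = tgt g.
Proof. exact: (@gtgt_mul _ (G_groupoid G) g h). Qed.
Lemma lgmulA (g h k : G1 G) : src g = tgt h -> src h = tgt k ->
  lgmul g (lgmul h k) = lgmul (lgmul g h) k.
Proof. exact: (@gmulA _ (G_groupoid G) g h k). Qed.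
Lemma mul1 (g : G1 G) : lgmul (one (tgt g)) g = g.
Proof. exact: (@gmul1l _ (G_groupoid G) g). Qed.
Lemma mulg1 (g : G1 G) : lgmul g (one (src g)) = g.
Proof. exact: (@gmul1r _ (G_groupoid G) g). Qed.
Lemma mul11 (x : G0 G) : lgmul (one x) (one x) = one x.
Proof. by rewrite -{1}(tgt_one x) mul1. Qed.
(* Well-definedness of the [xget] in [Tmul]: a tangent vector of [G2] is
   determined by its two projections. *)
Lemma tmul_push (z : G2 G) (xi : functional (G2 G)) : tangent_vector z xi ->
  tmul (pr1 z) (pr2 z) (push (@pr1 R G) z xi) (push (@pr2 R G) z xi) = push mul2
    z xi.
Proof.
move=> txi; rewrite /tmul /Tmul /=.
set S := (X in xget 0 X).
have [[z' xi'] /= txi' [E1 E2 E3]] : S (xget 0 S).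
  by apply: xgetPex; exists (push mul2 z xi); exists (z, xi).
have [e1 f1] : pr1 z' = pr1 z /\ push (@pr1 R G) z' xi' = push (@pr1 R G) z xi by
  case: E1.
have [e2 f2] : pr2 z' = pr2 z /\ push (@pr2 R G) z' xi' = push (@pr2 R G) z xi by
  case: E2.
have e : z' = z by exact: (fibre_inj fp e1 e2).
subst z'; have -> : xi = xi'.
  exact: (fibre_tangent_unique h1 h1 h0 h2 fp src_smooth (lgtgt_submersion G) txi
    txi' (esym f1) (esym f2)).
by case: E3.
Qed.

Definition composable_tangent (g h : G1 G) (X Y : functional (G1 G)) : Prop :=
  [/\ src g = tgt h, tangent_vector g X, tangent_vector h Y &
      push src g X = push tgt h Y].

Lemma composable_lift (g h : G1 G) (X Y : functional (G1 G)) :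
  composable_tangent g h X Y ->
  exists z xi, [/\ pr1 z = g, pr2 z = h, tangent_vector z xi,
    push (@pr1 R G) z xi = X & push (@pr2 R G) z xi = Y].
Proof.
move=> [gh tX tY E]; have [z [z1 z2]] := fibre_pair fp gh; subst g h.
have [xi [txi x1 x2]] := fibre_tangent_exists h1 h1 h0 fp src_smooth
  (lgtgt_submersion G) tX tY E.
by exists z, xi.
Qed.

Lemma tmul_src g h X Y : composable_tangent g h X Y ->
  push src (lgmul g h) (tmul g h X Y) = push src h Y.
Proof.
move=> /composable_lift[z [xi [<- <- txi <- <-]]]; rewrite tmul_push//.
rewrite (push_comp (f := mul2) xi h0 (src_smooth _)) (push_comp xi h0 (src_smooth
  _)).
by congr (push _ z xi); apply/funext => y /=; rewrite src_mul//; exact: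
  fibre_square fp y.
Qed.

Lemma tmul_tgt g h X Y : composable_tangent g h X Y ->
  push tgt (lgmul g h) (tmul g h X Y) = push tgt g X.
Proof.
move=> /composable_lift[z [xi [<- <- txi <- <-]]]; rewrite tmul_push//.
rewrite (push_comp (f := mul2) xi h0 (tgt_smooth _)) (push_comp xi h0 (tgt_smooth
  _)).
by congr (push _ z xi); apply/funext => y /=; rewrite tgt_mul//; exact:
  fibre_square fp y.
Qed.

(** Both pairs lift to tangent vectors at the same point of [G2], since a point of [G2] is
    determined by its projections; there [tmul] is the derivative of the multiplication. *)
Lemma tmul_lin g h a X Y X' Y' : composable_tangent g h X Y ->
  composable_tangent g h X' Y' ->
  tmul g h (a *: X + X') (a *: Y + Y') = a *: tmul g h X Y + tmul g h X' Y'.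
Proof.
move=> /composable_lift[z [xi [z1 z2 txi x1 x2]]] /composable_lift[z' [xi' [z1'
  z2' txi' x1' x2']]].
have e : z' = z by apply: (fibre_inj fp); rewrite ?z1 ?z2.
subst z' g h X Y X' Y'; rewrite -!push_lin !tmul_push//.
  by rewrite push_lin.
exact: (tangent_lin a h2 txi txi').
Qed.

Lemma composable_tangent0 g h : src g = tgt h -> composable_tangent g h 0 0.
Proof.
move=> gh; split => //; [exact: tangent0 h1|exact: tangent0 h1|].
by rewrite !push0.
Qed.

Lemma tmul0 g h : src g = tgt h -> tmul g h 0 0 = 0.
Proof.
move=> gh; have c := composable_tangent0 gh.
have := tmul_lin 1 c c; rewrite !scale1r !addr0 => E.
by apply: (addrI (tmul g h 0 0)); rewrite -E addr0.
Qed.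

(** Reduces identities in [TG] to identities in [G] along composable curves. *)
Lemma tmul_curve (c d : R -> G1 G) : smooth_curve c -> smooth_curve d ->
  (\forall r \near (0 : R), src (c r) = tgt (d r)) ->
  smooth_curve (fun r => lgmul (c r) (d r)) /\
  tmul (c 0) (d 0) (velocity c) (velocity d) = velocity (fun r => lgmul (c r) (d
    r)).
Proof.
move=> sc sd cd; have [z [z1 z2]] := fibre_pair fp (nbhs_singleton cd).
have [e [se e0 eE]] := fibre_curve h1 h1 h0 fp src_smooth (lgtgt_submersion G)
  sc sd (esym z1) (esym z2) cd.
have e1 : velocity (@pr1 R G \o e) = velocity c.
  by apply: velocity_eq; apply: filterS eE => r [].
have e2 : velocity (@pr2 R G \o e) = velocity d.
  by apply: velocity_eq; apply: filterS eE => r [].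
have eM : \forall r \near (0 : R), (mul2 \o e) r = lgmul (c r) (d r).
  by apply: filterS eE => r /= [-> ->].
have sm : smooth_at (e 0) mul2 by exact: (@lgmul_smooth R G).
split; first exact: (smooth_curve_eq eM (smooth_curve_comp h2 h1 se sm)).
have te := velocity_tangent se.
rewrite -z1 -z2 -e0 -e1 -e2 -(velocity_eq eM).
rewrite -(push_velocity h1 (fibre_smooth1 fp _)) -(push_velocity h1
  (fibre_smooth2 fp _)).
by rewrite -(push_velocity h1 sm) tmul_push.
Qed.

Lemma tangent_curve_tgt (h : G1 G) (Y : functional (G1 G)) (b : R -> G0 G) :
  tangent_vector h Y -> smooth_curve b -> b 0 = tgt h -> velocity b = push tgt h
    Y ->
  exists d, [/\ smooth_curve d, d 0 = h, velocity d = Y &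
    \forall r \near (0 : R), tgt (d r) = b r].
Proof.
move=> [c [sc c0 ->]] sb b0 vb; rewrite -c0 in b0 vb *.
exact: (curve_lift h1 h0 (lgtgt_submersion G) sc sb b0 vb).
Qed.

(** [X] is represented by any curve [c]; [curve_lift] then provides a curve for [Y] composable with
    [c], and one for [Z] composable with that of [Y], so that associativity in [G] holds at each
    time near 0. *)
Lemma tmulA g h k X Y Z : composable_tangent g h X Y -> composable_tangent h k Y
  Z ->
  tmul g (lgmul h k) X (tmul h k Y Z) = tmul (lgmul g h) k (tmul g h X Y) Z.
Proof.
move=> [gh [c [sc c0 ->]] tY E1] [hk _ tZ E2]; subst g.
have [|||d [sd d0 dY cd]] := @tangent_curve_tgt h Y (src \o c) tY.
- exact: smooth_curve_comp h1 h0 sc (src_smooth _).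
- by rewrite /= gh.
- by rewrite -(push_velocity h0 (src_smooth _)).
subst h Y.
have [|||e [se e0 eZ de]] := @tangent_curve_tgt k Z (src \o d) tZ.
- exact: smooth_curve_comp h1 h0 sd (src_smooth _).
- by rewrite /= hk.
- by rewrite -(push_velocity h0 (src_smooth _)).
subst k Z.
have cd' : \forall r \near (0 : R), src (c r) = tgt (d r) by apply: filterS cd =>
  r ->.
have de' : \forall r \near (0 : R), src (d r) = tgt (e r) by apply: filterS de =>
  r ->.
have [scd ->] := tmul_curve sc sd cd'; have [sde ->] := tmul_curve sd se de'.
have cde : \forall r \near (0 : R), src (c r) = tgt (lgmul (d r) (e r)).
  by apply: filterS2 cd' de' => r E1' /tgt_mul ->.
have cde' : \forall r \near (0 : R), src (lgmul (c r) (d r)) = tgt (e r).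
  by apply: filterS2 cd' de' => r /src_mul ->.
have [_ ->] := tmul_curve sc sde cde; have [_ ->] := tmul_curve scd se cde'.
by apply: velocity_eq; apply: filterS2 cd' de' => r ? ?; rewrite lgmulA.
Qed.

Lemma tmul1l g X : tangent_vector g X ->
  tmul (one (tgt g)) g (push one (tgt g) (push tgt g X)) X = X.
Proof.
move=> [c [sc c0 ->]]; subst g.
have st : smooth_curve (tgt \o c) by exact: smooth_curve_comp h1 h0 sc
  (tgt_smooth _).
have so : smooth_curve (one \o (tgt \o c)).
  exact: (smooth_curve_comp h0 h1 st (@lgunit_smooth R G _)).
rewrite (push_velocity h0 (tgt_smooth _)).
rewrite (push_velocity (c := tgt \o c) h1 (@lgunit_smooth R G _)).
have [|_ ->] := @tmul_curve (one \o (tgt \o c)) c so sc.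
  by apply: filterE => r /=; rewrite src_one.
by congr velocity; apply/funext => r /=; rewrite mul1.
Qed.

Lemma tmul1r g X : tangent_vector g X ->
  tmul g (one (src g)) X (push one (src g) (push src g X)) = X.
Proof.
move=> [c [sc c0 ->]]; subst g.
have st : smooth_curve (src \o c) by exact: smooth_curve_comp h1 h0 sc
  (src_smooth _).
have so : smooth_curve (one \o (src \o c)).
  exact: (smooth_curve_comp h0 h1 st (@lgunit_smooth R G _)).
rewrite (push_velocity h0 (src_smooth _)).
rewrite (push_velocity (c := src \o c) h1 (@lgunit_smooth R G _)).
have [|_ ->] := @tmul_curve c (one \o (src \o c)) sc so.
  by apply: filterE => r /=; rewrite tgt_one.
by congr velocity; apply/funext => r /=; rewrite mulg1.
Qed.

Lemma velocity_cst (x : G1 G) : velocity (fun _ : R => x) = 0.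
Proof.
apply/funext => h; rewrite /velocity; case: ifP => // _.
by rewrite derive1E; exact: derive_cst.
Qed.

Lemma right_translateE g X : tangent_vector (one (tgt g)) X ->
  push src (one (tgt g)) X = 0 -> right_translate g X = tmul (one (tgt g)) g X 0.
Proof.
move=> tX sX; rewrite /right_translate.
set S := (Y in xget 0 Y).
suff [c [sc c0 cs XE ->]] : S (xget 0 S).
  have [|_ <-] := @tmul_curve c (fun=> g) sc (smooth_curve_cst g h1).
    exact: cs.
  by rewrite c0 -XE velocity_cst.
apply: xgetPex; have [c [sc c0 XE]] := tX.
have [|||c' [sc' c0' vc' cs']] := @curve_lift R _ _ src c (fun=> tgt g) h1 h0
  (lgsrc_submersion G) sc.
- exact: smooth_curve_cst h0.
- by rewrite c0 src_one.
- rewrite c0 -XE sX; apply/funext => h; rewrite /velocity; case: ifP => // _.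
  by rewrite derive1E; exact: derive_cst.
exists (velocity (fun r => lgmul (c' r) g)); exists c'; split => //.
- by rewrite c0'.
- by rewrite vc'.
Qed.

(** The pair [(X, Y)] is a smooth section over [G2] by [fibre_section], and its product is the push
    by the multiplication. *)
Lemma smooth_tmul (L : chartedSpace R) (a b : L -> G1 G) (X Y : L -> functional
  (G1 G)) :
  is_manifold L -> smooth_section a X -> smooth_section b Y ->
  (forall l, src (a l) = tgt (b l)) ->
  (forall l, push src (a l) (X l) = push tgt (b l) (Y l)) ->
  smooth_section (fun l => lgmul (a l) (b l)) (fun l => tmul (a l) (b l) (X l) (Y
    l)).
Proof.
move=> hL sX sY ab XY; have [sa tX fX] := sX; have [sb tY fY] := sY.
have [phi phiE] : exists phi : L -> G2 G, forall l, pr1 (phi l) = a l /\ pr2 (phi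
  l) = b l.
  exists (fun l => sval (cid (fibre_pair fp (ab l)))) => l.
  by case: cid.
have p1 : @pr1 R G \o phi = a by apply/funext => l; have [] := phiE l.
have p2 : @pr2 R G \o phi = b by apply/funext => l; have [] := phiE l.
have sphi : smooth phi by apply: (fibre_universal fp hL); rewrite ?p1 ?p2.
have [Xi XiE] : exists Xi : L -> functional (G2 G), forall l,
    [/\ tangent_vector (phi l) (Xi l), push (@pr1 R G) (phi l) (Xi l) = X l &
        push (@pr2 R G) (phi l) (Xi l) = Y l].
  suff H l : exists xi, [/\ tangent_vector (phi l) xi, push (@pr1 R G) (phi l) xi
    = X l &
        push (@pr2 R G) (phi l) xi = Y l].
    by exists (fun l => sval (cid (H l))) => l; case: cid.
  have [e1 e2] := phiE l.
  by apply: (fibre_tangent_exists h1 h1 h0 fp src_smooth (lgtgt_submersion G));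
    rewrite ?e1 ?e2.
have sXi : smooth_section phi Xi.
  apply: (fibre_section h1 h1 h0 h2 fp src_smooth (lgtgt_submersion G) hL sphi).
  - by move=> l; have [] := XiE l.
  - apply: smooth_section_eq sX => l; first by rewrite p1.
    by have [] := XiE l.
  - apply: smooth_section_eq sY => l; first by rewrite p2.
    by have [] := XiE l.
apply: smooth_section_eq (smooth_section_push hL h2 h1 (@lgmul_smooth R G) sXi)
  => l.
  by have [<- <-] := phiE l.
have [txi <- <-] := XiE l; have [<- <-] := phiE l.
by rewrite tmul_push.
Qed.

End TangentMultiplication.

(** * Multiplicative vector fields and their morphisms *)

Section MultiplicativeFields.
Context {R : realType} {G : lieGroupoid R}.

Local Notation ls := (@lgsrc R G).
Local Notation lt := (@lgtgt R G).
Local Notation one := (@lgunit R G).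
Local Notation h0 := (G0_manifold G).
Local Notation h1 := (G1_manifold G).
Local Notation h2 := (G2_manifold G).
Local Notation fp := (G2_fibre_product G).
Local Notation mul2 := (fun z : G2 G => lgmul (pr1 z) (pr2 z)).
Implicit Types A B C H : G1 G -> functional (G1 G).

Lemma section_id (M : chartedSpace R) (X : M -> functional M) : is_manifold M ->
  vector_field X <-> smooth_section id X.
Proof. by move=> hM; exact: section_alongP. Qed.

Definition src_related A (v0 : G0 G -> functional (G0 G)) : Prop := forall g,
  push ls g (A g) = v0 (ls g).
Definition tgt_related A (v0 : G0 G -> functional (G0 G)) : Prop := forall g,
  push lt g (A g) = v0 (lt g).

(* The relation [A(g) B(h) = C(gh)] in [TG]; equivalently the field [(A, B)] on
   [G2] is related to [C] by the multiplication. *)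
Definition mul_related A B C : Prop := forall g h, ls g = lt h ->
  C (lgmul g h) = tmul g h (A g) (B h).

Lemma composable_fields A B v0 g h : smooth_section id A -> smooth_section id B ->
  src_related A v0 -> tgt_related B v0 -> ls g = lt h ->
  composable_tangent g h (A g) (B h).
Proof. by move=> [_ tA _] [_ tB _] sA tB' gh; split => //; rewrite sA tB' gh. Qed.

Lemma src_related_lin a A v0 A' v0' : src_related A v0 -> src_related A' v0' ->
  src_related (a *: A + A') (a *: v0 + v0').
Proof. by move=> sA sA' g; rewrite [LHS]push_lin sA sA'. Qed.

Lemma tgt_related_lin a A v0 A' v0' : tgt_related A v0 -> tgt_related A' v0' ->
  tgt_related (a *: A + A') (a *: v0 + v0').
Proof. by move=> sA sA' g; rewrite [LHS]push_lin sA sA'. Qed.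

Lemma mul_related_lin a A B C v0 A' B' C' v0' :
  smooth_section id A -> smooth_section id B ->
  smooth_section id A' -> smooth_section id B' ->
  src_related A v0 -> tgt_related B v0 ->
  src_related A' v0' -> tgt_related B' v0' ->
  mul_related A B C -> mul_related A' B' C' ->
  mul_related (a *: A + A') (a *: B + B') (a *: C + C').
Proof.
move=> sA sB sA' sB' rA rB rA' rB' m m' g h gh.
have c := composable_fields sA sB rA rB gh.
have c' := composable_fields sA' sB' rA' rB' gh.
by rewrite [RHS](tmul_lin a c c') -m// -m'.
Qed.

Lemma src_related_bracket A v0 A' v0' :
  smooth_section id A -> smooth_section id A' ->
  smooth_section id v0 -> smooth_section id v0' ->
  src_related A v0 -> src_related A' v0' ->
  src_related (vf_bracket A A') (vf_bracket v0 v0').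
Proof.
move=> sA sA' sv sv' r r'.
exact: (related_bracket h1 h0 src_smooth sA sA' sv sv' r r').
Qed.

Lemma tgt_related_bracket A v0 A' v0' :
  smooth_section id A -> smooth_section id A' ->
  smooth_section id v0 -> smooth_section id v0' ->
  tgt_related A v0 -> tgt_related A' v0' ->
  tgt_related (vf_bracket A A') (vf_bracket v0 v0').
Proof.
move=> sA sA' sv sv' r r'.
exact: (related_bracket h1 h0 tgt_smooth sA sA' sv sv' r r').
Qed.

Lemma pair_field A B C v0 : smooth_section id A -> smooth_section id B ->
  src_related A v0 -> tgt_related B v0 -> mul_related A B C ->
  exists D : G2 G -> functional (G2 G), [/\ smooth_section id D,
    forall z, push (@pr1 R G) z (D z) = A (pr1 z),
    forall z, push (@pr2 R G) z (D z) = B (pr2 z) &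
    forall z, push mul2 z (D z) = C (lgmul (pr1 z) (pr2 z))].
Proof.
move=> sA sB rA rB m.
have [D DE] : exists D : G2 G -> functional (G2 G), forall z,
    [/\ tangent_vector z (D z), push (@pr1 R G) z (D z) = A (pr1 z) &
        push (@pr2 R G) z (D z) = B (pr2 z)].
  suff H z : exists xi, [/\ tangent_vector z xi, push (@pr1 R G) z xi = A (pr1 z) &
        push (@pr2 R G) z xi = B (pr2 z)].
    by exists (fun z => sval (cid (H z))) => z; case: cid.
  have [_ tA tB E] := composable_fields sA sB rA rB (fibre_square fp z).
  exact: (fibre_tangent_exists h1 h1 h0 fp src_smooth (lgtgt_submersion G) tA tB E).
exists D; split; [|by move=> z; have [] := DE z|by move=> z; have [] := DE z|].
  apply: (fibre_section h1 h1 h0 h2 fp src_smooth (lgtgt_submersion G) h2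
    (smooth_id h2)).
  - by move=> z; have [] := DE z.
  - apply: smooth_section_eq (smooth_section_precomp h2 h1 h1 (fibre_smooth1 fp)
    sA) => z //=.
    by have [] := DE z.
  - apply: smooth_section_eq (smooth_section_precomp h2 h1 h1 (fibre_smooth2 fp)
    sB) => z //=.
    by have [] := DE z.
move=> z; have [tD D1 D2] := DE z.
by rewrite m ?(fibre_square fp)// -D1 -D2 tmul_push.
Qed.

Lemma mul_related_bracket A B C v0 A' B' C' v0' :
  smooth_section id A -> smooth_section id B -> smooth_section id C ->
  smooth_section id A' -> smooth_section id B' -> smooth_section id C' ->
  src_related A v0 -> tgt_related B v0 ->
  src_related A' v0' -> tgt_related B' v0' ->
  mul_related A B C -> mul_related A' B' C' ->
  mul_related (vf_bracket A A') (vf_bracket B B') (vf_bracket C C').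
Proof.
move=> sA sB sC sA' sB' sC' rA rB rA' rB' m m' g h gh.
have [D [sD D1 D2 Dm]] := pair_field sA sB rA rB m.
have [D' [sD' D1' D2' Dm']] := pair_field sA' sB' rA' rB' m'.
have [z [<- <-]] := fibre_pair fp gh.
rewrite -(related_bracket h2 h1 (@lgmul_smooth R G) sD sD' sC sC' Dm Dm' z).
rewrite -(related_bracket h2 h1 (fibre_smooth1 fp) sD sD' sA sA' D1 D1' z).
rewrite -(related_bracket h2 h1 (fibre_smooth2 fp) sD sD' sB sB' D2 D2' z).
by rewrite (tmul_push (vf_bracket_tangent z h2 sD sD')).
Qed.

Definition mult_field (v : obj G) : Prop :=
  [/\ smooth_section id v.1, smooth_section id v.2,
      src_related v.2 v.1 /\ tgt_related v.2 v.1,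
      forall x, push one x (v.1 x) = v.2 (one x) & mul_related v.2 v.2 v.2].

Lemma X0P (v : obj G) : X0 v <-> mult_field v.
Proof.
split.
- move=> [/(section_id _ h0) s0 /(section_id _ h1) s1 [f1 f2 f3 f4]]; split => //.
  + by split=> g; [have [] := f1 g|have [] := f2 g].
  + by move=> x; have [] := f3 x.
  + move=> g h gh; have := f4 g h gh; rewrite /= /obj1 /Tmul /= => E.
    by have := congr1 snd E.
- move=> [/(section_id _ h0) s0 /(section_id _ h1) s1 [f1 f2] f3 f4]; split => //.
  split=> [g|g|x|g h gh] /=; rewrite /obj0 /obj1 /Tmap /=.
  + by rewrite f1.
  + by rewrite f2.
  + by rewrite f3.
  + by rewrite f4.
Qed.

Definition field_morphism (v : obj G) (al : G0 G -> functional (G1 G)) (w : obj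
  G) : Prop :=
  [/\ smooth_section one al, forall x, push ls (one x) (al x) = v.1 x,
      forall x, push lt (one x) (al x) = w.1 x &
      forall g, tmul (one (lt g)) g (al (lt g)) (v.2 g) =
                tmul g (one (ls g)) (w.2 g) (al (ls g))].

Lemma X1P (al : mor G) :
  X1 al <-> [/\ mult_field (src al), mult_field (tgt al) &
               field_morphism (src al) (sec al) (tgt al)].
Proof.
split.
- move=> [/X0P mv /X0P mw /(section_alongP _ _ h0 h1) sa [n1 n2 n3]]; split => //.
  split => // [x|x|g].
  + by have := n1 x; rewrite /= /sec1 /obj0 /Tmap /= src_one; case.
  + by have := n2 x; rewrite /= /sec1 /obj0 /Tmap /= tgt_one; case.
  + by have := congr1 snd (n3 g).
- move=> [/X0P mv /X0P mw [/(section_alongP _ _ h0 h1) sa n1 n2 n3]]; split => //.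
  split => [x|x|g] /=; rewrite /sec1 /obj0 /Tmap /=.
  + by rewrite src_one n1.
  + by rewrite tgt_one n2.
  + have := n3 g; rewrite /tmul /obj1 /Tmul /= => ->.
    by rewrite mul1 mulg1.
Qed.

Definition hat_field (v : obj G) (al : G0 G -> functional (G1 G)) :
    G1 G -> functional (G1 G) :=
  fun g => tmul (one (lt g)) g (al (lt g)) (v.2 g).

(* A morphism [al : v => w] is recorded by the vector field [al(t g) v(g) =
   w(g) al(s g)] on [G1]. *)
Definition morphism_field (v : obj G) H (w : obj G) : Prop :=
  [/\ smooth_section id H, src_related H v.1, tgt_related H w.1,
      mul_related H v.2 H & mul_related w.2 H H].

Lemma morphism_field_sec v H w : morphism_field v H w ->
  field_morphism v (H \o one) w.
Proof.
move=> [sH rs rt m1 m2]; split.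
- have sone : smooth one by exact: (@lgunit_smooth R G).
  exact: smooth_section_precomp h0 h1 h1 sone sH.
- by move=> x; rewrite /= rs src_one.
- by move=> x; rewrite /= rt tgt_one.
- move=> g /=; rewrite -m1; last by rewrite src_one.
  by rewrite -m2; [rewrite mul1 mulg1|rewrite tgt_one].
Qed.

Lemma morphism_field_hat v H w : morphism_field v H w -> hat_field v (H \o one) = H.
Proof.
move=> [_ _ _ m1 _]; apply/funext => g; rewrite /hat_field /= -m1 ?src_one//.
by rewrite mul1.
Qed.

Section Hat.
Variables (v w : obj G) (al : G0 G -> functional (G1 G)).
Hypotheses (mv : mult_field v) (mw : mult_field w) (fal : field_morphism v al w).

Lemma sec_comp_left g : composable_tangent (one (lt g)) g (al (lt g)) (v.2 g).
Proof.
have [_ [_ tv _] [_ rt] _ _] := mv; have [[_ ta _] a1 _ _] := fal.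
by split; [exact: src_one|exact: ta|exact: tv|rewrite a1 rt].
Qed.

Lemma sec_comp_right g : composable_tangent g (one (ls g)) (w.2 g) (al (ls g)).
Proof.
have [_ [_ tw _] [rs _] _ _] := mw; have [[_ ta _] _ a2 _] := fal.
by split; [rewrite tgt_one|exact: tw|exact: ta|rewrite a2 rs].
Qed.

(** A multiplicative field takes unit values at units, so at [one x] the factor [v] is the unit of
    [TG] at the source of [al x]. *)
Lemma hat_field_sec : hat_field v al \o one = al.
Proof.
have [_ _ _ vone _] := mv; have [[_ ta _] a1 _ _] := fal.
apply/funext => x; rewrite /hat_field /= tgt_one -vone -a1.
by have := tmul1r (ta x); rewrite src_one.
Qed.

(** Associativity in [TG] applied to [al(t g) v(g)] gives the relation with [v]; applied to the
    second expression [w(g) al(s g)], which is naturality, it gives the relation with [w]. *)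
Lemma hat_morphism_field : morphism_field v (hat_field v al) w.
Proof.
have [_ sv [vs vt] _ mulv] := mv; have [_ sw [ws wt] _ mulw] := mw.
have [sal a1 a2 nat] := fal.
have hatE g : hat_field v al g = tmul g (one (ls g)) (w.2 g) (al (ls g)) by
  exact: nat.
split.
- have sone : smooth one by exact: (@lgunit_smooth R G).
  have sat := smooth_section_precomp h1 h0 h1 tgt_smooth sal.
  apply: smooth_section_eq (smooth_tmul h1 sat sv _ _) => g /=.
  + exact: mul1.
  + by [].
  + exact: src_one.
  + by rewrite a1 vt.
- by move=> g; rewrite /hat_field -{1}(mul1 g) (tmul_src (sec_comp_left g)) vs.
- move=> g; rewrite /hat_field -{1}(mul1 g) (tmul_tgt (sec_comp_left g)) a2.
  by [].
- move=> g h gh; rewrite {1}/hat_field tgt_mul// mulv//.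
  have c1 := composable_fields sv sv vs vt gh.
  have := tmulA (sec_comp_left g) c1; by rewrite mul1.
- move=> g h gh; rewrite hatE src_mul// mulw//.
  have c1 := composable_fields sw sw ws wt gh.
  have := tmulA c1 (sec_comp_right h); rewrite mulg1 => <-.
  by rewrite -hatE.
Qed.

End Hat.

Lemma obj_bracket_mult v w : mult_field v -> mult_field w -> mult_field
  (obj_bracket v w).
Proof.
move=> [sv0 sv1 [vs vt] vu vm] [sw0 sw1 [ws wt] wu wm]; split => /=.
- exact: smooth_section_bracket h0 sv0 sw0.
- exact: smooth_section_bracket h1 sv1 sw1.
- by split; [exact: src_related_bracket|exact: tgt_related_bracket].
- have sone : smooth one by exact: (@lgunit_smooth R G).
  exact: (related_bracket h0 h1 sone sv0 sw0 sv1 sw1 vu wu).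
- exact: (mul_related_bracket sv1 sv1 sv1 sw1 sw1 sw1 vs vt ws wt vm wm).
Qed.

Lemma morphism_field_bracket v H w v' H' w' :
  mult_field v -> mult_field w -> mult_field v' -> mult_field w' ->
  morphism_field v H w -> morphism_field v' H' w' ->
  morphism_field (obj_bracket v v') (vf_bracket H H') (obj_bracket w w').
Proof.
move=> [sv0 sv1 [vs vt] vu vm] [sw0 sw1 [ws wt] wu wm].
move=> [sv0' sv1' [vs' vt'] vu' vm'] [sw0' sw1' [ws' wt'] wu' wm'].
move=> [sH Hs Ht m1 m2] [sH' Hs' Ht' m1' m2']; split => /=.
- exact: smooth_section_bracket h1 sH sH'.
- exact: src_related_bracket.
- exact: tgt_related_bracket.
- exact: (mul_related_bracket sH sv1 sH sH' sv1' sH' Hs vt Hs' vt' m1 m1').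
- exact: (mul_related_bracket sw1 sH sH sw1' sH' sH' ws Ht ws' Ht' m2 m2').
Qed.

Lemma obj_lin1 a (v w : obj G) : (a *: v + w).1 = a *: v.1 + w.1.
Proof. by []. Qed.

Lemma obj_lin2 a (v w : obj G) : (a *: v + w).2 = a *: v.2 + w.2.
Proof. by []. Qed.

Lemma morphism_field_lin a v H w v' H' w' :
  mult_field v -> mult_field w -> mult_field v' -> mult_field w' ->
  morphism_field v H w -> morphism_field v' H' w' ->
  morphism_field (a *: v + v') (a *: H + H') (a *: w + w').
Proof.
move=> [sv0 sv1 [vs vt] vu vm] [sw0 sw1 [ws wt] wu wm].
move=> [sv0' sv1' [vs' vt'] vu' vm'] [sw0' sw1' [ws' wt'] wu' wm'].
move=> [sH Hs Ht m1 m2] [sH' Hs' Ht' m1' m2'].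
split; rewrite ?obj_lin1 ?obj_lin2.
- exact: (smooth_section_lin a h1 h1 sH sH').
- exact: (src_related_lin a Hs Hs').
- exact: (tgt_related_lin a Ht Ht').
- exact: (mul_related_lin a sH sv1 sH' sv1' Hs vt Hs' vt' m1 m1').
- exact: (mul_related_lin a sw1 sH sw1' sH' ws Ht ws' Ht' m2 m2').
Qed.

Lemma mult_field_lin a v w : mult_field v -> mult_field w -> mult_field (a *: v +
  w).
Proof.
move=> [sv0 sv1 [vs vt] vu vm] [sw0 sw1 [ws wt] wu wm].
split; rewrite ?obj_lin1 ?obj_lin2.
- exact: (smooth_section_lin a h0 h0 sv0 sw0).
- exact: (smooth_section_lin a h1 h1 sv1 sw1).
- by split; [exact: (src_related_lin a vs ws)|exact: (tgt_related_lin a vt wt)].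
- by move=> x; rewrite [LHS]push_lin vu wu.
- exact: (mul_related_lin a sv1 sv1 sw1 sw1 vs vt ws wt vm wm).
Qed.

Lemma mult_field0 : mult_field 0.
Proof.
split.
- exact: (smooth_section0 h0 h0 (smooth_id h0)).
- exact: (smooth_section0 h1 h1 (smooth_id h1)).
- by split=> g; exact: push0.
- by move=> x; exact: push0.
- by move=> g h gh; rewrite [RHS]tmul0.
Qed.

End MultiplicativeFields.

(** * Right-invariant fields and the bracket of morphisms *)

Section MorphismBracket.
Context {R : realType} {G : lieGroupoid R}.

Local Notation ls := (@lgsrc R G).
Local Notation lt := (@lgtgt R G).
Local Notation one := (@lgunit R G).
Local Notation h0 := (G0_manifold G).
Local Notation h1 := (G1_manifold G).
Implicit Types (v w : obj G) (al be : mor G).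

Lemma unit_sec_field v : mult_field v -> unit_sec v = v.2 \o one.
Proof. by move=> [_ _ _ vone _]; apply/funext => x; exact: vone. Qed.

(** Right-invariant fields: [A] is tangent to the source fibres, and [A(gh) = A(g) 0_h] says that it
    is preserved by right translations. *)
Definition right_field (A : G1 G -> functional (G1 G)) : Prop :=
  [/\ smooth_section id A, src_related A 0 & mul_related A 0 A].

Lemma algebroid_sectionE (a : G0 G -> functional (G1 G)) : algebroid_section a ->
  [/\ forall g, right_vf a g = tmul (one (lt g)) g (a (lt g)) 0 & right_vf a \o
    one = a].
Proof.
move=> [/(section_alongP _ _ h0 h1) [_ ta _] a0].
have E g : right_vf a g = tmul (one (lt g)) g (a (lt g)) 0.
  by rewrite /right_vf right_translateE.
split=> //; apply/funext => x; rewrite /= E tgt_one.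
by have := tmul1r (ta x); rewrite a0 push0 src_one.
Qed.

Lemma right_fieldE A : right_field A -> algebroid_section (A \o one) /\ right_vf
  (A \o one) = A.
Proof.
move=> [sA rA mA].
have sone : smooth one by exact: (@lgunit_smooth R G).
have aA : algebroid_section (A \o one).
  split; last by move=> x; rewrite /= rA.
  by apply/(section_alongP _ _ h0 h1); exact: smooth_section_precomp h0 h1 h1
    sone sA.
split=> //; apply/funext => g; have [-> _] := algebroid_sectionE aA.
by rewrite /= -[RHS](congr1 A (mul1 g)) mA // src_one.
Qed.

Lemma right_field_bracket A B : right_field A -> right_field B ->
  right_field (vf_bracket A B).
Proof.
move=> [sA rA mA] [sB rB mB].
have z0 : smooth_section id (0 : G0 G -> functional (G0 G)).
  exact: (smooth_section0 h0 h0 (smooth_id h0)).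
have z1 : smooth_section id (0 : G1 G -> functional (G1 G)).
  exact: (smooth_section0 h1 h1 (smooth_id h1)).
have r0 : tgt_related (0 : G1 G -> functional (G1 G)) 0 by move=> g; exact: push0.
split; first exact: smooth_section_bracket h1 sA sB.
- have := src_related_bracket sA sB z0 z0 rA rB.
  by rewrite vf_bracket_alt.
- have := mul_related_bracket sA z1 sA sB z1 sB rA r0 rB r0 mA mB.
  by rewrite vf_bracket_alt.
Qed.

(** A section is the restriction to the units of its right-invariant field, so every candidate in
    the [xget] is this one. *)
Lemma algebroid_bracketE (a b : G0 G -> functional (G1 G)) :
  right_field (right_vf a) -> right_field (right_vf b) ->
  algebroid_bracket a b = vf_bracket (right_vf a) (right_vf b) \o one.
Proof.
move=> ra rb; have [asec rv] := right_fieldE (right_field_bracket ra rb).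
rewrite /algebroid_bracket; set S := (X in xget 0 X).
have [cs rc] : S (xget 0 S).
  by apply: xgetPex; exists (vf_bracket (right_vf a) (right_vf b) \o one).
by have [_ <-] := algebroid_sectionE cs; rewrite rc.
Qed.

(* In [TG], [al(t g) v(g) = ((al - 1_v)(t g) + 1_v(t g)) (0 + v(g))], and the
   multiplication is linear on composable pairs. *)
Lemma hat_split v (al : G0 G -> functional (G1 G)) w : mult_field v ->
  field_morphism v al w ->
  right_vf (al - unit_sec v) = hat_field v al - v.2.
Proof.
move=> mv fal; have [_ [_ tv _] [vs vt] vone vm] := mv; have [[_ ta _] a1 _ _] :=
  fal.
have E x : (al - unit_sec v) x = al x - v.2 (one x) by rewrite unit_sec_field.
apply/funext => g; rewrite /right_vf E.
have tav : tangent_vector (one (lt g)) (al (lt g) - v.2 (one (lt g))).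
  rewrite addrC -scaleN1r; exact: (tangent_lin (-1) h1 (tv _) (ta _)).
have sav : push ls (one (lt g)) (al (lt g) - v.2 (one (lt g))) = 0.
  by rewrite addrC -scaleN1r push_lin a1 vs src_one scaleN1r addrC subrr.
rewrite right_translateE//.
have c1 : composable_tangent (one (lt g)) g (v.2 (one (lt g))) (v.2 g).
  split; [exact: src_one|exact: tv|exact: tv|].
  by rewrite vs vt src_one.
have c2 := sec_comp_left mv fal g.
rewrite addrC -scaleN1r -[X in tmul _ _ _ X](_ : (-1) *: v.2 g + v.2 g = 0); last
  first.
  by rewrite scaleN1r addrC subrr.
rewrite (tmul_lin (-1) c1 c2) -vm; last exact: src_one.
by rewrite mul1 scaleN1r addrC.
Qed.

(** Both [H = hat_field v al] and [v.2] are source-related to [v.1] and have [v.2] as right factor;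
    in [H - v.2] these two data cancel to 0. *)
Lemma hat_right_field v (al : G0 G -> functional (G1 G)) w : mult_field v ->
  mult_field w ->
  field_morphism v al w -> right_field (right_vf (al - unit_sec v)).
Proof.
move=> mv mw fal; rewrite (hat_split mv fal).
have [sH Hs Ht m1 _] := hat_morphism_field mv mw fal.
have [_ sv [vs vt] _ vm] := mv.
have E (T : lmodType R) (a b : T) : a - b = (-1) *: b + a by rewrite scaleN1r addrC.
have Z (T : lmodType R) (b : T) : (-1) *: b + b = 0 by rewrite scaleN1r addrC subrr.
rewrite E; split.
- exact: (smooth_section_lin (-1) h1 h1 sv sH).
- by have := src_related_lin (-1) vs Hs; rewrite Z.
- by have := mul_related_lin (-1) sv sv sH sv vs vt Hs vt vm m1; rewrite Z.
Qed.

Definition hat al := hat_field (src al) (sec al).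

Definition field_bracket al be : mor G :=
  (obj_bracket (src al) (src be), vf_bracket (hat al) (hat be) \o one,
   obj_bracket (tgt al) (tgt be)).

Lemma X1_field al : X1 al -> morphism_field (src al) (hat al) (tgt al).
Proof. by move=> /X1P[mv mw fal]; exact: hat_morphism_field. Qed.

Lemma hat_sec al : X1 al -> hat al \o one = sec al.
Proof. by move=> /X1P[mv mw fal]; exact: hat_field_sec mv fal. Qed.

Lemma X1_of_field v H w : mult_field v -> mult_field w -> morphism_field v H w ->
  X1 (v, H \o one, w) /\ hat (v, H \o one, w) = H.
Proof.
move=> mv mw mH; split; last exact: morphism_field_hat mH.
by apply/X1P; split => //; exact: morphism_field_sec.
Qed.

Lemma field_bracketP al be : X1 al -> X1 be ->
  X1 (field_bracket al be) /\ hat (field_bracket al be) = vf_bracket (hat al)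
    (hat be).
Proof.
move=> xal xbe; have Ha := X1_field xal; have Hb := X1_field xbe.
have [mv mw _] := (X1P _).1 xal; have [mv' mw' _] := (X1P _).1 xbe.
apply: X1_of_field.
- exact: obj_bracket_mult.
- exact: obj_bracket_mult.
- exact: (morphism_field_bracket mv mw mv' mw' Ha Hb).
Qed.

Lemma split_field_bracket al be : X1 al -> X1 be ->
  split_mor (field_bracket al be) = split_bracket (split_mor al) (split_mor be).
Proof.
move=> xal xbe; have [mv mw fa] := (X1P _).1 xal; have [mv' mw' fb] := (X1P _).1
  xbe.
rewrite /split_mor /split_bracket /=; congr (_, _).
set a := sec al - unit_sec (src al); set b := sec be - unit_sec (src be).
change (vf_bracket (hat al) (hat be) \o one - unit_sec (obj_bracket (src al) (src
  be)) =
  algebroid_bracket a b + deriv_action (src al) b - deriv_action (src be) a).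
have ra := hat_right_field mv mw fa; have rb := hat_right_field mv' mw' fb.
rewrite (unit_sec_field (obj_bracket_mult mv mv')) (algebroid_bracketE ra rb).
have [sra _ _] := ra; have [srb _ _] := rb.
have [_ sv _ _ _] := mv; have [_ sv' _ _ _] := mv'.
have Ea : hat al = 1 *: right_vf a + (src al).2.
  by rewrite scale1r (hat_split mv fa) subrK.
have Eb : hat be = 1 *: right_vf b + (src be).2.
  by rewrite scale1r (hat_split mv' fb) subrK.
have shb : smooth_section id (1 *: right_vf b + (src be).2).
  exact: (smooth_section_lin 1 h1 h1 srb sv').
(* Bilinear expansion of [[a + v, b + v']]; on the units the summand [[v, v']] becomes the unit
   section of the bracket of the sources, which [split_mor] subtracts. *)
have key : vf_bracket (hat al) (hat be) = vf_bracket (right_vf a) (right_vf b) +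
    vf_bracket (src al).2 (right_vf b) - vf_bracket (src be).2 (right_vf a) +
    vf_bracket (src al).2 (src be).2.
  rewrite Ea Eb (vf_bracket_linl 1 h1 sra sv shb).
  rewrite (vf_bracket_linr 1 h1 srb sv' sra) (vf_bracket_linr 1 h1 srb sv' sv)
    !scale1r.
  rewrite -(vf_bracket_anti (right_vf a)) addrACA addrA.
  by rewrite [X in X + _](addrAC).
apply/funext => x.
change ((vf_bracket (hat al) (hat be)) (one x) - (vf_bracket (src al).2 (src
  be).2) (one x) =
  vf_bracket (right_vf a) (right_vf b) (one x) +
    vf_bracket (src al).2 (right_vf b) (one x) - vf_bracket (src be).2 (right_vf
      a) (one x)).
rewrite key.
change (vf_bracket (right_vf a) (right_vf b) (one x) +
    vf_bracket (src al).2 (right_vf b) (one x) - vf_bracket (src be).2 (right_vf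
      a) (one x) +
    vf_bracket (src al).2 (src be).2 (one x) - vf_bracket (src al).2 (src be).2
      (one x) =
    vf_bracket (right_vf a) (right_vf b) (one x) +
    vf_bracket (src al).2 (right_vf b) (one x) - vf_bracket (src be).2 (right_vf
      a) (one x)).
by rewrite addrK.
Qed.

(* The source and the section of a morphism determine its target: by linearity,
   [w(g) al(s g) = w'(g) al(s g)] forces [(w - w')(g) 0 = 0]. *)
Lemma X1_unique al be : X1 al -> X1 be -> src al = src be -> sec al = sec be ->
  al = be.
Proof.
move=> /X1P[mv mw fa] /X1P[mv' mw' fb].
case: al mv mw fa => [[v al] w] /= mv mw fa; case: be mv' mw' fb => [[v' al'] w']
  /=.
rewrite /src /sec /tgt /= in mv mw fa * => mv' mw' fb E1 E2; subst v' al'.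
have c1 := sec_comp_right mw fa; have c2 := sec_comp_right mw' fb.
have [_ _ a2 nat] := fa; have [_ _ a2' nat'] := fb.
have E0 : w.1 = w'.1.
  by apply/funext => x; rewrite -a2 -a2'.
have E1 : w.2 = w'.2.
  apply/funext => g.
  have E := tmul_lin (-1) (c1 g) (c2 g).
  rewrite -nat -nat' !scaleN1r [X in _ = X]addrC subrr in E.
  have [_ tw _] := c1 g; have [_ tw' _] := c2 g => _ _.
  have td : tangent_vector g (- w.2 g + w'.2 g).
    by rewrite -scaleN1r; exact: (tangent_lin (-1) h1 tw tw').
  (* Since the difference has source projection 0, the zero vector at [one (ls g)] is its right unit
     in [TG]; its product with 0 is the difference itself. *)
  have sd : push ls g (- w.2 g + w'.2 g) = 0.
    have [_ _ [ws _] _ _] := mw; have [_ _ [ws' _] _ _] := mw'.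
    by rewrite -scaleN1r push_lin ws ws' E0 scaleN1r addrC subrr.
  have := tmul1r td; rewrite sd push0.
  rewrite -[X in tmul _ _ _ X](_ : - al (ls g) + al (ls g) = 0); last by rewrite
    addrC subrr.
  by rewrite E => /eqP; rewrite eq_sym addrC subr_eq0 => /eqP.
by case: w w' E0 E1 {mw mw' fa fb c1 c2 a2 a2' nat nat'} => [? ?] [? ?] /= -> ->.
Qed.

(** [split_mor] determines the source and the section of a morphism, hence the morphism by
    [X1_unique]; the value chosen by [xget] is thus the explicit one. *)
Lemma mor_bracketE al be : X1 al -> X1 be -> mor_bracket al be = field_bracket al
  be.
Proof.
move=> xal xbe; rewrite /mor_bracket; set S := (X in xget 0 X).
have [xb _] := field_bracketP xal xbe.
have sb := split_field_bracket xal xbe.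
have [xd sd] : S (xget 0 S) by apply: xgetPex; exists (field_bracket al be).
have E : split_mor (xget 0 S) = split_mor (field_bracket al be) by rewrite sd sb.
have E1 : src (xget 0 S) = src (field_bracket al be) by exact: (congr1 snd E).
apply: X1_unique => //.
have := congr1 fst E; rewrite /= => E2.
have : sec (xget 0 S) - unit_sec (src (xget 0 S)) =
  sec (field_bracket al be) - unit_sec (src (field_bracket al be)) by exact: E2.
by rewrite E1 => /addIr.
Qed.

Lemma X1_lin a al be : X1 al -> X1 be ->
  X1 (a *: al + be) /\ hat (a *: al + be) = a *: hat al + hat be.
Proof.
move=> xal xbe; have Ha := X1_field xal; have Hb := X1_field xbe.
have [mv mw _] := (X1P _).1 xal; have [mv' mw' _] := (X1P _).1 xbe.
have E : a *: al + be = (a *: src al + src be, (a *: hat al + hat be) \o one,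
    a *: tgt al + tgt be).
  have -> : (a *: hat al + hat be) \o one = a *: sec al + sec be.
    by rewrite -(hat_sec xal) -(hat_sec xbe).
  by [].
rewrite {1 2}E; apply: X1_of_field.
- exact: mult_field_lin.
- exact: mult_field_lin.
- exact: (morphism_field_lin a mv mw mv' mw' Ha Hb).
Qed.

Lemma X1_zero : X1 (0 : mor G).
Proof.
apply/X1P; split; [exact: mult_field0|exact: mult_field0|split].
- exact: (smooth_section0 h0 h1 (@lgunit_smooth R G)).
- by move=> x; exact: push0.
- by move=> x; exact: push0.
- by move=> g; rewrite [LHS]tmul0 ?[RHS]tmul0 ?src_one ?tgt_one.
Qed.

End MorphismBracket.

(** * The Lie 2-algebra *)

Section Composition.
Context {R : realType} {G : lieGroupoid R}.

Local Notation ls := (@lgsrc R G).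
Local Notation lt := (@lgtgt R G).
Local Notation one := (@lgunit R G).
Local Notation h0 := (G0_manifold G).
Local Notation h1 := (G1_manifold G).
Implicit Types (v w : obj G) (al be : mor G).

Lemma comp_morE be al : comp_mor (be, al) =
  (src al, fun x => tmul (one x) (one x) (sec be x) (sec al x), tgt be).
Proof. by []. Qed.

Lemma composable_sec be al x : composable (@X1 R G) (@src R G) (@tgt R G) (be,
  al) ->
  composable_tangent (one x) (one x) (sec be x) (sec al x).
Proof.
move=> [/= /X1P[_ _ fb] /X1P[_ _ fa] E].
have [[_ tb _] b1 _ _] := fb; have [[_ ta _] _ a2 _] := fa.
by split; [rewrite src_one tgt_one|exact: tb|exact: ta|rewrite b1 a2 E].
Qed.

(** The field [be(t g) (al(t g) v(g))], which by associativity is the one attached to the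
    composite. *)
Definition comp_field be al : G1 G -> functional (G1 G) :=
  fun g => tmul (one (lt g)) g (sec be (lt g)) (hat al g).

Lemma comp_fieldP be al : composable (@X1 R G) (@src R G) (@tgt R G) (be, al) ->
  [/\ morphism_field (src al) (comp_field be al) (tgt be),
      mul_related (hat be) (hat al) (comp_field be al) &
      comp_mor (be, al) = (src al, comp_field be al \o one, tgt be)].
Proof.
move=> cba; have [/= xb xa E] := cba.
have [sA As At m1 m2] := X1_field xa; have [sB Bs Bt n1 n2] := X1_field xb.
have [mv mw fa] := (X1P _).1 xa; have [_ mu fb] := (X1P _).1 xb.
have [_ sv [vs vt] _ _] := mv; have [_ sw [ws wt] _ _] := mw.
have [_ su [us ut] _ um] := mu; have [sb b1 b2 _] := fb; have [_ tb _] := sb.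
rewrite E in Bs n1; have [_ tA _] := sA; have [_ tB _] := sB.
have cK g : composable_tangent (one (lt g)) g (sec be (lt g)) (hat al g).
  by split; [exact: src_one|exact: tb|exact: tA|rewrite b1 At E].
have cBw g : composable_tangent (one (lt g)) g (sec be (lt g)) ((tgt al).2 g).
  by have [_ tw _] := sw; split; [exact: src_one|exact: tb|exact: tw|rewrite b1
    wt E].
have BE g : hat be g = tmul (one (lt g)) g (sec be (lt g)) ((tgt al).2 g).
  by rewrite /hat /hat_field E.
(* With [w] the common object and [A = hat al]: [be(t g) (w(g) A(h)) = (be(t g) w(g)) A(h)], and the
   last bracket is [hat be g]. *)
have mBA : mul_related (hat be) (hat al) (comp_field be al).
  move=> g h gh; rewrite /comp_field tgt_mul// m2//.
  have c1 := composable_fields sw sA ws At gh.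
  by have := tmulA (cBw g) c1; rewrite mul1 -BE.
split=> //; last first.
  rewrite comp_morE; congr (_, _, _); apply/funext => x.
  by rewrite /comp_field /= tgt_one -(congr1 (fun f => f x) (hat_sec xa)).
split => //.
- have sbt := smooth_section_precomp h1 h0 h1 tgt_smooth sb.
  apply: smooth_section_eq (smooth_tmul h1 sbt sA _ _) => g /=.
  + exact: mul1.
  + by [].
  + exact: src_one.
  + by rewrite b1 At E.
- by move=> g; rewrite /comp_field -{1}(mul1 g) (tmul_src (cK g)) As.
- by move=> g; rewrite /comp_field -{1}(mul1 g) (tmul_tgt (cK g)) b2.
- move=> g h gh; rewrite {1}/comp_field tgt_mul// m1//.
  have c1 := composable_fields sA sv As vt gh.
  by have := tmulA (cK g) c1; rewrite mul1.
(* With [u] the target of [be]: [u(g) (be(t h) A(h)) = (u(g) be(s g)) A(h)]. Naturality of [be]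
   identifies the last bracket with [hat be g], and [mBA] concludes. *)
- move=> g h gh.
  have c1 := composable_fields su sB us Bt gh.
  have cr := sec_comp_right mu fb.
  have gh' : ls g = lt (one (lt h)) by rewrite tgt_one.
  have Bg : hat be g = tmul g (one (lt h)) ((tgt be).2 g) (sec be (lt h)).
    rewrite -gh; have [_ _ _ nat] := fb; exact: nat.
  have cub : composable_tangent g (one (lt h)) ((tgt be).2 g) (sec be (lt h)).
    by rewrite -gh; exact: cr.
  have Eg : lgmul g (one (lt h)) = g by rewrite -gh mulg1.
  have E2 := tmulA cub (cK h); rewrite mul1 Eg -Bg in E2.
  by rewrite mBA// -E2.
Qed.

Lemma comp_X1 be al : composable (@X1 R G) (@src R G) (@tgt R G) (be, al) ->
  X1 (comp_mor (be, al)) /\ hat (comp_mor (be, al)) = comp_field be al.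
Proof.
move=> cba; have [/= xb xa E] := cba; have [mK _ ->] := comp_fieldP cba.
have [mv _ _] := (X1P _).1 xa; have [_ mu _] := (X1P _).1 xb.
exact: X1_of_field.
Qed.

Lemma composable_bracket (p q : mor G * mor G) :
  composable (@X1 R G) (@src R G) (@tgt R G) p ->
  composable (@X1 R G) (@src R G) (@tgt R G) q ->
  composable (@X1 R G) (@src R G) (@tgt R G)
    (prod_bracket (@mor_bracket R G) (@mor_bracket R G) p q).
Proof.
move=> [xb xa E] [xb' xa' E']; rewrite /prod_bracket.
rewrite (mor_bracketE xb xb') (mor_bracketE xa xa'); split => /=.
- by have [] := field_bracketP xb xb'.
- by have [] := field_bracketP xa xa'.
- by rewrite /field_bracket /src /tgt /= -/(src _) -/(src _) -/(tgt _) -/(tgt _)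
  E E'.
Qed.

Lemma comp_mor_bracket (p q : mor G * mor G) :
  composable (@X1 R G) (@src R G) (@tgt R G) p ->
  composable (@X1 R G) (@src R G) (@tgt R G) q ->
  comp_mor (prod_bracket (@mor_bracket R G) (@mor_bracket R G) p q) =
  mor_bracket (comp_mor p) (comp_mor q).
Proof.
case: p q => [be al] [be' al'] cp cq.
have [/= xb xa E] := cp; have [/= xb' xa' E'] := cq.
have [xc Hc] := comp_X1 cp; have [xc' Hc'] := comp_X1 cq.
have [[sK _ _ _ _] mK _] := comp_fieldP cp; have [[sK' _ _ _ _] mK' _] :=
  comp_fieldP cq.
rewrite (mor_bracketE xc xc') /prod_bracket /= (mor_bracketE xb xb')
  (mor_bracketE xa xa').
rewrite [in RHS]/field_bracket Hc Hc' comp_morE; congr (_, _, _); apply/funext => x.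
have [sA As At _ _] := X1_field xa; have [sB Bs Bt _ _] := X1_field xb.
have [sA' As' At' _ _] := X1_field xa'; have [sB' Bs' Bt' _ _] := X1_field xb'.
rewrite E in Bs; rewrite E' in Bs'.
(* The bracketed relation is evaluated at the composable pair [(one x, one x)], whose product is
   [one x]; there the fields restrict to the sections being composed. *)
have := mul_related_bracket sB sA sK sB' sA' sK' Bs At Bs' At' mK mK'.
move=> /(_ (one x) (one x)); rewrite src_one tgt_one mul11 => /(_ erefl) E3.
exact: (esym E3).
Qed.

End Composition.

Section LieTwoAlgebra.
Context {R : realType} {G : lieGroupoid R}.

Local Notation h0 := (G0_manifold G).
Local Notation h1 := (G1_manifold G).

Lemma objects_lie_algebra : is_lie_algebra (@X0 R G) (@obj_bracket R G).
Proof.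
split.
- exact/X0P/mult_field0.
- by move=> a v w /X0P mv /X0P mw; apply/X0P; exact: mult_field_lin.
- by move=> v w /X0P mv /X0P mw; apply/X0P; exact: obj_bracket_mult.
- move=> a v w u /X0P[v0 v1 _ _ _] /X0P[w0 w1 _ _ _] /X0P[u0 u1 _ _ _].
  congr (_, _); first exact: (vf_bracket_linl a h0 v0 w0 u0).
  exact: (vf_bracket_linl a h1 v1 w1 u1).
- move=> a v w u /X0P[v0 v1 _ _ _] /X0P[w0 w1 _ _ _] /X0P[u0 u1 _ _ _].
  congr (_, _); first exact: (vf_bracket_linr a h0 v0 w0 u0).
  exact: (vf_bracket_linr a h1 v1 w1 u1).
- by move=> v _; rewrite /obj_bracket !vf_bracket_alt.
- move=> v w u /X0P[v0 v1 _ _ _] /X0P[w0 w1 _ _ _] /X0P[u0 u1 _ _ _].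
  congr (_, _); first exact: (vf_jacobi h0 v0 w0 u0).
  exact: (vf_jacobi h1 v1 w1 u1).
Qed.

(** The triple of source, [hat] and target is linear in the morphism and turns the bracket into
    three brackets of fields; restricting the middle one to the units returns the section, so each
    axiom is checked componentwise. *)
Lemma morphisms_lie_algebra : is_lie_algebra (@X1 R G) (@mor_bracket R G).
Proof.
have ho := objects_lie_algebra.
have xs (al : mor G) : X1 al -> X0 (src al) by case.
have xt (al : mor G) : X1 al -> X0 (tgt al) by case.
have closed (al be : mor G) : X1 al -> X1 be -> X1 (mor_bracket al be).
  by move=> xa xb; rewrite mor_bracketE//; have [] := field_bracketP xa xb.
have hatb (al be : mor G) : X1 al -> X1 be -> hat (mor_bracket al be) =
  vf_bracket (hat al) (hat be).
  by move=> xa xb; rewrite mor_bracketE//; have [] := field_bracketP xa xb.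
have sh (al : mor G) : X1 al -> smooth_section id (hat al) by move=> /X1_field[].
have lin (a : R) (al be : mor G) : X1 al -> X1 be -> X1 (a *: al + be).
  by move=> xa xb; have [] := X1_lin a xa xb.
have hatlin (a : R) (al be : mor G) : X1 al -> X1 be -> hat (a *: al + be) = a *:
  hat al + hat be.
  by move=> xa xb; have [] := X1_lin a xa xb.
split => //.
- exact: X1_zero.
- move=> a al be ga xa xb xc; rewrite !mor_bracketE//; last exact: lin.
  rewrite {1}/field_bracket hatlin// (vf_bracket_linl a h1 (sh _ xa) (sh _ xb)
    (sh _ xc)).
  have E1 := lie_linl ho a (xs _ xa) (xs _ xb) (xs _ xc).
  have E2 := lie_linl ho a (xt _ xa) (xt _ xb) (xt _ xc).
  by congr (_, _, _); [exact: E1|exact: E2].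
- move=> a al be ga xa xb xc; rewrite !mor_bracketE//; last exact: lin.
  rewrite {1}/field_bracket hatlin// (vf_bracket_linr a h1 (sh _ xa) (sh _ xb)
    (sh _ xc)).
  have E1 := lie_linr ho a (xs _ xa) (xs _ xb) (xs _ xc).
  have E2 := lie_linr ho a (xt _ xa) (xt _ xb) (xt _ xc).
  by congr (_, _, _); [exact: E1|exact: E2].
- move=> al xa; rewrite mor_bracketE// /field_bracket vf_bracket_alt.
  by rewrite (lie_alt ho (xs _ xa)) (lie_alt ho (xt _ xa)).
- move=> al be ga xa xb xc.
  have step (x y z : mor G) : X1 x -> X1 y -> X1 z -> mor_bracket x (mor_bracket
    y z) =
     (obj_bracket (src x) (obj_bracket (src y) (src z)),
      vf_bracket (hat x) (vf_bracket (hat y) (hat z)) \o @lgunit R G,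
      obj_bracket (tgt x) (obj_bracket (tgt y) (tgt z))).
    move=> xx xy xz; rewrite (mor_bracketE xx (closed _ _ xy xz)) /field_bracket
      hatb//.
    by rewrite (mor_bracketE xy xz).
  rewrite !step//.
  have E1 := lie_jacobi ho (xs _ xa) (xs _ xb) (xs _ xc).
  have E2 := lie_jacobi ho (xt _ xa) (xt _ xb) (xt _ xc).
  have E := vf_jacobi h1 (sh _ xa) (sh _ xb) (sh _ xc).
  congr (_, _, _); [exact: E1| |exact: E2].
  exact: (congr1 (fun f => f \o @lgunit R G) E).
Qed.

Lemma composable_lie_algebra : is_lie_algebra
  (composable (@X1 R G) (@src R G) (@tgt R G))
  (prod_bracket (@mor_bracket R G) (@mor_bracket R G)).
Proof.
have hm := morphisms_lie_algebra.
split.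
- by split => //; exact: X1_zero.
- move=> a [b1 a1] [b2 a2] [/= xb1 xa1 E1] [/= xb2 xa2 E2]; split => /=.
  + exact: lie_lin hm _ _ _ xb1 xb2.
  + exact: lie_lin hm _ _ _ xa1 xa2.
  + by change (a *: src b1 + src b2 = a *: tgt a1 + tgt a2); rewrite E1 E2.
- exact: composable_bracket.
- move=> a p q r [p1 p2 _] [q1 q2 _] [r1 r2 _].
  congr (_, _); [exact: (lie_linl hm a p1 q1 r1)|exact: (lie_linl hm a p2 q2 r2)].
- move=> a p q r [p1 p2 _] [q1 q2 _] [r1 r2 _].
  congr (_, _); [exact: (lie_linr hm a p1 q1 r1)|exact: (lie_linr hm a p2 q2 r2)].
- by move=> p [p1 p2 _]; rewrite /prod_bracket (lie_alt hm p1) (lie_alt hm p2).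
- move=> p q r [p1 p2 _] [q1 q2 _] [r1 r2 _].
  congr (_, _); [exact: (lie_jacobi hm p1 q1 r1)|exact: (lie_jacobi hm p2 q2 r2)].
Qed.

Lemma unit_sec_lin (a : R) (v w : obj G) :
  unit_sec (a *: v + w) = a *: unit_sec v + unit_sec w.
Proof. by apply/funext => x; exact: (push_lin (@lgunit R G) x a (v.1 x) (w.1 x)).
  Qed.

Lemma unit_field (v : obj G) : X0 v ->
  morphism_field v v.2 v /\ unit_mor v = (v, v.2 \o @lgunit R G, v).
Proof.
move=> /X0P mv; have [_ sv [vs vt] _ vm] := mv; split=> //.
by rewrite /unit_mor (unit_sec_field mv).
Qed.

Lemma unit_X1 (v : obj G) : X0 v -> X1 (unit_mor v) /\ hat (unit_mor v) = v.2.
Proof.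
by move=> xv; have [mf ->] := unit_field xv; move/X0P: xv => mv; exact: X1_of_field.
Qed.

End LieTwoAlgebra.

Theorem theorem3p4 (R : realType) (G : lieGroupoid R) :
  @strict_lie_2_algebra R (obj G) (mor G) (@X0 R G) (@X1 R G)
    (@obj_bracket R G) (@mor_bracket R G)
    (@src R G) (@tgt R G) (@unit_mor R G) (@comp_mor R G).
Proof.
have ho := @objects_lie_algebra R G; have hm := @morphisms_lie_algebra R G.
split=> //.
- exact: composable_lie_algebra.
- split=> // [al []//|al be xa xb].
  by rewrite mor_bracketE.
- split=> // [al []//|al be xa xb].
  by rewrite mor_bracketE.
- split=> [v /unit_X1[]//|a v w xv xw|v w xv xw].
  + by rewrite /unit_mor unit_sec_lin.
  + have [xuv huv] := unit_X1 xv; have [xuw huw] := unit_X1 xw.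
    rewrite (mor_bracketE xuv xuw) /field_bracket huv huw.
    have [_ ->] := unit_field (lie_closed ho xv xw).
    by [].
- split=> [[be al] /comp_X1[]//|a [be al] [be' al'] c c'|p q].
  + have [_ _ _] := c; congr (_, _, _); apply/funext => x.
    exact: (tmul_lin a (composable_sec x c) (composable_sec x c')).
  + exact: comp_mor_bracket.
- move=> ga be al cgb cba; rewrite !comp_morE; congr (_, _, _); apply/funext => x.
  have := tmulA (composable_sec x cgb) (composable_sec x cba).
  by rewrite mul11.
(* The unit section of the target at [x] is the unit of [TG] over the target of [al x]; the claim is
   the left unit law of [TG] at [one x]. *)
- move=> al /X1P[_ _ [[_ ta _] _ a2 _]].
  rewrite /unit_mor comp_morE; case: al ta a2 => [[v al] w] /= ta a2.
  congr (_, _, _); apply/funext => x; rewrite /sec /=.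
  have := tmul1l (ta x); rewrite tgt_one a2; exact.
- move=> al /X1P[_ _ [[_ ta _] a1 _ _]].
  rewrite /unit_mor comp_morE; case: al ta a1 => [[v al] w] /= ta a1.
  congr (_, _, _); apply/funext => x; rewrite /sec /=.
  have := tmul1r (ta x); rewrite src_one a1; exact.
Qed.
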